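(* Let $\phi : M^{m}_{s} \rightarrow \mathbb{S}^{n}_{p}(1)$ be a full totally umbilical isometric immersion, let $\bar{g}$ be the metric of $\mathbb{S}^{n}_{p}(1)$, and let $H$ be the mean curvature vector field of $\phi$. Then, up to isometry, the image of $\phi$ is congruent to an open portion of (the image of) one of the following: (1) $\mathbb{S}^{m}_{s}(1) \rightarrow \mathbb{S}^{m+1}_{s}(1) \subset \mathbb{S}^{n}_{p}(1)$; $x \mapsto (x,0)$ (totally geodesic, $H=0$); (2) $\mathbb{S}^{m}_{s}(1) \rightarrow \mathbb{S}^{m+1}_{s+1}(1) \subset \mathbb{S}^{n}_{p}(1)$; $x \mapsto (0,x)$ (totally geodesic, $H=0$); (3) $\mathbb{S}^{m}_{s}(r^2) \rightarrow \mathbb{S}^{m+1}_{s}(1) \subset \mathbb{S}^{n}_{p}(1)$; $x \mapsto (x, \sqrt{1-r^2})$ ($0<r<1$, $\bar{g}(H,H) > 0$); (4) $\mathbb{S}^{m}_{s}(r^2) \rightarrow \mathbb{S}^{m+1}_{s+1}(1) \subset \mathbb{S}^{n}_{p}(1)$; $x \mapsto (\sqrt{r^2-1}, x)$ ($r>1$, $-1 < \bar{g}(H,H) < 0$); (5) $\mathbb{S}^{m}_{s}(1) \rightarrow \mathbb{S}^{m+2}_{s+1}(1) \subset \mathbb{S}^{n}_{p}(1)$; $x \mapsto (1,x,1)$ ($H \neq 0$, $\bar{g}(H,H) = 0$); (6) $\mathbb{H}^{m}_{s}(-r^2) \rightarrow \mathbb{S}^{m+1}_{s+1}(1) \subset \mathbb{S}^{n}_{p}(1)$;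 $x \mapsto (x, \sqrt{1+r^2})$ ($r>0$, $\bar{g}(H,H) < -1$); (7) $\mathbb{E}^{m}_{s} \rightarrow \mathbb{S}^{m+1}_{s+1}(1) \subset \mathbb{S}^{n}_{p}(1)$; $x \mapsto \left(\langle x, x \rangle_{s}-\frac{3}{4},\,x,\,\langle x, x \rangle_{s}-\frac{5}{4}\right)$ ($\bar{g}(H,H) = -1$). Moreover, when $M^{m}_{s}$ is geodesically complete, the image of $\phi$ globally coincides with (the image of) one of the maps (1)--(7).
   Context: $m,n$ are positive integers. $L^m_s$ denotes an $m$-dimensional pseudo-Riemannian manifold of index $s$. $\mathbb{E}^{n}_{p}$ is $\mathbb{R}^n$ with the metric $\langle\cdot,\cdot\rangle_p=-\sum_{i=1}^{p}dx_i^2+\sum_{j=p+1}^{n}dx_j^2$ (the first $p$ coordinates are the negative ones). For $r>0$, $$\mathbb{S}^{n}_{p}(r^2)=\{x\in\mathbb{E}^{n+1}_{p}\mid\langle x,x\rangle_p=r^2\},\qquad \mathbb{H}^{n}_{p}(-r^2)=\{x\in\mathbb{E}^{n+1}_{p+1}\mid\langle x,x\rangle_{p+1}=-r^2\},$$ with the induced metrics (pseudo-sphere and pseudo-hyperbolic space of index $p$). In the listed maps, the components are written in the coordinates of the pseudo-Euclidean space containing the target, and the inclusions $\mathbb{S}^{k}_{q}(1)\subset\mathbb{S}^{n}_{p}(1)$ are the totally geodesic pseudo-subspheres $\{(x_1,\dots,x_q,0,\dots,0,x_{q+1},\dots,x_{k+1})\in\mathbb{S}^n_p(1)\}\cong\mathbb{S}^k_q(1)$.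 For an isometric immersion $\phi:(M,g)\to(\bar M,\bar g)$ of pseudo-Riemannian manifolds with second fundamental form $h$ and mean curvature vector field $H$: $\phi$ is totally geodesic if $h=0$, and totally umbilical if $h(X,Y)=g(X,Y)H$ for all $X,Y\in\Gamma(TM)$. An isometric immersion $\phi:M^m_s\to\mathbb{S}^n_p(1)$ is full if $\phi(M)$ is not contained in any non-degenerate totally geodesic hypersurface of $\mathbb{S}^n_p(1)$. Congruent means equal up to composition with an isometry of the ambient space.
   Formalization: Formalized for M nonempty and connected with 2 ≤ m < n (the claim fails for m = 1, n = m or disconnected M); for complete M the image is a whole connected component of the model, since S^m_m(r²) and H^m_0(-r²) have two sheets (the other models are connected). *)

(* Defs.v *)
From HB Require Import structures.
From mathcomp Require Import all_boot all_order all_algebra.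
From mathcomp Require Import all_classical all_reals all_analysis.

Set Implicit Arguments.
Unset Strict Implicit.
Unset Printing Implicit Defensive.

Import Order.TTheory GRing.Theory Num.Theory.
Import numFieldNormedType.Exports.

Local Open Scope classical_set_scope.
Local Open Scope ring_scope.

(* Vectors of R^N are row vectors 'rV[R]_N. *)

Section Smooth.
Context {R : realType} {V W : normedModType R}.

Fixpoint Ck (k : nat) (U : set V) (f : V -> W) : Prop :=
  (forall x, U x -> {for x, continuous f}) /\
  (if k is k'.+1 then
     forall v, (forall x, U x -> derivable f x v) /\ Ck k' U ('D_v f)
   else True).

(* Meant for U open. *)
Definition smooth_on (U : set V) (f : V -> W) : Prop := forall k, Ck k U f.

(* For an embedded submanifold A of V, every smooth map A -> W extends to a
   neighbourhood of A, and its differential along A does not depend on the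
   extension. *)
Definition smooth_along (A : set V) (f : V -> W) : Prop :=
  exists U : set V, [/\ open U, A `<=` U & smooth_on U f].

End Smooth.

Section PseudoEuclidean.
Context {R : realType}.

Definition mink {N : nat} (p : nat) (x y : 'rV[R]_N) : R :=
  \sum_(i < N) (if (i < p)%N then -1 else 1) * (x 0 i * y 0 i).

(* S^n_p(r^2), where N = n + 1. *)
Definition psphere {N : nat} (p : nat) (r : R) : set 'rV[R]_N :=
  [set x | mink p x x = r ^+ 2].

(* H^n_p(-r^2), where N = n + 1. *)
Definition phyperbolic {N : nat} (p : nat) (r : R) : set 'rV[R]_N :=
  [set x | mink p.+1 x x = - r ^+ 2].

(* Isometries of S^n_p(1), N = n + 1; the tangent space at x is the
   orthogonal complement of x. *)
Definition psphere_isometry {N : nat} (p : nat) (Psi : 'rV[R]_N -> 'rV[R]_N) : Prop :=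
  let S : set 'rV[R]_N := psphere p 1 in
  smooth_along S Psi /\
  (exists Phi : 'rV[R]_N -> 'rV[R]_N,
     [/\ smooth_along S Phi,
         forall x, S x -> S (Psi x) /\ Phi (Psi x) = x &
         forall x, S x -> S (Phi x) /\ Psi (Phi x) = x]) /\
  (forall x v w, S x -> mink p v x = 0 -> mink p w x = 0 ->
     mink p ('D_v Psi x) ('D_w Psi x) = mink p v w).

(* (x_1, ..., x_a) |-> (x_1, ..., x_q, 0, ..., 0, x_{q+1}, ..., x_a). *)
Definition insert0 {a : nat} (b q : nat) (x : 'rV[R]_a) : 'rV[R]_b :=
  x *m \matrix_(i < a, j < b)
         (nat_of_ord j == if (i < q)%N then nat_of_ord i else (i + (b - a))%N)%:R.

Definition gram_form {m : nat} (G : 'M[R]_m) (v w : 'rV[R]_m) : R :=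
  (v *m G *m w^T) 0 0.

(* The subspaces of R^m are the row spaces of the matrices B : 'M_m. *)
Definition negative_definite_on {m : nat} (G B : 'M[R]_m) : Prop :=
  forall v : 'rV[R]_m, (v <= B)%MS -> v != 0 -> gram_form G v v < 0.

Definition has_index {m : nat} (G : 'M[R]_m) (s : nat) : Prop :=
  (exists B : 'M[R]_m, negative_definite_on G B /\ \rank B = s) /\
  (forall B : 'M[R]_m, negative_definite_on G B -> (\rank B <= s)%N).

End PseudoEuclidean.

(* ccoord is only meaningful on cdom, and cpar (its inverse) on crange. *)
Record chart (R : realType) (M : topologicalType) (m : nat) := Chart {
  cdom : set M;
  crange : set 'rV[R]_m;
  ccoord : M -> 'rV[R]_m;
  cpar : 'rV[R]_m -> M;
  cdom_open : open cdom;
  crange_open : open crange;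
  ccoordK : forall x, cdom x -> crange (ccoord x) /\ cpar (ccoord x) = x;
  cparK : forall u, crange u -> cdom (cpar u) /\ ccoord (cpar u) = u;
  ccoord_cont : forall x, cdom x -> {for x, continuous ccoord};
  cpar_cont : forall u, crange u -> {for u, continuous cpar} }.

(* Pseudo-Riemannian manifolds of dimension m and index s, not assumed to be
   connected.  The metric is given by its Gram matrices in the charts of the
   atlas: metric k u is the matrix of the metric at cpar k u with respect to
   the coordinate frame of k. *)
Record pseudoRiemannian (R : realType) (m s : nat) := PseudoRiemannian {
  carrier :> topologicalType;
  pR_hausdorff : hausdorff_space carrier;
  pR_second_countable : @second_countable carrier;
  atlas : set (chart R carrier m);
  atlas_cover : forall x : carrier, exists2 k, atlas k & cdom k x;
  atlas_smooth : forall k l, atlas k -> atlas l ->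
    smooth_on (crange k `&` cpar k @^-1` cdom l) (ccoord l \o cpar k);
  metric : chart R carrier m -> 'rV[R]_m -> 'M[R]_m;
  metric_smooth : forall k, atlas k -> smooth_on (crange k) (metric k);
  metric_symmetric : forall k u, atlas k -> crange k u ->
    (metric k u)^T = metric k u;
  metric_nondegenerate : forall k u, atlas k -> crange k u ->
    metric k u \in unitmx;
  metric_index : forall k u, atlas k -> crange k u -> has_index (metric k u) s;
  metric_compat : forall k l u v w, atlas k -> atlas l ->
    crange k u -> cdom l (cpar k u) ->
    let tau := ccoord l \o cpar k in
    gram_form (metric k u) v w = gram_form (metric l (tau u)) ('D_v tau u) ('D_w tau u) }.

Arguments atlas {R m s} _ _.
Arguments metric {R m s} _ _ _.

Section LeviCivita.
Context {R : realType} {m s : nat} (M : pseudoRiemannian R m s).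
Implicit Types (k : chart R M m) (u v w : 'rV[R]_m).

(* Coordinate representation at u of the covariant derivative, along v, of
   the vector field with constant coordinates w, i.e., the vector with entries
   \sum_(i, j) Gamma^l_ij v_i w_j (Koszul formula). *)
Definition christoffel k u v w : 'rV[R]_m :=
  let g := metric M k in
  (\row_(l < m)
     (2^-1 * ('D_v (fun a => gram_form (g a) w (delta_mx 0 l)) u
              + 'D_w (fun a => gram_form (g a) v (delta_mx 0 l)) u
              - 'D_(delta_mx 0 l) (fun a => gram_form (g a) v w) u)))
  *m invmx (g u).

Definition is_geodesic (c : R -> M) : Prop :=
  continuous c /\
  forall k t, atlas M k -> cdom k (c t) ->
    let y : R -> 'rV[R]_m := ccoord k \o c in
    let y' := derive1 y in
    [/\ derivable y t 1, derivable y' t 1 &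
        derive1 y' t = - christoffel k (y t) (y' t) (y' t)].

(* The exponential map is defined on the whole tangent bundle. *)
Definition geodesically_complete : Prop :=
  forall k u v, atlas M k -> crange k u ->
    exists c : R -> M,
      [/\ is_geodesic c, c 0 = cpar k u & derive1 (ccoord k \o c) 0 = v].

End LeviCivita.

Section Immersions.
Context {R : realType} {m s : nat} (M : pseudoRiemannian R m s) (n p : nat).
Variable phi : M -> 'rV[R]_n.+1.
Implicit Types (k : chart R M m) (u v w : 'rV[R]_m).

(* Isometric immersion of M into S^n_p(1). *)
Definition isometric_immersion : Prop :=
  (forall x, psphere p 1 (phi x)) /\
  forall k, atlas M k ->
    let f := phi \o cpar k in
    smooth_on (crange k) f /\
    forall u, crange k u ->
      (forall v, 'D_v f u = 0 -> v = 0) /\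
      (forall v w, mink p ('D_v f u) ('D_w f u) = gram_form (metric M k u) v w).

(* The Levi-Civita connection of S^n_p(1), applied to the vector field
   dphi(w) along phi: it is the flat derivative of E^{n+1}_p followed by the
   orthogonal projection to the tangent space of S^n_p(1), that is, to the
   orthogonal complement of f u, where <f u, f u> = 1. *)
Definition ambient_nabla k u v w : 'rV[R]_n.+1 :=
  let f := phi \o cpar k in
  let a := 'D_v ('D_w f) u in
  a - mink p a (f u) *: f u.

(* Gauss formula: h(X, Y) is the difference between the ambient covariant
   derivative of dphi(Y) along X and the image by dphi of that of M.  By
   tensoriality it is enough to use fields with constant coordinates. *)
Definition second_fundamental_form k u v w : 'rV[R]_n.+1 :=
  ambient_nabla k u v w - 'D_(christoffel k u v w) (phi \o cpar k) u.

Definition mean_curvature k u : 'rV[R]_n.+1 :=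
  m%:R^-1 *: \sum_(i < m) \sum_(j < m)
    invmx (metric M k u) i j *:
      second_fundamental_form k u (delta_mx 0 i) (delta_mx 0 j).

Definition totally_geodesic : Prop :=
  forall k u v w, atlas M k -> crange k u ->
    second_fundamental_form k u v w = 0.

Definition totally_umbilical : Prop :=
  forall k u v w, atlas M k -> crange k u ->
    second_fundamental_form k u v w = gram_form (metric M k u) v w *: mean_curvature k u.

Definition H_everywhere (P : 'rV[R]_n.+1 -> Prop) : Prop :=
  forall k u, atlas M k -> crange k u -> P (mean_curvature k u).

End Immersions.

Section Full.
Context {R : realType} {m s : nat} (M : pseudoRiemannian R m s) (n p : nat).
Variable phi : M -> 'rV[R]_n.+1.

(* The induced metric of a non-degenerate hypersurface makes it a
   pseudo-Riemannian manifold of some index t. *)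
Definition full : Prop :=
  forall (t : nat) (N : pseudoRiemannian R n.-1 t) (psi : N -> 'rV[R]_n.+1),
    isometric_immersion p psi -> totally_geodesic p psi ->
    ~ (range phi `<=` range psi).

End Full.

Definition open_portion (T : topologicalType) (Q O : set T) : Prop :=
  exists2 U : set T, open U & O = Q `&` U.

(* The quadrics S^m_m(r^2) and H^m_0(-r^2) have two connected components, of
   which a connected manifold can only cover one; the other models are
   connected, so that O = Q for them. *)
Definition whole_portion (T : topologicalType) (Q O : set T) : Prop :=
  exists2 x, Q x & O = connected_component Q x.

Section Models.
Context {R : realType} {m s : nat} (M : pseudoRiemannian R m s) (n p : nat).
Variable phi : M -> 'rV[R]_n.+1.
Variable portion : forall T : topologicalType, set T -> set T -> Prop.

(* S^{b-1}_q(1) is a subsphere of S^n_p(1), and the image of phi is congruent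
   to that of a portion of Q by F : Q -> S^{b-1}_q(1). *)
Definition congruent_to (a b q : nat) (Q : set 'rV[R]_a)
    (F : 'rV[R]_a -> 'rV[R]_b) : Prop :=
  [/\ (q <= p)%N, (q <= b)%N, (b + p <= n.+1 + q)%N &
      exists (Psi : 'rV[R]_n.+1 -> 'rV[R]_n.+1) (O : set 'rV[R]_a),
        [/\ psphere_isometry p Psi, portion Q O &
            range phi = [set Psi (insert0 n.+1 q (F x)) | x in O]]].

Local Notation gHH P := (H_everywhere p phi (fun H => P (mink p H H))).
Local Notation c1 a := (const_mx a : 'rV[R]_1).

Definition model1 : Prop :=
  [/\ congruent_to s (psphere s 1) (fun x : 'rV_m.+1 => row_mx x (c1 0)),
      totally_geodesic p phi & H_everywhere p phi (fun H => H = 0)].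

Definition model2 : Prop :=
  [/\ congruent_to s.+1 (psphere s 1) (fun x : 'rV_m.+1 => row_mx (c1 0) x),
      totally_geodesic p phi & H_everywhere p phi (fun H => H = 0)].

Definition model3 : Prop :=
  exists r : R,
    [/\ 0 < r, r < 1,
        congruent_to s (psphere s r)
          (fun x : 'rV_m.+1 => row_mx x (c1 (Num.sqrt (1 - r ^+ 2)))) &
        gHH (fun a => 0 < a)].

Definition model4 : Prop :=
  exists r : R,
    [/\ 1 < r,
        congruent_to s.+1 (psphere s r)
          (fun x : 'rV_m.+1 => row_mx (c1 (Num.sqrt (r ^+ 2 - 1))) x) &
        gHH (fun a => -1 < a /\ a < 0)].

Definition model5 : Prop :=
  [/\ congruent_to s.+1 (psphere s 1)
        (fun x : 'rV_m.+1 => row_mx (c1 1) (row_mx x (c1 1))),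
      H_everywhere p phi (fun H => H <> 0) & gHH (fun a => a = 0)].

Definition model6 : Prop :=
  exists r : R,
    [/\ 0 < r,
        congruent_to s.+1 (phyperbolic s r)
          (fun x : 'rV_m.+1 => row_mx x (c1 (Num.sqrt (1 + r ^+ 2)))) &
        gHH (fun a => a < -1)].

Definition model7 : Prop :=
  congruent_to s.+1 [set: 'rV[R]_m]
    (fun x : 'rV_m => row_mx (c1 (mink s x x - 3%:R / 4%:R))
                        (row_mx x (c1 (mink s x x - 5%:R / 4%:R)))) /\
  gHH (fun a => a = -1).

Definition classified : Prop :=
  model1 \/ model2 \/ model3 \/ model4 \/ model5 \/ model6 \/ model7.

End Models.

(* Main.v *)
(* In a chart write f for phi, g for the metric and h = H - f.  For an umbilical
   immersion the Gauss formula says that the flat Hessian of f is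
   tangential + g (x) h, with h normal to f(M) and <h, f> = -1.  Since m >= 2,
   the symmetry of third derivatives (Codazzi) gives dh = - c df with
   c = <h, h> = <H, H> + 1 constant, so that P = h + c f is a constant vector.
   The span of the tangent space and of h satisfies a linear differential
   equation, hence is a constant subspace W of dimension m + 1; therefore f(M)
   lies in the m-dimensional quadric cut out of the sphere by f(x0) + W, and
   it is open there.  Splitting according to the sign of c and c - 1, and,
   when c = 1, according to whether P = 0, an orthonormal frame adapted to W
   and P identifies this quadric with one of the models, and extends to a
   linear isometry of the ambient space.

   The geodesics of the quadric through f(x) with velocity e are
   f(x) + S e + <e, e> C h, where S and C are the sine and versine of curvature
   c <e, e>.  If M is complete, phi maps geodesics of M to these curves, so
   that the range of phi contains a neighbourhood of uniform size of each of
   its points in the quadric: it is open and closed there, hence a component. *)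
Require Import Defs.
From HB Require Import structures.
From mathcomp Require Import all_boot all_order all_algebra.
From mathcomp Require Import all_classical all_reals all_analysis.
From mathcomp Require Import zify ring lra.

Set Implicit Arguments.
Unset Strict Implicit.
Unset Printing Implicit Defensive.

Import Order.TTheory GRing.Theory Num.Theory.
Import numFieldNormedType.Exports.

Local Open Scope classical_set_scope.
Local Open Scope ring_scope.

(** * Differentiability *)

Section Differentiability.
Context {R : realType} {V W : normedModType R}.
Implicit Types f g : V -> W.

(** The overview's h is [xi] on an open set, [chart_xi] in a chart and [normal_xi] on M; its P is
    [center]. In the lemmas on normal vectors, [h] is a fixed test vector. The obstacle is that the
    form is indefinite: h is null when c = 0, so W can be degenerate and has no orthogonal
    projection. Constancy of W is therefore obtained by duality: the products of a fixed vector with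
    the moving frame satisfy a linear equation, so a vector orthogonal to W at one point is so
    everywhere, and W is its own double orthogonal because the ambient form is nondegenerate. For
    the same reason a nonzero tangent vector is not normalised but paired with another one to the
    value 1. Near phi x the quadric is a graph over the tangent space: in y = f + e + b h, b is the
    root of <e, e> + c b^2 = 2 b with c b < 1. Since <y - f, y - f> = 2 b, this threshold reads c <y
    - f, y - f> < 2, an inequality free of frames. It serves both local surjectivity and
    completeness, where 1 - c b > 0 is the value of the generalised cosine at which the geodesic
    arrives. *)

Lemma differentiable_estimate f (L : {linear V -> W}) x : continuous L ->
  (forall e, 0 < e ->
     \forall h \near 0, `|f (h + x) - f x - L h| <= e * `|h|) ->
  differentiable f x.
Proof.
move=> cL est.
have E : f \o shift x = cst (f x) + L +o_ 0 id.
  apply/eqaddoP => e e0; have := est _ e0.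
  apply: filterS => h /= H.
  by rewrite -[(f \o shift x - _) h]/(f (h + x) - (f x + L h)) opprD addrA.
by apply/diff_locallyP; rewrite (diff_unique cL E).
Qed.

Lemma differentiable_small f x e : differentiable f x -> 0 < e ->
  \forall h \near 0, `|f (h + x) - f x - 'd f x h| <= e * `|h|.
Proof.
move=> df e0; have [_ /eqaddoP /(_ _ e0)] := (diff_locallyP _ _).1 df.
apply: filterS => h /=.
by rewrite -[(f \o shift x - _) h]/(f (h + x) - (f x + 'd f x h)) opprD addrA.
Qed.

Lemma near_eq_differentiable f g x :
  (\near x, f x = g x) -> differentiable f x -> differentiable g x.
Proof.
move=> fg df; have fgx := nbhs_singleton fg.
apply: (@differentiable_estimate _ ('d f x)) => [|e e0].
  exact: diff_continuous.
have H : \forall h \near 0, f (h + x) = g (h + x).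
  by move: fg; rewrite (near_shift 0 x) /= subr0.
have S := differentiable_small df e0.
by near=> h; rewrite -fgx -(near H h) //; near: h.
Unshelve. all: by end_near. Qed.

Lemma is_derive_line f (p v : V) (t : R) : derivable f (p + t *: v) v ->
  is_derive t 1 (fun s => f (p + s *: v)) ('D_v f (p + t *: v)).
Proof.
have E : (fun h : R => h^-1 *: (((fun s => f (p + s *: v)) \o shift t) (h *: 1)
    - f (p + t *: v))) = (fun h => h^-1 *: ((f \o shift (p + t *: v)) (h *: v)
    - f (p + t *: v))).
  apply/funext => h /=; congr (_ *: (f _ - _)).
  by rewrite [h *: 1]mulr1 scalerDl addrCA.
by move=> df; split; rewrite /derivable /derive E.
Qed.

(** Only the derivative along [v] is available, so linearity of a differential cannot be used; the
    chain rule is applied to the restriction of [f] to the line, which also covers [a = 0]. *)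
Lemma derive_scale_dir f (x v : V) (a : R) : derivable f x v ->
  is_derive x (a *: v) f (a *: 'D_v f x).
Proof.
move=> df; have : derivable f (x + 0 *: v) v by rewrite scale0r addr0.
move=> /is_derive_line; rewrite scale0r addr0.
set F := fun s : R => _ => -[dF <-].
have dF' : differentiable F (a * 0) by rewrite mulr0; exact/derivable1_diffP.
have dMd : is_derive (0:R) 1 (fun s : R => a * s) a.
  have -> : (fun s : R => a * s) = a *: (id : R -> R) by [].
  by apply: is_derive_eq; rewrite [LHS]mulr1.
have dM' : differentiable (fun s : R => a * s) 0 by apply/derivable1_diffP; case: dMd.
have dM1 : 'd (fun s : R => a * s) 0 1 = a by rewrite -deriveE //; case: dMd.
have : is_derive (0:R) 1 (F \o *%R a) (a *: 'D_1 F 0).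
  split; first by apply/derivable1_diffP; exact: differentiable_comp.
  rewrite deriveE; last exact: differentiable_comp.
  rewrite diff_comp //= dM1 mulr0 deriveE; last by rewrite -(mulr0 a).
  by rewrite -[a in LHS]mulr1 linearZ.
have E : (fun h : R => h^-1 *: (((F \o *%R a) \o shift 0) (h *: 1) -
    (F \o *%R a) 0)) = (fun h => h^-1 *: ((f \o shift x) (h *: (a *: v)) - f x)).
  apply/funext => h /=; rewrite /F mulr0 scale0r !addr0 [h *: 1]mulr1.
  by congr (_ *: (f _ - _)); rewrite scalerA addrC [a * h]mulrC.
by case; rewrite /derivable /derive E => d1 d2; split.
Qed.

End Differentiability.

Lemma line_MVT {R : realType} {V : normedModType R} (f : V -> R) (p v : V) :
  (forall t : R, 0 <= t <= 1 -> derivable f (p + t *: v) v) ->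
  exists2 t : R, 0 <= t <= 1 & f (p + v) - f p = 'D_v f (p + t *: v).
Proof.
move=> df; set F := fun s : R => f (p + s *: v).
have dF (t : R) : 0 <= t <= 1 -> is_derive t 1 F ('D_v f (p + t *: v)).
  by move=> /df; exact: is_derive_line.
have dF01 (t : R) : t \in `]0, 1[ -> is_derive t 1 F ('D_v f (p + t *: v)).
  by rewrite in_itv /= => /andP[/ltW t0 /ltW t1]; apply: dF; rewrite t0 t1.
have cF : {within `[0, 1], continuous F}.
  by apply: derivable_within_continuous => s; rewrite in_itv /= => /dF [].
have [t] := MVT_segment ler01 dF01 cF.
rewrite in_itv /= => t01; rewrite /F scale1r scale0r addr0 subr0 mulr1 => ->.
by exists t.
Qed.

Section RowNorm.
Context {R : realType}.

Lemma coord_le_norm m n (x : 'M[R]_(m, n)) i j : `|x i j| <= `|x|.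
Proof.
by rewrite [leRHS]/Num.Def.normr /= mx_normrE; exact: (le_bigmax _ _ (i, j)).
Qed.

Lemma norm_le_coord m n (x : 'M[R]_(m, n)) c : 0 <= c ->
  (forall i j, `|x i j| <= c) -> `|x| <= c.
Proof.
move=> c0 H; rewrite [leLHS]/Num.Def.normr /= mx_normrE.
by apply: bigmax_le => // -[i j] _; exact: H.
Qed.

Lemma differentiable_mx (V : normedModType R) m n (f : V -> 'M[R]_(m, n)) x :
  (forall i j, differentiable (fun y => f y i j) x) -> differentiable f x.
Proof.
move=> df.
rewrite (_ : f = \sum_(i < m) \sum_(j < n) (fun y => f y i j *: delta_mx i j)).
  apply: differentiable_sum => i; apply: differentiable_sum => j.
  exact: differentiableZl.
apply/funext => y; rewrite {1}[f y]matrix_sum_delta fct_sumE.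
by apply: eq_bigr => i _; rewrite fct_sumE.
Qed.

Lemma differentiable_entry (V : normedModType R) m n (f : V -> 'M[R]_(m, n)) x i j :
  differentiable f x -> differentiable (fun y => f y i j) x.
Proof.
move=> df.
exact: (@differentiable_comp _ _ _ _ f (fun N : 'M[R]_(m, n) => N i j) x df
          (differentiable_coord (f x) i j)).
Qed.

End RowNorm.

Section C1.
Context {R : realType} {m : nat}.
Local Notation e_ j := (delta_mx 0 j : 'rV[R]_m).

Lemma linear_form_continuous (A : 'cV[R]_m) :
  continuous (fun h : 'rV[R]_m => (h *m A) 0 0).
Proof.
move=> h; apply: differentiable_continuous.
rewrite (_ : (fun _ => _) = \sum_(j < m) (A j 0 *: (fun h : 'rV[R]_m => h 0 j : R))).
  apply: differentiable_sum => j; apply: differentiableZ.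
  exact: differentiable_coord.
apply/funext => k; rewrite mxE fct_sumE; apply: eq_bigr => j _.
by rewrite mulrC.
Qed.

(** The increment h is taken one coordinate at a time; by the mean value theorem each edge
    contributes a partial derivative at a point of the ball, which differs from the one at [u] by at
    most [e1]. *)
Lemma C1_differentiable_scalar (U : set 'rV[R]_m) (f : 'rV[R]_m -> R) u :
  open U -> U u ->
  (forall x j, U x -> derivable f x (e_ j)) ->
  (forall j, {for u, continuous ('D_(e_ j) f)}) ->
  differentiable f u.
Proof.
move=> oU Uu df cdf.
pose A : 'cV[R]_m := \col_j 'D_(e_ j) f u.
pose L0 := fun h : 'rV[R]_m => (h *m A) 0 0.
have Llin : linear L0 by move=> a x y; rewrite /L0 mulmxDl -scalemxAl !mxE.
pose LM := GRing.isLinear.Build _ _ _ _ _ Llin.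
pose L : {linear 'rV[R]_m -> R} := HB.pack L0 LM.
apply: (@differentiable_estimate _ _ _ f L); first exact: linear_form_continuous.
(* The m edges add up to at most m e1 |h| <= e |h|; the divisor m + 1 is never zero. *)
move=> e e0; pose e1 := e / (m.+1)%:R.
have e10 : 0 < e1 by rewrite divr_gt0.
have [d /= d0 Hd] : exists2 d : R, 0 < d & forall x, ball u d x ->
    U x /\ forall j, `|'D_(e_ j) f x - 'D_(e_ j) f u| <= e1.
  have : \forall x \near u, U x /\ forall j, `|'D_(e_ j) f x - 'D_(e_ j) f u| <= e1.
    near=> x; split; first by near: x; exact: open_nbhs_nbhs.
    near: x; apply: filter_forall => j.
    move: (cdf j) => /cvgrPdist_le /(_ _ e10).
    by apply: filterS => x; rewrite distrC.
  by move=> /nbhs_ballP [d d0 H]; exists d.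
near=> h.
have hd : `|h| < d.
  by near: h; apply/nbhs_ballP; exists d => //= x; rewrite -ball_normE /= sub0r normrN.
(* [pk k] keeps the first k coordinates of h: these are the vertices of the path from 0 to h. *)
pose pk k : 'rV[R]_m := \row_j (if (j < k)%N then h 0 j else 0).
have pkS (k : nat) (km : (k < m)%N) :
    pk k.+1 = pk k + h 0 (Ordinal km) *: e_ (Ordinal km).
  apply/rowP => j; rewrite !mxE eqxx /= ltnS leq_eqVlt.
  have [->|jk] := eqVneq j (Ordinal km); first by rewrite eqxx /= ltnn add0r mulr1.
  by rewrite mulr0 addr0 -val_eqE /= in jk *; rewrite (negPf jk).
have pk0 : pk 0 = 0 by apply/rowP => j; rewrite !mxE.
have pkm : pk m = h by apply/rowP => j; rewrite !mxE ltn_ord.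
suff est (k : nat) : (k <= m)%N ->
    `|f (u + pk k) - f u - (pk k *m A) 0 0| <= k%:R * (e1 * `|h|).
  have := est m (leqnn m); rewrite pkm (addrC u h) => /le_trans; apply.
  rewrite mulrA ler_wpM2r // /e1 mulrCA -{2}(mulr1 e) ler_pM2l //.
  by rewrite ler_pdivrMr // mul1r ler_nat.
elim: k => [_|k IH km].
  by rewrite pk0 addr0 subrr mul0mx mxE subrr normr0 mul0r.
set j := Ordinal km.
have pt (t : R) : 0 <= t <= 1 -> ball u d (u + pk k + t *: (h 0 j *: e_ j)).
  move=> /andP[t0 t1]; rewrite -ball_normE /= -addrA opprD addrA subrr sub0r normrN.
  apply: le_lt_trans hd; apply: norm_le_coord => // i0 i; rewrite ord1 !mxE eqxx /=.
  have [->|ij] := eqVneq i j.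
    rewrite /= ltnn add0r mulr1 normrM ger0_norm //.
    by apply: le_trans (coord_le_norm h 0 j); rewrite ler_piMl.
  rewrite !mulr0 addr0; case: ifP => _; first exact: coord_le_norm.
  by rewrite normr0.
have [t t01] : exists2 t : R, 0 <= t <= 1 & f (u + pk k + h 0 j *: e_ j) - f (u + pk k) =
    'D_(h 0 j *: e_ j) f (u + pk k + t *: (h 0 j *: e_ j)).
  apply: line_MVT => t /pt /Hd [Ux _].
  by have [] := @derive_scale_dir _ _ _ f _ _ (h 0 j) (df _ j Ux).
have [Ux Dx] := Hd _ (pt _ t01).
have [_ ->] := @derive_scale_dir _ _ _ f _ _ (h 0 j) (df _ j Ux).
move=> E; rewrite pkS mulmxDl -scalemxAl -rowE.
set D := 'D__ f _ in E; have := Dx j; rewrite -/D => Dj.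
have -> : f (u + (pk k + h 0 j *: e_ j)) - f u - (pk k *m A + h 0 j *: row j A) 0 0 =
  (f (u + pk k) - f u - (pk k *m A) 0 0) + h 0 j * (D - 'D_(e_ j) f u).
  rewrite addrA -[f (u + pk k + _)](subrK (f (u + pk k))) E.
  have -> : (pk k *m A + h 0 j *: row j A) 0 0 = (pk k *m A) 0 0 + h 0 j * 'D_(e_ j) f u.
    by rewrite [LHS]mxE; congr (_ + _); rewrite !mxE.
  by rewrite /GRing.scale /=; ring.
apply: le_trans (ler_normD _ _) _.
rewrite -natr1 mulrDl mul1r; apply: lerD; first exact: IH (ltnW km).
by rewrite normrM mulrC ler_pM // coord_le_norm.
Unshelve. all: by end_near. Qed.

Lemma derivable_entry {V : normedModType R} p q (f : V -> 'M[R]_(p, q)) x v i j :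
  derivable f x v -> derivable (fun y => f y i j) x v.
Proof. by move/derivable_mxP. Qed.

Lemma derive_entry {V : normedModType R} p q (f : V -> 'M[R]_(p, q)) x v i j :
  derivable f x v -> 'D_v (fun y => f y i j) x = 'D_v f x i j.
Proof. by move/derive_mx => ->; rewrite mxE. Qed.

Lemma C1_differentiable (U : set 'rV[R]_m) p q (f : 'rV[R]_m -> 'M[R]_(p, q)) u :
  open U -> Ck 1 U f -> U u -> differentiable f u.
Proof.
move=> oU [_ f1] Uu; apply: differentiable_mx => i j.
apply: (C1_differentiable_scalar oU Uu) => [x k Ux|k].
  by apply: derivable_entry; have [] := f1 (e_ k) => + _; exact.
have [df [cf _]] := f1 (e_ k).
have E : \forall y \near u, 'D_(e_ k) f y i j = 'D_(e_ k) (fun y => f y i j) y.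
  have := open_nbhs_nbhs (conj oU Uu); apply: filterS => y Uy.
  by rewrite derive_entry //; exact: df.
rewrite /prop_for /continuous_at -(nbhs_singleton E).
apply: cvg_trans (near_eq_cvg E) _.
apply: (@cvg_comp _ _ _ ('D_(e_ k) f) (fun N : 'M[R]_(p, q) => N i j) _ _ _ (cf _ Uu)).
exact: coord_continuous.
Qed.
End C1.

(** * Symmetry of second derivatives *)

Section Schwarz.
Context {R : realType} {V : normedModType R}.

Lemma is_derive_translate (W : normedModType R) (f : V -> W) (a x v : V) :
  derivable f (x + a) v -> is_derive x v (fun y => f (y + a)) ('D_v f (x + a)).
Proof.
have E : (fun h : R => h^-1 *: (((fun y => f (y + a)) \o shift x) (h *: v)
    - f (x + a))) = (fun h => h^-1 *: ((f \o shift (x + a)) (h *: v)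
    - f (x + a))) by apply/funext => h /=; rewrite addrA.
by move=> df; split; rewrite /derivable /derive E.
Qed.

(** Mean value theorem twice: along v for the function x |-> f (x + h w) - f x, then along w for the
    derivative of f along v. *)
Lemma second_difference (f : V -> R) (u v w : V) (h : R) :
  (forall s t, 0 <= s <= 1 -> 0 <= t <= 1 ->
     derivable f (u + (s * h) *: v + (t * h) *: w) v /\
     derivable ('D_v f) (u + (s * h) *: v + (t * h) *: w) w) ->
  exists s t, [/\ 0 <= s <= 1, 0 <= t <= 1 &
    f (u + h *: v + h *: w) - f (u + h *: v) - (f (u + h *: w) - f u) =
    h ^+ 2 * 'D_w ('D_v f) (u + (s * h) *: v + (t * h) *: w)].
Proof.
move=> df.
have dF (s : R) : 0 <= s <= 1 -> is_derive (u + s *: (h *: v)) (h *: v)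
    ((fun x => f (x + h *: w)) - f) (h *: ('D_v f (u + (s * h) *: v + h *: w) -
       'D_v f (u + (s * h) *: v))).
  move=> s01.
  have [d1 _] := df s 1 s01 (introT andP (conj ler01 (lexx 1))).
  have [d0 _] := df s 0 s01 (introT andP (conj (lexx 0) ler01)).
  rewrite mul1r in d1; rewrite mul0r scale0r addr0 in d0.
  rewrite scalerA scalerBr; apply: is_deriveB; last exact: derive_scale_dir.
  have [d1' <-] := is_derive_translate d1.
  exact: derive_scale_dir.
have [s s01] : exists2 s : R, 0 <= s <= 1 &
    ((fun x => f (x + h *: w)) - f) (u + h *: v) -
    ((fun x => f (x + h *: w)) - f) u =
    'D_(h *: v) ((fun x => f (x + h *: w)) - f) (u + s *: (h *: v)).
  by apply: line_MVT => s /dF [].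
rewrite -!/(_ - f _) !fctE; have [_ ->] := dF _ s01.
move=> E.
have [t t01 E'] : exists2 t : R, 0 <= t <= 1 &
    'D_v f (u + (s * h) *: v + h *: w) - 'D_v f (u + (s * h) *: v) =
    'D_(h *: w) ('D_v f) (u + (s * h) *: v + t *: (h *: w)).
  apply: line_MVT => t t01; have [_ d] := df _ _ s01 t01.
  by rewrite scalerA; have [] := derive_scale_dir h d.
exists s, t; split=> //.
have [_ d] := df _ _ s01 t01; have [_ D] := derive_scale_dir h d.
move: E; rewrite E' scalerA D /GRing.scale /= mulrA -expr2 => <-; ring.
Qed.

(** The mean value theorem yields the two mixed derivatives at two different intermediate points,
    hence the two separate points x and y. *)
Lemma continuous_meet (F G : V -> R) u :
  {for u, continuous F} -> {for u, continuous G} ->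
  (forall d, 0 < d -> exists x y, [/\ ball u d x, ball u d y & F x = G y]) ->
  F u = G u.
Proof.
rewrite /prop_for /continuous_at => /cvgrPdist_le c1 /cvgrPdist_le c2 FG.
apply/eqP; rewrite -subr_eq0 -normr_le0; apply/ler_addgt0Pr => e e0.
have e2 : 0 < e / 2 by rewrite divr_gt0.
have : nbhs u ([set x | `|F u - F x| <= e / 2] `&` [set x | `|G u - G x| <= e / 2]).
  exact: filterI (c1 _ e2) (c2 _ e2).
move=> /nbhs_ballP[d /= d0 Hd].
have [x [y [/Hd [/= Fx _] /Hd [/= _ Gy] E]]] := FG _ d0.
have -> : F u - G u = (F u - F x) + (F x - G u) by rewrite addrA subrK.
rewrite add0r; apply: le_trans (ler_normD _ _) _.
by rewrite [e]splitr lerD // E distrC.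
Qed.

(** The second difference over the parallelogram with sides h v and h w is symmetric in v and w;
    expanding it in both orders and dividing by h^2 gives equal values arbitrarily near u. *)
Lemma schwarz_symmetry (f : V -> R) (U : set V) (u v w : V) :
  open U -> U u ->
  (forall x, U x -> [/\ derivable f x v, derivable f x w,
     derivable ('D_v f) x w & derivable ('D_w f) x v]) ->
  {for u, continuous ('D_w ('D_v f))} ->
  {for u, continuous ('D_v ('D_w f))} ->
  'D_w ('D_v f) u = 'D_v ('D_w f) u.
Proof.
move=> oU Uu df c1 c2; apply: (continuous_meet c1 c2) => d1 d10.
have [d d0 [dd1 Hd]] : exists2 d : R, 0 < d & d <= d1 /\ forall x, ball u d x -> U x.
  have : nbhs u U by exact: open_nbhs_nbhs.
  move=> /nbhs_ballP[d /= d0 H].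
  exists (Num.min d d1); first by rewrite lt_min d0.
  split; first by rewrite ge_min lexx orbT.
  by move=> x xb; apply: H; apply: le_ball xb; rewrite ge_min lexx.
(* Small enough for the whole parallelogram to stay in the ball; the summand 1 keeps the denominator
   positive when v = w = 0. *)
pose h := d / (`|v| + `|w| + 1) / 2.
have n0 : 0 < `|v| + `|w| + 1 by rewrite ltr_wpDl // addr_ge0.
have h0 : 0 < h by rewrite !divr_gt0.
have hd : h * (`|v| + `|w|) < d.
  have -> : d = h * ((`|v| + `|w| + 1) * 2) by rewrite /h; field; rewrite gt_eqF.
  rewrite ltr_pM2l //; have := normr_ge0 v; have := normr_ge0 w; lra.
have inb (s t : R) v' w' : `|v'| + `|w'| = `|v| + `|w| -> 0 <= s <= 1 -> 0 <= t <= 1 ->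
    ball u d (u + (s * h) *: v' + (t * h) *: w').
  move=> E /andP[s0 s1] /andP[t0 t1].
  rewrite -ball_normE /= -addrA opprD addrA subrr sub0r normrN.
  apply: le_lt_trans hd; rewrite -E mulrDr; apply: le_trans (ler_normD _ _) _.
  have n (r : R) (x : V) : 0 <= r -> r <= 1 -> `|(r * h) *: x| <= h * `|x|.
    move=> r0 r1; rewrite normrZ ger0_norm; last by rewrite mulr_ge0 // ltW.
    by rewrite ler_wpM2r // ler_piMl // ltW.
  by apply: lerD; exact: n.
have [s [t [s01 t01 E1]]] : exists s t, [/\ 0 <= s <= 1, 0 <= t <= 1 &
    f (u + h *: v + h *: w) - f (u + h *: v) - (f (u + h *: w) - f u) =
    h ^+ 2 * 'D_w ('D_v f) (u + (s * h) *: v + (t * h) *: w)].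
  apply: second_difference => s t s01 t01.
  by have [d1v _ d2v _] := df _ (Hd _ (inb s t v w erefl s01 t01)); exact: conj d1v d2v.
have [s' [t' [s01' t01' E2]]] : exists s t, [/\ 0 <= s <= 1, 0 <= t <= 1 &
    f (u + h *: w + h *: v) - f (u + h *: w) - (f (u + h *: v) - f u) =
    h ^+ 2 * 'D_v ('D_w f) (u + (s * h) *: w + (t * h) *: v)].
  apply: second_difference => s' t' s01' t01'.
  by have [_ d1w _ d2w] := df _ (Hd _ (inb s' t' w v (addrC _ _) s01' t01')); exact: conj d1w d2w.
exists (u + (s * h) *: v + (t * h) *: w), (u + (s' * h) *: w + (t' * h) *: v).
split.
- exact: le_ball dd1 _ (inb s t v w erefl s01 t01).
- exact: le_ball dd1 _ (inb s' t' w v (addrC _ _) s01' t01').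
apply: (mulfI (lt0r_neq0 (exprn_gt0 2 h0))); rewrite -E1 -E2.
by rewrite (addrAC u (h *: w)); ring.
Qed.

End Schwarz.

(** * Derivatives of matrix-valued maps *)

Section MatrixDerivatives.
Context {R : realType} {V : normedModType R}.

Lemma is_derive_mx m n (f : V -> 'M[R]_(m, n)) x v (df : 'M[R]_(m, n)) :
  (forall i j, is_derive x v (fun y => f y i j) (df i j)) -> is_derive x v f df.
Proof.
move=> H; have d : derivable f x v.
  by apply/derivable_mxP => i j; have [] := H i j.
split=> //; apply/matrixP => i j; rewrite -derive_entry //.
by have [_ ->] := H i j.
Qed.

Lemma is_derive_entry m n (f : V -> 'M[R]_(m, n)) x v (df : 'M[R]_(m, n)) i j :
  is_derive x v f df -> is_derive x v (fun y => f y i j) (df i j).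
Proof.
case=> d <-; split; first exact: derivable_entry.
exact: derive_entry.
Qed.

Lemma is_derive_bigsum (I : Type) (r : seq I) (P : pred I) (F : I -> V -> R) x v
    (dF : I -> R) :
  (forall i, is_derive x v (F i) (dF i)) ->
  is_derive x v (fun y => \sum_(i <- r | P i) F i y) (\sum_(i <- r | P i) dF i).
Proof.
move=> H; elim: r => [|a r IH].
  rewrite big_nil (_ : (fun _ => _) = cst 0); first exact: is_derive_cst.
  by apply/funext => y; rewrite big_nil.
rewrite big_cons; case: ifP => Pa.
  rewrite (_ : (fun _ => _) = F a + (fun y => \sum_(i <- r | P i) F i y)).
    exact: is_deriveD.
  by apply/funext => y; rewrite big_cons Pa.
by move: IH; congr is_derive; apply/funext => y; rewrite big_cons Pa.
Qed.

Lemma is_derive_mulr (f g : V -> R) x v df dg :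
  is_derive x v f df -> is_derive x v g dg ->
  is_derive x v (fun y => f y * g y) (df * g x + f x * dg).
Proof.
move=> Hf Hg; have := is_deriveM Hf Hg.
by rewrite addrC /GRing.scale /= [g x * df]mulrC.
Qed.

Lemma is_derive_mulmx m n p (A : V -> 'M[R]_(m, n)) (B : V -> 'M[R]_(n, p))
    x v dA dB :
  is_derive x v A dA -> is_derive x v B dB ->
  is_derive x v (fun y => A y *m B y) (dA *m B x + A x *m dB).
Proof.
move=> HA HB; apply: is_derive_mx => i j.
rewrite !mxE -big_split /=.
rewrite (_ : (fun _ => _) = fun y => \sum_k A y i k * B y k j).
  by apply: is_derive_bigsum => k; apply: is_derive_mulr; exact: is_derive_entry.
by apply/funext => y; rewrite mxE.
Qed.

Lemma is_derive_trmx m n (A : V -> 'M[R]_(m, n)) x v dA :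
  is_derive x v A dA -> is_derive x v (fun y => (A y)^T) dA^T.
Proof.
move=> HA; apply: is_derive_mx => i j; rewrite mxE.
rewrite (_ : (fun _ => _) = fun y => A y j i); first exact: is_derive_entry.
by apply/funext => y; rewrite mxE.
Qed.

Lemma is_derive_scalemx m n (k : V -> R) (A : V -> 'M[R]_(m, n)) x v dk dA :
  is_derive x v k dk -> is_derive x v A dA ->
  is_derive x v (fun y => k y *: A y) (dk *: A x + k x *: dA).
Proof.
move=> Hk HA; apply: is_derive_mx => i j; rewrite !mxE.
rewrite (_ : (fun _ => _) = fun y => k y * A y i j).
  by apply: is_derive_mulr => //; exact: is_derive_entry.
by apply/funext => y; rewrite mxE.
Qed.

Lemma is_derive_gram_form n (G : 'M[R]_n) (f g : V -> 'rV[R]_n) x v df dg :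
  is_derive x v f df -> is_derive x v g dg ->
  is_derive x v (fun y => gram_form G (f y) (g y))
    (gram_form G df (g x) + gram_form G (f x) dg).
Proof.
move=> Hf Hg; rewrite /gram_form.
have HfG : is_derive x v (fun y => f y *m G) (df *m G).
  have := is_derive_mulmx Hf (is_derive_cst G x v).
  by rewrite mulmx0 addr0.
have := is_derive_mulmx HfG (is_derive_trmx Hg).
by move=> /(is_derive_entry 0 0); rewrite mxE.
Qed.

Lemma differentiable_bigsum (I : Type) (r : seq I) (P : pred I) (F : I -> V -> R) x :
  (forall i, differentiable (F i) x) ->
  differentiable (fun y => \sum_(i <- r | P i) F i y) x.
Proof.
move=> H; elim: r => [|a r IH].
  rewrite (_ : (fun _ => _) = cst 0); first exact: differentiable_cst.
  by apply/funext => y; rewrite big_nil.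
rewrite (_ : (fun _ => _) =
  fun y => (if P a then F a y else 0) + \sum_(i <- r | P i) F i y).
  apply: (@differentiableD _ _ _ (fun y => if P a then F a y else 0)) => //.
  by case: (P a) => //; exact: differentiable_cst.
by apply/funext => y; rewrite big_cons; case: (P a); rewrite ?add0r.
Qed.

Lemma differentiable_bigprod (I : Type) (r : seq I) (F : I -> V -> R) x :
  (forall i, differentiable (F i) x) ->
  differentiable (fun y => \prod_(i <- r) F i y) x.
Proof.
move=> H; elim: r => [|a r IH].
  rewrite (_ : (fun _ => _) = cst 1); first exact: differentiable_cst.
  by apply/funext => y; rewrite big_nil.
rewrite (_ : (fun _ => _) = F a * (fun y => \prod_(i <- r) F i y)).
  exact: differentiableM.
by apply/funext => y; rewrite big_cons.
Qed.

Lemma differentiable_mulmx m n p (A : V -> 'M[R]_(m, n)) (B : V -> 'M[R]_(n, p)) x :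
  differentiable A x -> differentiable B x ->
  differentiable (fun y => A y *m B y) x.
Proof.
move=> HA HB; apply: differentiable_mx => i j.
rewrite (_ : (fun _ => _) = fun y => \sum_k A y i k * B y k j).
  apply: differentiable_bigsum => k.
  apply: (@differentiableM _ _ (fun y => A y i k) (fun y => B y k j));
    exact: differentiable_entry.
by apply/funext => y; rewrite mxE.
Qed.

Lemma differentiable_trmx m n (A : V -> 'M[R]_(m, n)) x :
  differentiable A x -> differentiable (fun y => (A y)^T) x.
Proof.
move=> HA; apply: differentiable_mx => i j.
rewrite (_ : (fun _ => _) = fun y => A y j i); first exact: differentiable_entry.
by apply/funext => y; rewrite mxE.
Qed.

Lemma differentiable_scalemx m n (k : V -> R) (A : V -> 'M[R]_(m, n)) x :
  differentiable k x -> differentiable A x -> differentiable (fun y => k y *: A y) x.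
Proof.
move=> Hk HA; apply: differentiable_mx => i j.
rewrite (_ : (fun _ => _) = k * (fun y => A y i j)).
  by apply: differentiableM => //; exact: differentiable_entry.
by apply/funext => y; rewrite mxE.
Qed.

Lemma differentiable_neq0_near (g : V -> R) x : differentiable g x -> g x != 0 ->
  \forall y \near x, g y != 0.
Proof.
move=> dg gx; have := differentiable_continuous dg.
rewrite /prop_for /continuous_at => cg.
have : nbhs (g x) [set r : R | r != 0].
  by apply: open_nbhs_nbhs; split => //; exact: open_neq.
exact: cg.
Qed.

Lemma differentiable_det n (A : V -> 'M[R]_n) x :
  differentiable A x -> differentiable (fun y => \det (A y)) x.
Proof.
move=> HA; apply: differentiable_bigsum => s.
apply: (@differentiableM _ _ (fun=> _)); first exact: differentiable_cst.
by apply: differentiable_bigprod => i; exact: differentiable_entry.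
Qed.

(** [invmx] returns its argument on singular matrices, so the formula by the adjugate is used on the
    neighbourhood where the determinant does not vanish. *)
Lemma differentiable_invmx n (A : V -> 'M[R]_n) x :
  differentiable A x -> A x \in unitmx -> differentiable (fun y => invmx (A y)) x.
Proof.
move=> HA uA; have dd := differentiable_det HA.
have dx : \det (A x) != 0 by rewrite -unitfE.
have near_unit := differentiable_neq0_near dd dx.
apply: (@near_eq_differentiable _ _ _ (fun y => (\det (A y))^-1 *: \adj (A y))).
  by apply: filterS near_unit => y dy; rewrite /invmx unitmxE unitfE dy.
apply: differentiable_scalemx; first exact: differentiableV.
apply: differentiable_mx => i j.
rewrite (_ : (fun _ => _) = fun y => (-1) ^+ (j + i) *
   \det (row' j (col' i (A y)))); last by apply/funext => y; rewrite mxE.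
apply: (@differentiableM _ _ (fun=> _)); first exact: differentiable_cst.
apply: differentiable_det; apply: differentiable_mx => k l.
rewrite (_ : (fun _ => _) = fun y => A y (lift j k) (lift i l)).
  exact: differentiable_entry.
by apply/funext => y; rewrite !mxE.
Qed.

End MatrixDerivatives.

Lemma is_derive_comp {R : realType} {V W X : normedModType R} (g : V -> W)
    (f : W -> X) x v :
  differentiable g x -> differentiable f (g x) ->
  is_derive x v (f \o g) ('D_('D_v g x) f (g x)).
Proof.
move=> dg df; have dfg : differentiable (f \o g) x by exact: differentiable_comp.
split; first exact: diff_derivable.
by rewrite deriveE // diff_comp //= !deriveE.
Qed.

(** * Smooth maps on an open set *)

Section SmoothOn.
Context {R : realType} {m : nat}.
Local Notation e_ j := (delta_mx 0 j : 'rV[R]_m).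

Lemma smooth_derive (W : normedModType R) (U : set 'rV[R]_m) (f : 'rV[R]_m -> W) v :
  smooth_on U f -> smooth_on U ('D_v f).
Proof. by move=> sf k; have [_ /(_ v) []] := sf k.+1. Qed.

Lemma smooth_differentiable (U : set 'rV[R]_m) p q (f : 'rV[R]_m -> 'M[R]_(p, q)) u :
  open U -> smooth_on U f -> U u -> differentiable f u.
Proof. by move=> oU sf Uu; exact: (C1_differentiable oU (sf 1%N)). Qed.

Lemma smooth_derivable (W : normedModType R) (U : set 'rV[R]_m) (f : 'rV[R]_m -> W) u v :
  smooth_on U f -> U u -> derivable f u v.
Proof. by move=> sf Uu; have [_ /(_ v) [d _]] := sf 1%N; exact: d. Qed.

Lemma smooth_continuous (W : normedModType R) (U : set 'rV[R]_m) (f : 'rV[R]_m -> W) u :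
  smooth_on U f -> U u -> {for u, continuous f}.
Proof. by move=> sf Uu; have [c _] := sf 0%N; exact: c. Qed.

Lemma smooth_schwarz (U : set 'rV[R]_m) p q (f : 'rV[R]_m -> 'M[R]_(p, q)) u v w :
  open U -> smooth_on U f -> U u -> 'D_v ('D_w f) u = 'D_w ('D_v f) u.
Proof.
move=> oU sf Uu.
have near2 v' w' i j x : U x ->
    is_derive x v' ('D_w' (fun y => f y i j)) ('D_v' ('D_w' f) x i j).
  move=> Ux; apply: (@near_eq_is_derive _ _ _ (fun y => 'D_w' f y i j)).
    have := open_nbhs_nbhs (conj oU Ux); apply: filterS => y Uy.
    by rewrite derive_entry //; exact: smooth_derivable sf Uy.
  apply: is_derive_entry; apply: derivableP.
  by apply: smooth_derivable Ux; exact: smooth_derive.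
have cont v' w' i j : {for u, continuous ('D_v' ('D_w' (fun y => f y i j)))}.
  have E : \forall y \near u, 'D_v' ('D_w' f) y i j = 'D_v' ('D_w' (fun z => f z i j)) y.
    have := open_nbhs_nbhs (conj oU Uu); apply: filterS => y Uy.
    by have [_ ->] := near2 v' w' i j y Uy.
  rewrite /prop_for /continuous_at -(nbhs_singleton E).
  apply: cvg_trans (near_eq_cvg E) _.
  have cf : {for u, continuous ('D_v' ('D_w' f))}.
    by apply: smooth_continuous Uu; do 2!apply: smooth_derive.
  apply: (@cvg_comp _ _ _ ('D_v' ('D_w' f)) (fun N : 'M[R]_(p, q) => N i j) _ _ _ cf).
  exact: coord_continuous.
apply/matrixP => i j.
case: (near2 v w i j u Uu) => _ E1; case: (near2 w v i j u Uu) => _ E2.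
refine (etrans (esym E1) (etrans _ E2)).
refine (@schwarz_symmetry _ _ (fun y => f y i j) U u w v oU Uu _
  (cont v w i j) (cont w v i j)) => x Ux.
case: (near2 v w i j x Ux) => d1 _; case: (near2 w v i j x Ux) => d2 _.
split; [| |exact: d1|exact: d2]; apply: derivable_entry;
  exact: smooth_derivable sf Ux.
Qed.

Lemma derive_jacobian q (f : 'rV[R]_m -> 'rV[R]_q) u v :
  differentiable f u -> 'D_v f u = v *m jacobian f u.
Proof. by move=> df; rewrite deriveEjacobian. Qed.

Lemma row_jacobian q (f : 'rV[R]_m -> 'rV[R]_q) u j :
  differentiable f u -> row j (jacobian f u) = 'D_(e_ j) f u.
Proof. by move=> df; rewrite derive_jacobian // rowE. Qed.

Lemma smooth_is_derive_jacobian (U : set 'rV[R]_m) q (f : 'rV[R]_m -> 'rV[R]_q) u v :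
  open U -> smooth_on U f -> U u ->
  is_derive u v (jacobian f) (\matrix_(j < m) 'D_v ('D_(e_ j) f) u).
Proof.
move=> oU sf Uu; apply: is_derive_mx => i j; rewrite !mxE.
apply: (@near_eq_is_derive _ _ _ (fun y => 'D_(e_ i) f y 0 j)).
  have := open_nbhs_nbhs (conj oU Uu); apply: filterS => y Uy.
  by rewrite -row_jacobian ?mxE //; exact: (smooth_differentiable oU sf Uy).
apply: is_derive_entry; apply: derivableP.
by apply: smooth_derivable Uu; exact: smooth_derive.
Qed.

Lemma smooth_differentiable_jacobian (U : set 'rV[R]_m) q
    (f : 'rV[R]_m -> 'rV[R]_q) u :
  open U -> smooth_on U f -> U u -> differentiable (jacobian f) u.
Proof.
move=> oU sf Uu; apply: differentiable_mx => i j.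
apply: (@near_eq_differentiable _ _ _ (fun y => 'D_(e_ i) f y 0 j)).
  have := open_nbhs_nbhs (conj oU Uu); apply: filterS => y Uy.
  by rewrite -row_jacobian ?mxE //; exact: (smooth_differentiable oU sf Uy).
apply: differentiable_entry.
by apply: (smooth_differentiable oU) Uu; exact: smooth_derive.
Qed.

Lemma derive_jacobian2 (U : set 'rV[R]_m) q (f : 'rV[R]_m -> 'rV[R]_q) u v w :
  open U -> smooth_on U f -> U u ->
  'D_v ('D_w f) u = w *m \matrix_(j < m) 'D_v ('D_(e_ j) f) u.
Proof.
move=> oU sf Uu.
rewrite -(@near_eq_derive _ _ _ (fun y => w *m jacobian f y)); last first.
  have := open_nbhs_nbhs (conj oU Uu); apply: filterS => y Uy.
  by rewrite derive_jacobian //; exact: (smooth_differentiable oU sf Uy).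
have := is_derive_mulmx (is_derive_cst w u v) (smooth_is_derive_jacobian v oU sf Uu).
by rewrite mul0mx add0r => -[_ ->].
Qed.

(** Written as y' times the Jacobian along the curve, the velocity is differentiated by the product
    rule, so that no more than the regularity of geodesics in [is_geodesic] is required of y. *)
Lemma smooth_curve (U : set 'rV[R]_m) q (f : 'rV[R]_m -> 'rV[R]_q)
    (y y' : R -> 'rV[R]_m) (t : R) (y'' : 'rV[R]_m) :
  open U -> smooth_on U f -> U (y t) ->
  (\forall s \near t, is_derive (s : R) 1 y (y' s)) -> is_derive t 1 y' y'' ->
  (\forall s \near t, is_derive (s : R) 1 (f \o y) ('D_(y' s) f (y s))) /\
  is_derive t 1 (fun s => 'D_(y' s) f (y s))
    ('D_(y' t) ('D_(y' t) f) (y t) + 'D_(y'') f (y t)).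
Proof.
move=> oU sf Ut dy dy'.
have dyt := nbhs_singleton dy.
have diffy (s : R) : is_derive s 1 y (y' s) -> differentiable y s.
  by case=> d _; apply/derivable1_diffP.
have nU : \forall s \near t, U (y s).
  have := differentiable_continuous (diffy _ dyt).
  rewrite /prop_for /continuous_at; apply.
  exact: open_nbhs_nbhs.
split.
  apply: filterS2 _ dy nU => s ds Us.
  have [_ <-] := ds.
  by apply: is_derive_comp; [exact: diffy|exact: smooth_differentiable Us].
apply: (@near_eq_is_derive _ _ _ (fun s => y' s *m jacobian f (y s))).
  apply: filterS nU => s Us.
  by rewrite derive_jacobian //; exact: (smooth_differentiable oU sf Us).
have dJ : is_derive t 1 (fun s => jacobian f (y s))
    (\matrix_(j < m) 'D_(y' t) ('D_(e_ j) f) (y t)).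
  have [_ <-] := smooth_is_derive_jacobian (y' t) oU sf Ut.
  have [_ <-] := dyt.
  apply: (is_derive_comp (g := y)); first exact: diffy.
  exact: smooth_differentiable_jacobian Ut.
have := is_derive_mulmx dy' dJ.
rewrite -(derive_jacobian2 _ _ oU sf Ut) addrC -derive_jacobian //.
exact: (smooth_differentiable oU sf Ut).
Qed.

End SmoothOn.

(** * Symmetric forms, signatures and frames *)

Section GramForm.
Context {R : realType}.
Implicit Types (d N p q k : nat).

Lemma gram_formDl d (G : 'M[R]_d) x y z :
  gram_form G (x + y) z = gram_form G x z + gram_form G y z.
Proof. by rewrite /gram_form !mulmxDl mxE. Qed.

Lemma gram_formDr d (G : 'M[R]_d) x y z :
  gram_form G z (x + y) = gram_form G z x + gram_form G z y.
Proof. by rewrite /gram_form linearD /= mulmxDr mxE. Qed.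

Lemma gram_formZl d (G : 'M[R]_d) a x y :
  gram_form G (a *: x) y = a * gram_form G x y.
Proof. by rewrite /gram_form -!scalemxAl mxE. Qed.

Lemma gram_formZr d (G : 'M[R]_d) a x y :
  gram_form G x (a *: y) = a * gram_form G x y.
Proof. by rewrite /gram_form linearZ /= -scalemxAr mxE. Qed.

Lemma gram_formNl d (G : 'M[R]_d) x y : gram_form G (- x) y = - gram_form G x y.
Proof. by rewrite -scaleN1r gram_formZl mulN1r. Qed.

Lemma gram_formNr d (G : 'M[R]_d) x y : gram_form G x (- y) = - gram_form G x y.
Proof. by rewrite -scaleN1r gram_formZr mulN1r. Qed.

Lemma gram_form0l d (G : 'M[R]_d) x : gram_form G 0 x = 0.
Proof. by rewrite /gram_form !mul0mx mxE. Qed.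

Lemma gram_form0r d (G : 'M[R]_d) x : gram_form G x 0 = 0.
Proof. by rewrite /gram_form trmx0 mulmx0 mxE. Qed.

Definition gram_formE := (gram_formDl, gram_formDr, gram_formZl, gram_formZr,
  gram_formNl, gram_formNr, gram_form0l, gram_form0r).

Lemma gram_formC d (G : 'M[R]_d) x y : G^T = G -> gram_form G x y = gram_form G y x.
Proof.
move=> GT; rewrite /gram_form; transitivity ((x *m G *m y^T)^T 0 0).
  by rewrite [RHS]mxE.
by rewrite !trmx_mul trmxK GT mulmxA.
Qed.

Lemma gram_form_mul d N (G : 'M[R]_N) (E : 'M[R]_(d, N)) x y :
  gram_form G (x *m E) (y *m E) = gram_form (E *m G *m E^T) x y.
Proof. by rewrite /gram_form trmx_mul !mulmxA. Qed.

Lemma gram_form_delta d (G : 'M[R]_d) i j :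
  gram_form G (delta_mx 0 i) (delta_mx 0 j) = G i j.
Proof. by rewrite /gram_form -rowE trmx_delta -colE !mxE. Qed.

Lemma gram_form_row d N (G : 'M[R]_N) (E : 'M[R]_(d, N)) i j :
  gram_form G (row i E) (row j E) = (E *m G *m E^T) i j.
Proof. by rewrite !rowE gram_form_mul gram_form_delta. Qed.

Lemma gram_form_eq0 d (G : 'M[R]_d) x : G \in unitmx ->
  (forall y, gram_form G x y = 0) -> x = 0.
Proof.
move=> uG H; have : x *m G = 0.
  apply/rowP => j; have := H (delta_mx 0 j).
  by rewrite /gram_form trmx_delta -colE !mxE.
by move=> xG; rewrite -[x](mulmxK uG) xG mul0mx.
Qed.

Definition signature_mx N p : 'M[R]_N :=
  \matrix_(i, j) ((if (i < p)%N then -1 else 1) * (i == j)%:R).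

Lemma mink_gram N p (x y : 'rV[R]_N) : mink p x y = gram_form (signature_mx N p) x y.
Proof.
rewrite /mink /gram_form mxE; apply: eq_bigr => i _.
rewrite !mxE (bigD1 i) //= mxE eqxx big1 ?addr0; last first.
  by move=> j ji; rewrite mxE (negPf ji) !mulr0.
by rewrite mulr1 mulrA [_ * x 0 i]mulrC.
Qed.

Lemma signature_mxT N p : (signature_mx N p)^T = signature_mx N p.
Proof.
apply/matrixP => i j; rewrite !mxE eq_sym; have [->|] := eqVneq i j => //.
by rewrite !mulr0.
Qed.

Lemma signature_mxK N p : signature_mx N p *m signature_mx N p = 1%:M.
Proof.
apply/matrixP => i j; rewrite !mxE (bigD1 i) //= !mxE eqxx big1 ?addr0.
  by case: ifP; rewrite mulr1 ?mulN1r ?mul1r ?mulNr ?opprK ?mul1r.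
by move=> k ki; rewrite !mxE [i == k]eq_sym (negPf ki) mulr0 mul0r.
Qed.

Lemma signature_mx_unit N p : signature_mx N p \in unitmx.
Proof. by have [] := mulmx1_unit (signature_mxK N p). Qed.

Lemma signature_block d k :
  block_mx (-1)%:M 0 0 (signature_mx d k) = signature_mx (1 + d) k.+1.
Proof.
apply/matrixP => i j; rewrite [RHS]mxE.
case: (split_ordP i) => i' ->; case: (split_ordP j) => j' ->.
- by rewrite block_mxEul !mxE !ord1 /= !mulr1n mulr1.
- by rewrite block_mxEur !mxE eq_lrshift mulr0.
- by rewrite block_mxEdl !mxE eq_rlshift mulr0.
- by rewrite block_mxEdr !mxE eq_rshift /= add1n ltnS.
Qed.

Lemma signature_block0 d :
  block_mx 1%:M 0 0 (signature_mx d 0) = signature_mx (1 + d) 0.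
Proof.
apply/matrixP => i j; rewrite [RHS]mxE.
case: (split_ordP i) => i' ->; case: (split_ordP j) => j' ->.
- by rewrite block_mxEul !mxE !ord1 /= mulr1.
- by rewrite block_mxEur !mxE eq_lrshift mulr0.
- by rewrite block_mxEdl !mxE eq_rlshift mulr0.
- by rewrite block_mxEdr !mxE eq_rshift.
Qed.

(** Gram-Schmidt step for an indefinite form: [v] is completed to a basis, its square is scaled to
    the sign s, and the other vectors are made orthogonal to it, which leaves the Schur complement
    as [G']. *)
Lemma split_off_vector d (G : 'M[R]_(1 + d)) (v : 'rV[R]_(1 + d)) (s : R) :
  G^T = G -> G \in unitmx -> s ^+ 2 = 1 -> 0 < s * gram_form G v v ->
  exists (E : 'M[R]_(1 + d)) (G' : 'M[R]_d),
    [/\ E \in unitmx, G'^T = G', G' \in unitmx &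
        E *m G *m E^T = block_mx s%:M 0 0 G'].
Proof.
move=> GT uG s2 sv.
have v0 : v != 0.
  by apply: contraTneq sv => ->; rewrite gram_form0l mulr0 ltxx.
have rv : \rank v = 1%N by rewrite rank_rV v0.
(* As v has rank 1, it is proportional to the first row of [row_ebase v]. *)
pose F := row_ebase v; have uF : F \in unitmx by exact: row_ebase_unit.
set M := F *m G *m F^T.
have MT : M^T = M by rewrite /M !trmx_mul trmxK GT mulmxA.
pose a := M 0 0.
have Ev : v = (col_ebase v) 0 0 *: (delta_mx 0 0 *m F).
  rewrite -{1}(mulmx_ebase v) rv -mulmxA {1}[col_ebase v]mx11_scalar mul_scalar_mx.
  congr (_ *: (_ *m _)); apply/rowP => j; rewrite !mxE eqxx /= eq_sym andbT.
  by rewrite -val_eqE.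
have sa : 0 < s * a.
  move: sv; rewrite Ev gram_formZl gram_formZr gram_form_mul gram_form_delta -/M -/a.
  set c := col_ebase _ _ _.
  rewrite (_ : s * (c * (c * a)) = c ^+ 2 * (s * a)); last by ring.
  have := sqr_ge0 c; rewrite le_eqVlt => /orP[/eqP <-|c0]; last by rewrite pmulr_rgt0.
  by rewrite mul0r ltxx.
have a0 : a != 0 by apply: contraTneq sa => ->; rewrite mulr0 ltxx.
pose t := (Num.sqrt (s * a))^-1.
have t0 : t != 0 by rewrite invr_neq0 // gt_eqF // sqrtr_gt0.
have tat : t * a * t = s.
  rewrite mulrAC -expr2 /t exprVn sqr_sqrtr ?ltW // invfM mulfVK //.
  have : s * s = 1 by rewrite -expr2.
  by move=> ss; have /divr1_eq <- : s / s^-1 = 1 by rewrite invrK.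
pose b := ursubmx M.
have bT : b^T = dlsubmx M by rewrite /b -MT trmx_ursub trmxK MT.
pose L : 'M[R]_(1 + d) := block_mx t%:M 0 (- a^-1 *: b^T) 1%:M.
have ula : ulsubmx M = a%:M.
  have ulE (X : 'M[R]_(1 + d)) : ulsubmx X = (X 0 0)%:M.
    by apply/matrixP => i j; rewrite !ord1 !mxE mulr1n; congr (X _ _); exact: val_inj.
  exact: ulE.
have uL : L \in unitmx.
  by rewrite unitmxE det_lblock det_scalar1 det1 mulr1 unitfE.
pose G' := drsubmx M - a^-1 *: (b^T *m b).
have LML : L *m M *m L^T = block_mx s%:M 0 0 G'.
  rewrite -[M]submxK ula -/b -bT /L tr_block_mx !mulmx_block.
  rewrite !tr_scalar_mx !trmx0 !mulmx0 !mul0mx !addr0 !mulmx1 !mul1mx.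
  have Z : - a^-1 *: b^T *m a%:M + b^T = 0.
    by rewrite mul_mx_scalar scalerA mulrN mulfV // scaleN1r addNr.
  have Z' : t%:M *m a%:M *m (- a^-1 *: b^T)^T + t%:M *m b = 0.
    rewrite -mulmxA -mulmxDr [X in _ *m X](_ : _ = 0) ?mulmx0 //.
    by apply: trmx_inj; rewrite linearD /= trmx_mul trmxK tr_scalar_mx Z trmx0.
  rewrite Z Z' !mul0mx add0r -!scalar_mxM tat; congr block_mx.
  by rewrite /G' -scalemxAl scaleNr addrC.
exists (L *m F), G'.
have EE : L *m F *m G *m (L *m F)^T = block_mx s%:M 0 0 G'.
  by rewrite trmx_mul -LML /M !mulmxA.
have s0 : s != 0 by apply: contra_eq_neq s2 => ->; rewrite expr0n eq_sym oner_neq0.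
split => //.
- by rewrite unitmx_mul uL.
- rewrite /G' linearB /= linearZ /= trmx_mul trmxK trmx_drsub MT //.
- have : L *m F *m G *m (L *m F)^T \in unitmx.
    by rewrite !unitmx_mul unitmx_tr unitmx_mul uL uF uG.
  by rewrite EE !unitmxE det_ublock unitrM => /andP[].
Qed.

End GramForm.

Section Signature.
Context {R : realType}.
Implicit Types (d N p q k : nat).

Lemma signature_mxE N p (x : 'rV[R]_N) :
  gram_form (signature_mx N p) x x = \sum_(i < N) (if (i < p)%N then -1 else 1) * x 0 i ^+ 2.
Proof. by rewrite -mink_gram /mink; apply: eq_bigr => i _; rewrite expr2. Qed.

Lemma nondegenerate_polarization d (G : 'M[R]_d) : G^T = G ->
  (forall v, gram_form G v v = 0) -> G = 0.
Proof.
move=> GT H; apply/matrixP => i j; rewrite mxE -gram_form_delta.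
have := H (delta_mx 0 i + delta_mx 0 j).
rewrite !gram_formE !H (gram_formC (delta_mx 0 j)) // add0r addr0.
by move/eqP; rewrite -mulr2n mulrn_eq0 /= => /eqP.
Qed.

(** Negative vectors are split off as long as there are any, so that the signs -1 come first, as in
    [signature_mx]. Otherwise polarization provides a positive vector, and the rest cannot contain a
    negative one. *)
Lemma signature_diagonalization d (G : 'M[R]_d) : G^T = G -> G \in unitmx ->
  exists (E : 'M[R]_d) k,
    [/\ (k <= d)%N, E \in unitmx & E *m G *m E^T = signature_mx d k].
Proof.
elim: d G => [|d IH] G GT uG.
  exists 1%:M, 0%N; split=> //; first exact: unitmx1.
  by apply/matrixP => -[].
rewrite -[d.+1]/(1 + d)%N in G GT uG *.
have step (s : R) (v : 'rV_(1 + d)) : s ^+ 2 = 1 -> 0 < s * gram_form G v v ->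
    exists (E : 'M[R]_(1 + d)) k, [/\ (k <= d)%N, E \in unitmx &
      E *m G *m E^T = block_mx s%:M 0 0 (signature_mx d k)].
  move=> s2 sv; have [E [G' [uE G'T uG' EGE]]] := split_off_vector GT uG s2 sv.
  have [E' [k [kd uE' EGE']]] := IH G' G'T uG'.
  exists (block_mx 1%:M 0 0 E' *m E), k; split=> //.
    by rewrite unitmx_mul uE andbT unitmxE det_ublock det1 mul1r -unitmxE.
  rewrite trmx_mul !mulmxA -[_ *m E *m G]mulmxA -[_ *m (E *m G) *m E^T]mulmxA EGE.
  rewrite tr_block_mx !trmx0 trmx1 !mulmx_block !(mulmx0, mul0mx, mulmx1, mul1mx).
  by rewrite !(addr0, add0r) EGE' mul0mx.
have [[v vneg]|nneg] := pselect (exists v, gram_form G v v < 0).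
  have [||E [k [kd uE EGE]]] := step (-1) v; first by rewrite sqrrN expr1n.
    by rewrite mulN1r oppr_gt0.
  by exists E, k.+1; split => //; rewrite EGE signature_block.
have [[v vpos]|npos] := pselect (exists v, 0 < gram_form G v v); last first.
  have G0 : G = 0.
    apply: nondegenerate_polarization => // v; apply/eqP; rewrite eq_le.
    apply/andP; split; rewrite leNgt; apply/negP => H.
      by apply: npos; exists v.
    by apply: nneg; exists v.
  by move: uG; rewrite G0 unitmxE det0 unitr0.
have [||E [k [kd uE EGE]]] := step 1 v; rewrite ?expr1n ?mul1r //.
have k0 : k = 0%N.
  apply/eqP; rewrite -leqn0 leqNgt; apply/negP => k0.
  apply: nneg; exists (delta_mx 0 (rshift 1 (Ordinal (leq_trans k0 kd))) *m E).
  rewrite gram_form_mul EGE gram_form_delta block_mxEdr mxE eqxx /= k0 mulr1.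
  by rewrite oppr_lt0.
by exists E, 0%N; split=> //; rewrite EGE k0 signature_block0.
Qed.

(** A subspace where the form is negative definite meets one where it is nonnegative only in 0. This
    is the core of the law of inertia: the number of negative signs does not depend on the
    diagonalizing frame. *)
Lemma definite_ranks d (G B P : 'M[R]_d) : negative_definite_on G B ->
  (forall v, (v <= P)%MS -> 0 <= gram_form G v v) -> (\rank B + \rank P <= d)%N.
Proof.
move=> neg pos.
have cap0 : (B :&: P)%MS = 0.
  apply/eqP; rewrite -submx0; apply/row_subP => i.
  set v := row i _; have vBP : (v <= B :&: P)%MS by exact: row_sub.
  rewrite submx0; apply: contraT => v0.
  have := neg v (submx_trans vBP (capmxSl _ _)) v0.
  by rewrite ltNge pos // (submx_trans vBP (capmxSr _ _)).
by rewrite -mxrank_sum_cap cap0 mxrank0 addn0 rank_leq_row.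
Qed.

Lemma signature_negative d (G E : 'M[R]_d) k : (k <= d)%N -> E \in unitmx ->
  E *m G *m E^T = signature_mx d k ->
  negative_definite_on G ((pid_mx k : 'M[R]_d) *m E) /\ \rank ((pid_mx k : 'M[R]_d) *m E) = k.
Proof.
move=> kd uE EGE; split; last first.
  by rewrite mxrankMfree ?row_free_unit // rank_pid_mx.
move=> v /submxP[w ->]; rewrite mulmxA => nz.
rewrite gram_form_mul EGE signature_mxE.
set u := w *m _ in nz *.
have u0 (i : 'I_d) : (k <= i)%N -> u 0 i = 0.
  move=> ki; rewrite mxE big1 // => j _; rewrite mxE.
  by case: eqP => [->|_]; rewrite ?(leqNgt k i) in ki *; rewrite ?(negPf ki) ?andbF ?mulr0.
have H (i : 'I_d) : (if (i < k)%N then -1 else 1) * u 0 i ^+ 2 = - u 0 i ^+ 2 :> R.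
  by case: ltnP => [_|/u0 ->]; rewrite ?mulN1r // expr0n mulr0 oppr0.
rewrite (eq_bigr _ (fun i _ => H i)) sumrN oppr_lt0.
rewrite lt_def sumr_ge0 ?andbT; last by move=> i _; exact: sqr_ge0.
apply: contra_neq nz => /eqP; rewrite psumr_eq0; last by move=> i _; exact: sqr_ge0.
move=> /allP uz; rewrite (_ : u = 0) ?mul0mx //; apply/rowP => i; rewrite [RHS]mxE.
by have := uz i (mem_index_enum i); rewrite /= sqrf_eq0 => /eqP.
Qed.

Lemma signature_nonneg d (G E : 'M[R]_d) k : (k <= d)%N -> E \in unitmx ->
  E *m G *m E^T = signature_mx d k ->
  (forall v, (v <= copid_mx k *m E)%MS -> 0 <= gram_form G v v) /\
  \rank (copid_mx k *m E) = (d - k)%N.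
Proof.
move=> kd uE EGE; split; last first.
  by rewrite mxrankMfree ?row_free_unit // rank_copid_mx.
move=> v /submxP[w ->]; rewrite mulmxA gram_form_mul EGE signature_mxE.
set u := w *m _.
have u0 (i : 'I_d) : (i < k)%N -> u 0 i = 0.
  move=> ki; rewrite mxE big1 // => j _; rewrite !mxE.
  by case: (j =P i) => [->|/eqP ji]; rewrite ?eqxx ?ki ?subrr ?mulr0 //
     -?val_eqE ?(negPf ji) /= ?subrr ?mulr0 // val_eqE (negPf ji) subrr mulr0.
apply: sumr_ge0 => i _; case: ltnP => [/u0 ->|_]; first by rewrite expr0n mulr0.
by rewrite mul1r sqr_ge0.
Qed.

Lemma signature_index d (G E : 'M[R]_d) k s : (k <= d)%N -> E \in unitmx ->
  E *m G *m E^T = signature_mx d k -> has_index G s -> k = s.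
Proof.
move=> kd uE EGE [[B [Bneg Bs]] maxs]; apply/eqP; rewrite eqn_leq; apply/andP; split.
  by have [neg <-] := signature_negative kd uE EGE; exact: maxs.
have [pos rk] := signature_nonneg kd uE EGE.
have := definite_ranks Bneg pos; rewrite Bs rk; lia.
Qed.

Lemma signature_unique d (G E E' : 'M[R]_d) k k' : (k <= d)%N -> (k' <= d)%N ->
  E \in unitmx -> E' \in unitmx ->
  E *m G *m E^T = signature_mx d k -> E' *m G *m E'^T = signature_mx d k' -> k = k'.
Proof.
move=> kd kd' uE uE' H H'.
have [n r] := signature_negative kd uE H; have [n' r'] := signature_negative kd' uE' H'.
have [s t] := signature_nonneg kd uE H; have [s' t'] := signature_nonneg kd' uE' H'.
have := definite_ranks n s'; have := definite_ranks n' s; rewrite r r' t t'; lia.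
Qed.

(** The double orthogonal of W is W, degenerate or not, since J is invertible: the columns of the
    cokernel of W, multiplied by J, are orthogonal to W, hence to z. *)
Lemma double_orthogonal k N p (W : 'M[R]_(k, N)) (z : 'rV[R]_N) :
  (forall y : 'rV[R]_N, W *m signature_mx N p *m y^T = 0 ->
     gram_form (signature_mx N p) z y = 0) -> (z <= W)%MS.
Proof.
move=> H; rewrite submxE; apply/eqP/rowP => j; rewrite [RHS]mxE.
set J := signature_mx N p in H *.
have JK : J *m J = 1%:M by exact: signature_mxK.
have := H ((J *m col j (cokermx W))^T); rewrite /gram_form trmxK !mulmxA -!(mulmxA _ J J) JK !mulmx1.
rewrite colE (mulmxA W) mulmx_coker mul0mx => /(_ erefl).
by move=> E0; apply: etrans E0; rewrite (mulmxA z) -colE [RHS]mxE -mulmxA.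
Qed.

End Signature.

(** * Extension of orthonormal systems *)

Section FrameExtension.
Context {R : realType}.
Implicit Types (b N p q k r : nat).

(** The form is nondegenerate on the row space of B, so the ambient space splits orthogonally; the
    complement is then nondegenerate and can be diagonalized. *)
Lemma frame_complement b N p q (B : 'M[R]_(b, N)) :
  B *m signature_mx N p *m B^T = signature_mx b q ->
  exists r (C : 'M[R]_(r, N)) k, [/\ (b + r = N)%N, (k <= r)%N,
    C *m signature_mx N p *m C^T = signature_mx r k &
    C *m signature_mx N p *m B^T = 0].
Proof.
move=> BJB; set J := signature_mx N p in BJB *.
have JT : J^T = J by exact: signature_mxT.
have uJ : J \in unitmx by exact: signature_mx_unit.
have rB : row_free B.
  rewrite -row_leq_rank; apply: leq_trans (mxrankM_maxl B (J *m B^T)).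
  by rewrite mulmxA BJB mxrank_unit ?signature_mx_unit.
have bN : (b <= N)%N by move: rB => /eqP <-; exact: rank_leq_col.
pose K := kermx (J *m B^T).
have rK : \rank K = (N - b)%N.
  rewrite mxrank_ker -mxrank_tr trmx_mul trmxK JT mxrankMfree ?row_free_unit //.
  by move: rB => /eqP ->.
have [C [CK fC]] : exists C : 'M[R]_(\rank K, N), (C :=: K)%MS /\ row_free C.
  by exists (row_base K); split; [exact: eq_row_base|exact: row_base_free].
have CJB : C *m J *m B^T = 0.
  by rewrite -mulmxA; apply/sub_kermxP; rewrite CK.
have bJC : B *m J *m C^T = 0.
  by apply: trmx_inj; rewrite trmx0 !trmx_mul trmxK JT mulmxA.
have GT : (C *m J *m C^T)^T = C *m J *m C^T.
  by rewrite !trmx_mul trmxK JT mulmxA.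
have uG : C *m J *m C^T \in unitmx.
  rewrite -row_free_unit; apply: inj_row_free => w wG.
  apply: (row_free_inj fC); rewrite mul0mx.
  apply: (gram_form_eq0 uJ) => y.
  (* Coefficients of the orthogonal projection of y to the rows of B: the Gram matrix
     [signature_mx b q] is its own inverse. *)
  pose a := y *m J *m B^T *m signature_mx b q.
  have yK : (y - a *m B <= K)%MS.
    apply/sub_kermxP; rewrite mulmxA !mulmxBl -(mulmxA a) -(mulmxA a) BJB.
    by rewrite /a -(mulmxA _ (signature_mx b q)) signature_mxK mulmx1 subrr.
  have [z yz] : exists z, y = a *m B + z *m C.
    have /submxP[z zC] : (y - a *m B <= C)%MS by rewrite CK.
    by exists z; rewrite -zC addrC subrK.
  rewrite yz gram_formDr gram_form_mul /gram_form wG mul0mx [X in _ + X]mxE addr0.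
  by rewrite trmx_mul !mulmxA -!(mulmxA w) CJB mul0mx mulmx0 mxE.
have [E [k [kr uE EGE]]] := signature_diagonalization GT uG.
exists (\rank K), (E *m C), k; split => //.
- by rewrite rK subnKC.
- by rewrite -EGE trmx_mul !mulmxA.
- by rewrite -!mulmxA (mulmxA C) CJB mulmx0.
Qed.

(** Rows are indexed by natural numbers, with 0 out of range, because [frame_extension] interleaves
    two matrices by shifting indices. *)
Definition nat_row k N (A : 'M[R]_(k, N)) (i : nat) : 'rV[R]_N :=
  if insub i is Some j then row j A else 0.

Lemma nat_rowE k N (A : 'M[R]_(k, N)) (j : 'I_k) : nat_row A j = row j A.
Proof. by rewrite /nat_row valK. Qed.

Lemma nat_row_gram k l N (G : 'M[R]_N) (A : 'M[R]_(k, N)) (B : 'M[R]_(l, N)) i j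
    (ik : (i < k)%N) (jl : (j < l)%N) :
  gram_form G (nat_row A i) (nat_row B j) =
  (A *m G *m B^T) (Ordinal ik) (Ordinal jl).
Proof.
rewrite (nat_rowE A (Ordinal ik)) (nat_rowE B (Ordinal jl)) !rowE /gram_form trmx_mul.
by rewrite trmx_delta !mulmxA -colE -!mulmxA -rowE !mxE; apply: eq_bigr => m _; rewrite !mxE.
Qed.

Lemma insert0_row b N q (B : 'M[R]_(b, N)) (A : 'M[R]_N) (x : 'rV[R]_b) :
  (b <= N)%N ->
  (forall i : 'I_b, row i B = nat_row A (if (i < q)%N then i : nat else (i + (N - b))%N)) ->
  insert0 N q x *m A = x *m B.
Proof.
move=> bN H; rewrite /insert0 -mulmxA; congr (_ *m _).
apply/row_matrixP => i; rewrite H row_mul.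
have lt : ((if (i < q)%N then i : nat else (i + (N - b))%N) < N)%N.
  by have := ltn_ord i; case: ifP; lia.
rewrite (nat_rowE A (Ordinal lt)) [RHS]rowE; congr (_ *m _).
by apply/rowP => j; rewrite !mxE eqxx -val_eqE.
Qed.

(** Witt extension in coordinates. A lists the q negative rows of B, all rows of C, then the
    positive rows of B: [insert0] leaves its gap after position q, so it selects the rows of B, and
    the negative rows of A are the first q + k. *)
Lemma frame_extension b N p q (B : 'M[R]_(b, N)) : (p <= N)%N -> (q <= b)%N ->
  B *m signature_mx N p *m B^T = signature_mx b q ->
  [/\ (q <= p)%N, (b + p <= N + q)%N &
      exists2 A : 'M[R]_N, (A *m signature_mx N p *m A^T = signature_mx N p) &
        (forall x : 'rV[R]_b, insert0 N q x *m A = x *m B)].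
Proof.
move=> pN qb BJB; have [r [C [k [brN kr CJC CJB]]]] := frame_complement BJB.
set J := signature_mx N p in BJB CJC CJB *.
have JT : J^T = J by exact: signature_mxT.
have BJC : B *m J *m C^T = 0.
  by apply: trmx_inj; rewrite trmx0 !trmx_mul trmxK JT mulmxA.
pose A : 'M[R]_N := \matrix_(j < N)
  (if (j < q)%N then nat_row B j else if (j < q + r)%N then nat_row C (j - q)
   else nat_row B (j - r)).
have AJA : A *m J *m A^T = signature_mx N (q + k).
  apply/matrixP => i j; rewrite -gram_form_row !rowK [RHS]mxE.
  have := ltn_ord i; have := ltn_ord j; rewrite -(inj_eq val_inj) /=.
  move: (i : nat) (j : nat) => {}i {}j jN iN.
  have BB i' j' (ib : (i' < b)%N) (jb : (j' < b)%N) : gram_form J (nat_row B i') (nat_row B j') =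
      (if (i' < q)%N then -1 else 1) * (i' == j')%:R.
    by rewrite (nat_row_gram _ _ _ ib jb) BJB mxE -(inj_eq val_inj).
  have CC i' j' (ib : (i' < r)%N) (jb : (j' < r)%N) : gram_form J (nat_row C i') (nat_row C j') =
      (if (i' < k)%N then -1 else 1) * (i' == j')%:R.
    by rewrite (nat_row_gram _ _ _ ib jb) CJC mxE -(inj_eq val_inj).
  have BC i' j' (ib : (i' < b)%N) (jb : (j' < r)%N) : gram_form J (nat_row B i') (nat_row C j') = 0.
    by rewrite (nat_row_gram _ _ _ ib jb) BJC mxE.
  have CB i' j' (ib : (i' < r)%N) (jb : (j' < b)%N) : gram_form J (nat_row C i') (nat_row B j') = 0.
    by rewrite (nat_row_gram _ _ _ ib jb) CJB mxE.
  have e0 : (i == j) = false -> (if (i < q + k)%N then -1 else 1) * (i == j)%:R = 0 :> R.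
    by move=> ->; rewrite mulr0.
  case: (ltnP i q) => iq; case: (ltnP j q) => jq.
  - rewrite BB; [|lia|lia]; rewrite iq; case: (ltnP i (q + k)) => //; lia.
  - case: (ltnP j (q + r)) => jr.
      rewrite BC; [|lia|lia]; rewrite e0 //; lia.
    rewrite BB; [|lia|lia]; rewrite e0; last lia.
    by rewrite (_ : (i == _) = false) ?mulr0 //; lia.
  - case: (ltnP i (q + r)) => ir.
      rewrite CB; [|lia|lia]; rewrite e0 //; lia.
    rewrite BB; [|lia|lia]; rewrite e0; last lia.
    by rewrite (_ : (_ == j) = false) ?mulr0 //; lia.
  case: (ltnP i (q + r)) => ir; case: (ltnP j (q + r)) => jr.
  - rewrite CC; [|lia|lia].
    rewrite (_ : (i - q == j - q)%N = (i == j)); last lia.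
    by rewrite (_ : (i - q < k)%N = (i < q + k)%N) //; lia.
  - rewrite CB; [|lia|lia]; rewrite e0 //; lia.
  - rewrite BC; [|lia|lia]; rewrite e0 //; lia.
  - rewrite BB; [|lia|lia].
    rewrite (_ : (i - r == j - r)%N = (i == j)); last lia.
    rewrite (_ : (i - r < q)%N = false); last lia.
    by rewrite (_ : (i < q + k)%N = false) //; lia.
have uA : A \in unitmx.
  have : A *m J *m A^T \in unitmx by rewrite AJA signature_mx_unit.
  by rewrite !unitmx_mul => /andP[/andP[]].
(* Law of inertia, with the standard basis as the second frame; the bounds on p then follow from k
   <= r. *)
have qkp : (q + k = p)%N.
  apply: (@signature_unique _ _ J A 1%:M) => //; first lia.
    exact: unitmx1.
  by rewrite trmx1 mulmx1 mul1mx.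
split; [lia|lia|exists A; first by rewrite AJA qkp].
move=> x; apply: insert0_row => [|i]; first lia.
have ib := ltn_ord i; have Nb : (N - b = r)%N by lia.
rewrite Nb -nat_rowE; case: (ltnP i q) => iq.
  have iN : (i < N)%N by lia.
  by rewrite (nat_rowE A (Ordinal iN)) rowK /= iq.
have iN : (i + r < N)%N by lia.
rewrite (nat_rowE A (Ordinal iN)) rowK /=.
by rewrite !ifF; [rewrite addnK|lia|lia].
Qed.

End FrameExtension.

(** * Uniqueness for linear differential equations *)

Section LinearODE.
Context {R : realType}.

(** The function N(t) exp(- K t) is nonincreasing, nonnegative, and 0 at the origin. *)
Lemma gronwall_zero (N dN : R -> R) (K : R) :
  (forall t : R, 0 <= t <= 1 -> is_derive t 1 N (dN t)) ->
  (forall t : R, 0 <= t <= 1 -> dN t <= K * N t) ->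
  (forall t : R, 0 <= t <= 1 -> 0 <= N t) -> N 0 = 0 ->
  forall t : R, 0 <= t <= 1 -> N t = 0.
Proof.
move=> dNt le N0 N00 t t01.
pose h (s : R) := N s * expR (- K * s).
have dexp (s : R) : is_derive s 1 (fun s => expR (- K * s)) (- K * expR (- K * s)).
  have d1 : is_derive s 1 (fun s : R => - K * s) (- K).
    have -> : (fun s : R => - K * s) = (- K) *: (id : R -> R) by [].
    by apply: is_derive_eq; rewrite [LHS]mulr1.
  have := @is_derive1_comp _ expR (fun s => - K * s) s _ _ (is_derive_expR _) d1.
  by rewrite mulrC.
have dh (s : R) : 0 <= s <= 1 -> is_derive s 1 h ((dN s - K * N s) * expR (- K * s)).
  move=> s01; have := is_derive_mulr (dNt s s01) (dexp s).
  by move=> H; apply: (is_derive_eq H); ring.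
have ch : {within `[0, 1], continuous h}.
  by apply: derivable_within_continuous => s; rewrite in_itv /= => /dh [].
have dh' (s : R) : s \in `]0, 1[ -> derivable h s 1.
  by rewrite in_itv /= => /andP[/ltW a /ltW b]; have [] := dh s _; rewrite ?a ?b.
have dh0 (s : R) : s \in `]0, 1[ -> derive1 h s <= 0.
  rewrite in_itv /= => /andP[/ltW a /ltW b].
  have s01 : 0 <= s <= 1 by rewrite a b.
  rewrite derive1E; have [_ ->] := dh s s01.
  by rewrite mulr_le0_ge0 ?expR_ge0 // subr_le0; exact: le.
have : h t <= h 0.
  have := ler0_derive1_le_cc dh' dh0 ch.
  move: t01 => /andP[t0 t1]; apply => //; rewrite in_itv /= ?lexx ?ler01 ?t0 ?t1 //.
rewrite /h N00 mul0r pmulr_lle0 ?expR_gt0 // => Nt.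
by apply/eqP; rewrite eq_le Nt N0.
Qed.


(** Gronwall for the sum of squares q of Y: its derivative is at most 2 C k q, where C bounds the
    entries of L on [0, 1] and a product of coordinates is bounded by half the sum of their
    squares. *)
Lemma linear_ode_zero k (Y : R -> 'rV[R]_k) (L : R -> 'M[R]_k) :
  (forall t : R, 0 <= t <= 1 -> is_derive t 1 Y (Y t *m L t)) ->
  (forall t : R, 0 <= t <= 1 -> {for t, continuous L}) -> Y 0 = 0 ->
  forall t : R, 0 <= t <= 1 -> Y t = 0.
Proof.
move=> dY cL Y0.
pose q (x : 'rV[R]_k) := gram_form 1%:M x x.
have qE x : q x = \sum_i x 0 i ^+ 2.
  by rewrite /q /gram_form mulmx1 mxE; apply: eq_bigr => i _; rewrite mxE expr2.
have q_ge0 x : 0 <= q x by rewrite qE; apply: sumr_ge0 => i _; exact: sqr_ge0.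
have [C C0 HC] : exists2 C, 0 <= C & forall t : R, 0 <= t <= 1 -> `|L t| <= C.
  have cn : {within `[0, 1], continuous (fun t => `|L t|)}.
    apply: continuous_in_subspaceT => t; rewrite inE /= in_itv /= => t01.
    by apply: (continuous_comp (cL t t01)); exact: norm_continuous.
  have [c c01 Hc] := EVT_max ler01 cn.
  exists `|L c| => // t t01; apply: Hc; by rewrite in_itv.
have dq (t : R) : 0 <= t <= 1 -> is_derive t 1 (fun t => q (Y t))
    (gram_form 1%:M (Y t *m L t) (Y t) + gram_form 1%:M (Y t) (Y t *m L t)).
  by move=> t01; apply: is_derive_gram_form; exact: dY.
have le (t : R) : 0 <= t <= 1 ->
   gram_form 1%:M (Y t *m L t) (Y t) + gram_form 1%:M (Y t) (Y t *m L t) <=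
   (C * k%:R *+ 2) * q (Y t).
  move=> t01; rewrite (gram_formC (Y t) (Y t *m L t)) ?trmx1 // -mulr2n mulrnAl lerMn2r.
  apply/orP; right.
  rewrite /gram_form mulmx1 mxE.
  apply: (@le_trans _ _ (\sum_i \sum_j C * ((Y t 0 i ^+ 2 + Y t 0 j ^+ 2) / 2))).
    apply: ler_sum => i _; rewrite !mxE big_distrl /=; apply: ler_sum => j _.
    have Lji := le_trans (coord_le_norm (L t) j i) (HC t t01).
    set a := Y t 0 i; set b := Y t 0 j; set l := L t j i in Lji *.
    apply: le_trans (ler_norm _) _; rewrite !normrM mulrAC.
    have -> : a ^+ 2 + b ^+ 2 = `|a| ^+ 2 + `|b| ^+ 2 by rewrite !real_normK ?num_real.
    rewrite [leLHS]mulrC; apply: ler_pM => //.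
    rewrite ler_pdivlMr //; have := sqr_ge0 (`|a| - `|b|); lra.
  rewrite qE; set x := fun i => Y t 0 i ^+ 2; pose S := \sum_i x i.
  rewrite le_eqVlt; apply/orP; left; apply/eqP.
  transitivity (C / 2 * (\sum_(i < k) \sum_(j < k) x i + \sum_(i < k) \sum_(j < k) x j)).
    rewrite -big_split big_distrr; apply: eq_bigr => i _ /=.
    rewrite -big_split big_distrr; apply: eq_bigr => j _ /=.
    by rewrite -/(x i) -/(x j); move: (x i) (x j) => xi xj; field.
  have SS : \sum_(i < k) \sum_(j < k) x j = k%:R * S.
    by rewrite sumr_const card_ord mulr_natl.
  by rewrite exchange_big /= SS -/S; set kk := k%:R; field.
have qY := gronwall_zero dq le (fun t _ => q_ge0 (Y t)).
have q0 : q (Y 0) = 0 by rewrite Y0 /q gram_form0l.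
move=> t t01; have := qY q0 t t01; rewrite qE => /eqP.
rewrite psumr_eq0; last by move=> i _; exact: sqr_ge0.
move=> /allP H; apply/rowP => i; rewrite mxE.
by have := H i (mem_index_enum i); rewrite /= sqrf_eq0 => /eqP.
Qed.

End LinearODE.

(** * Umbilical immersions of an open set *)

Section AbstractIdentities.
Context {R : realType} {N : nat} (J : 'M[R]_N).
Local Notation dot := (gram_form J).

Lemma dot_drop_normal a h b x c : J^T = J -> h = b + c *: x -> dot x a = 0 ->
  dot a h = dot a b.
Proof.
by move=> JT -> xa; rewrite gram_formDr gram_formZr (gram_formC a x) // xa mulr0 addr0.
Qed.

Lemma dot_normal_part h b x c y : h = b + c *: x -> dot b y = 0 ->
  dot h y = c * dot x y.
Proof. by move=> -> yb; rewrite gram_formDl gram_formZl yb add0r. Qed.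

Lemma dot_leibniz A B g g' x x' y a c : dot A y = 0 -> dot B y = a * dot x y ->
  c = a + g ->
  dot (A + B + (g *: x + g' *: x')) y = c * dot x y + g' * dot x' y.
Proof.
by move=> Ay By ->; rewrite !gram_formDl !gram_formZl Ay By add0r addrA -mulrDl.
Qed.

(** T1 and T2 are the same third derivative expanded in two orders; their coefficients along x
    consist of the same three terms, permuted, and cancel. *)
Lemma codazzi_cancel (a1 b1 c1 a2 b2 c2 x g h X Y T1 T2 : R) :
  T1 = (a1 + (b1 + c1)) * x + g * X -> T2 = (a2 + (b2 + c2)) * x + h * Y ->
  T1 = T2 -> a1 = c2 -> b1 = b2 -> c1 = a2 -> g * X = h * Y.
Proof.
move=> -> -> H E1 E2 E3; apply: (addrI ((a1 + (b1 + c1)) * x)).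
by rewrite H E1 E2 E3; congr (_ * _ + _); ring.
Qed.

Lemma unit_cancel (g h X Y : R) : g * X = h * Y -> g = 1 -> h = 0 -> X = 0.
Proof. by move=> E g1 h0; move: E; rewrite g1 h0 mul1r mul0r. Qed.

Lemma dot_orthogonal_sum a c b s y w e : J^T = J -> y = w + e ->
  dot a w = - dot b w * c -> dot a e = 0 -> dot b e = 0 -> s = c ->
  dot (a + s *: b) y = 0.
Proof.
move=> JT -> aw ae be ->.
by rewrite !gram_formDl !gram_formZl !gram_formDr ae be aw !addr0; ring.
Qed.

Lemma matrix_of_rows m (M : 'M[R]_(m, N)) (A : 'M[R]_m) (E : 'M[R]_(m, N))
    (g : 'rV[R]_m) (x : 'rV[R]_N) :
  (forall j, row j M = row j A *m E + g 0 j *: x) -> M = A *m E + g^T *m x.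
Proof.
move=> H; apply/row_matrixP => j; rewrite H linearD /= !row_mul; congr (_ + _).
by apply/rowP => k; rewrite !mxE big_ord1 !mxE.
Qed.

Lemma mulmx_tr_sum m (h : 'rV[R]_N) (A : 'M[R]_m) (E : 'M[R]_(m, N))
    (g : 'rV[R]_m) (x : 'rV[R]_N) :
  h *m (A *m E + g^T *m x)^T = h *m E^T *m A^T + h *m x^T *m g.
Proof. by rewrite linearD /= !trmx_mul trmxK mulmxDr !mulmxA. Qed.

Lemma mulmx_tr_opp m (h : 'rV[R]_N) c (v : 'rV[R]_m) (E : 'M[R]_(m, N)) y :
  y = v *m E -> h *m (- (c *: y))^T = h *m E^T *m - (c *: v^T).
Proof.
by move=> ->; rewrite linearN linearZ /= trmx_mul !mulmxN -!scalemxAr mulmxA.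
Qed.

End AbstractIdentities.

Section ConvexBalls.
Context {R : realType} {V : normedModType R}.

Lemma ball_segment (x0 x y : V) (r t : R) : ball x0 r x -> ball x0 r y -> 0 <= t <= 1 ->
  ball x0 r (x + t *: (y - x)).
Proof.
rewrite -!ball_normE /= => xr yr /andP[t0 t1].
set a := x0 - x in xr *; set b := x0 - y in yr *.
have -> : x0 - (x + t *: (y - x)) = (1 - t) *: a + t *: b.
  have -> : y - x = a - b by rewrite /a /b opprB [RHS]addrC addrA subrK.
  by rewrite opprD addrA -/a scalerBr opprB scalerBl scale1r addrA addrAC.
have [t0'|t0'] := eqVneq t 0; first by rewrite t0' subr0 scale1r scale0r addr0.
have tpos : 0 < t by rewrite lt_def t0' t0.
apply: le_lt_trans (ler_normD _ _) _; rewrite !normrZ !ger0_norm ?subr_ge0 //.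
have -> : r = (1 - t) * r + t * r by ring.
apply: ler_ltD.
  by rewrite ler_wpM2l ?subr_ge0 // ltW.
by rewrite ltr_pM2l.
Qed.

Lemma line_constant (W : set V) (F : V -> R) (x0 : V) (r : R) :
  (forall x, ball x0 r x -> W x) -> (forall x v, W x -> is_derive x v F 0) ->
  forall x y, ball x0 r x -> ball x0 r y -> F x = F y.
Proof.
move=> bW dF x y xb yb; apply/esym/eqP; rewrite -subr_eq0; apply/eqP.
have [t t01|t t01] := @line_MVT _ _ F x (y - x).
  by have [] := dF _ (y - x) (bW _ (ball_segment xb yb t01)).
rewrite (addrC x) subrK => ->.
by have [] := dF _ (y - x) (bW _ (ball_segment xb yb t01)).
Qed.

End ConvexBalls.

Section LocalUmbilical.
Context {R : realType} {m N : nat} (p : nat).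
(** [xi] stands for the vector h of the overview and [Gam] for the Christoffel symbols. Neither is
    assumed to be regular: their differentiability is recovered from that of [f] through [hess]. *)
Variables (U : set 'rV[R]_m) (f xi : 'rV[R]_m -> 'rV[R]_N)
  (Gam : 'rV[R]_m -> 'rV[R]_m -> 'rV[R]_m -> 'rV[R]_m).
Local Notation e_ j := (delta_mx 0 j : 'rV[R]_m).
Local Notation J := (signature_mx N p : 'M[R]_N).
Local Notation dot := (gram_form (signature_mx N p : 'M[R]_N)).
Local Notation E := (jacobian f).
Local Notation G u := (jacobian f u *m J *m (jacobian f u)^T).
Hypothesis oU : open U.
Hypothesis sf : smooth_on U f.
Hypothesis uG : forall u, U u -> G u \in unitmx.
Hypothesis hess : forall u v w, U u ->
  'D_v ('D_w f) u = 'D_(Gam u v w) f u + dot ('D_v f u) ('D_w f u) *: xi u.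
Hypothesis xiT : forall u v, U u -> dot (xi u) ('D_v f u) = 0.
Hypothesis m2 : (2 <= m)%N.

Let dotC x y : dot x y = dot y x.
Proof. by rewrite gram_formC ?signature_mxT. Qed.

Let GT u : (G u)^T = G u.
Proof. by rewrite !trmx_mul trmxK signature_mxT mulmxA. Qed.

Let nU u : U u -> \forall y \near u, U y.
Proof. by move=> Uu; exact: open_nbhs_nbhs. Qed.

Let dE u v : U u -> 'D_v f u = v *m E u.
Proof. by move=> Uu; rewrite derive_jacobian //; exact: smooth_differentiable Uu. Qed.

Let dotE u v w : U u -> dot ('D_v f u) ('D_w f u) = gram_form (G u) v w.
Proof. by move=> Uu; rewrite !dE // gram_form_mul. Qed.

Let xiJE u : U u -> xi u *m J *m (E u)^T = 0.
Proof.
move=> Uu; apply/rowP => j; rewrite [RHS]mxE; have := xiT (e_ j) Uu.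
by rewrite dE // /gram_form trmx_mul mulmxA trmx_delta -colE mxE.
Qed.

Lemma tangential_decomposition u y : U u ->
  exists w y', y = w *m E u + y' /\ forall v, dot ('D_v f u) y' = 0.
Proof.
move=> Uu; pose w := y *m J *m (E u)^T *m invmx (G u).
exists w, (y - w *m E u); split; first by rewrite addrC subrK.
move=> v; rewrite dE // dotC !gram_formE gram_form_mul /gram_form /w mulmxKV ?uG //.
by rewrite trmx_mul !mulmxA subrr.
Qed.

(** Replaces the normalization of w, which may be null. *)
Lemma nonzero_partner u w : U u -> w != 0 ->
  exists v, dot ('D_v f u) ('D_w f u) = 1.
Proof.
move=> Uu w0; have [v v0] : exists v, gram_form (G u) w v != 0.
  apply: contrapT => H; move/eqP: w0; apply; apply: (gram_form_eq0 (uG Uu)) => v.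
  by apply/eqP; apply: contrapT => /negP v0; apply: H; exists v.
exists ((gram_form (G u) w v)^-1 *: v).
by rewrite dotE // gram_formZl (gram_formC v w (GT u)) mulVf.
Qed.

(** Pairing [hess] with the tangent space removes xi, and the Gram matrix can be inverted: this
    exhibits Gam as a differentiable function. *)
Lemma gamE u v w : U u ->
  Gam u v w = 'D_v ('D_w f) u *m J *m (E u)^T *m invmx (G u).
Proof.
move=> Uu; rewrite hess // dE // !mulmxDl -!scalemxAl xiJE // mul0mx scaler0 addr0.
by rewrite -!(mulmxA (Gam u v w)) mulmxV ?mulmx1 //; exact: uG.
Qed.

Lemma differentiable_jac u : U u -> differentiable E u.
Proof. by move=> Uu; exact: smooth_differentiable_jacobian Uu. Qed.

Lemma differentiable_gram u : U u -> differentiable (fun y => G y) u.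
Proof.
move=> Uu; have dJ := differentiable_jac Uu.
apply: differentiable_mulmx; last exact: differentiable_trmx.
by apply: differentiable_mulmx => //; exact: differentiable_cst.
Qed.

Lemma differentiable_gam u v w : U u -> differentiable (fun y => Gam y v w) u.
Proof.
move=> Uu; apply: (@near_eq_differentiable _ _ _
    (fun y => 'D_v ('D_w f) y *m J *m (E y)^T *m invmx (G y))).
  by apply: filterS (nU Uu) => y Uy; rewrite gamE.
apply: differentiable_mulmx; last first.
  by apply: differentiable_invmx; [exact: differentiable_gram|exact: uG].
apply: differentiable_mulmx; last by apply: differentiable_trmx; exact: differentiable_jac.
apply: differentiable_mulmx; last exact: differentiable_cst.
by apply: (smooth_differentiable oU) Uu; do 2!apply: smooth_derive.
Qed.

Lemma differentiable_metric u v w : U u ->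
  differentiable (fun y => dot ('D_v f y) ('D_w f y)) u.
Proof.
move=> Uu; apply: (@near_eq_differentiable _ _ _ (fun y => (v *m G y *m w^T) 0 0)).
  by apply: filterS (nU Uu) => y Uy; rewrite dotE.
apply: differentiable_entry; apply: differentiable_mulmx; last exact: differentiable_cst.
by apply: differentiable_mulmx; [exact: differentiable_cst|exact: differentiable_gram].
Qed.

(** [hess] can be solved for xi wherever the metric coefficient of a pair v, w does not vanish; a
    pair with coefficient 1 at u has this property nearby. *)
Lemma xi_differentiable u : U u -> differentiable xi u.
Proof.
move=> Uu; have m0 : (0 < m)%N by apply: leq_trans m2.
have w0 : e_ (Ordinal m0) != 0.
  by apply/eqP => /rowP /(_ (Ordinal m0)) /eqP; rewrite !mxE !eqxx oner_eq0.
have [v vw] := nonzero_partner Uu w0.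
set w := e_ _ in vw.
have dm := differentiable_metric v w Uu.
have nz : \forall y \near u, dot ('D_v f y) ('D_w f y) != 0.
  by apply: differentiable_neq0_near dm _; rewrite vw oner_neq0.
apply: (@near_eq_differentiable _ _ _ (fun y => (dot ('D_v f y) ('D_w f y))^-1 *:
    ('D_v ('D_w f) y - Gam y v w *m E y))).
  apply: filterS2 _ nz (nU Uu) => y nzy Uy.
  by rewrite hess // (dE (Gam y v w)) // addrAC subrr add0r scalerA mulVf // scale1r.
apply: differentiable_scalemx.
  by apply: differentiableV => //; rewrite vw oner_neq0.
apply: differentiableB.
  by apply: (smooth_differentiable oU) Uu; do 2!apply: smooth_derive.
by apply: differentiable_mulmx; [exact: differentiable_gam|exact: differentiable_jac].
Qed.

Let df u v w : U u -> is_derive u w ('D_v f) ('D_w ('D_v f) u).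
Proof.
move=> Uu; apply: derivableP; apply: smooth_derivable Uu.
exact: smooth_derive.
Qed.

Let dxi u v : U u -> is_derive u v xi ('D_v xi u).
Proof. by move=> Uu; apply/derivableP/diff_derivable/xi_differentiable. Qed.

(** When the derivative of [hess] is paired with a normal y, the derivative of Gam is tangential and
    vanishes; differentiating the moving frame brings in [hess] once more, whence a second multiple
    of xi. *)
Lemma third_derivative_normal u z v w y : U u ->
  (forall v, dot ('D_v f u) y = 0) ->
  dot ('D_z ('D_v ('D_w f)) u) y =
  (dot ('D_z f u) ('D_v ('D_w f) u) + (dot ('D_z ('D_v f) u) ('D_w f u) +
   dot ('D_v f u) ('D_z ('D_w f) u))) * dot (xi u) y +
  dot ('D_v f u) ('D_w f u) * dot ('D_z xi u) y.
Proof.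
move=> Uu yT.
have dGam : is_derive u z (fun y => Gam y v w) ('D_z (fun y => Gam y v w) u).
  by apply/derivableP/diff_derivable/differentiable_gam.
have D1 := is_derive_mulmx dGam (smooth_is_derive_jacobian z oU sf Uu).
have Dg := is_derive_gram_form J (df v z Uu) (df w z Uu).
have D2 := is_derive_scalemx Dg (dxi z Uu).
have [_ D] := is_deriveD D1 D2.
have nE : \forall x \near u, 'D_v ('D_w f) x = (fun y => Gam y v w *m E y) x +
    (fun y => dot ('D_v f y) ('D_w f y) *: xi y) x.
  by apply: filterS (nU Uu) => x Ux; rewrite /= -dE //; exact: hess.
refine (etrans (congr1 (fun h => dot h y) (etrans (near_eq_derive z nE) D)) _).
have e1 : dot ('D_z (fun y => Gam y v w) u *m jacobian f u) y = 0.
  by rewrite -(dE _ Uu); exact: yT.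
(* Trades the Christoffel symbol for a second derivative of f, which makes the coefficient of xi
   symmetric in z and v. *)
have e2 := dot_drop_normal (signature_mxT _ _) (hess v w Uu) (xiT z Uu).
have e3 := dot_normal_part (hess z (Gam u v w) Uu) (yT _).
rewrite (derive_jacobian2 _ _ oU sf Uu) -e2 in e3.
exact: dot_leibniz e1 e3 erefl.
Qed.

(* Third derivatives are symmetric in z and v; the components along xi already
   are, so only the derivatives of xi remain. *)
Lemma codazzi u z v w y : U u -> (forall v, dot ('D_v f u) y = 0) ->
  dot ('D_v f u) ('D_w f u) * dot ('D_z xi u) y =
  dot ('D_z f u) ('D_w f u) * dot ('D_v xi u) y.
Proof.
move=> Uu yT.
have T1 := third_derivative_normal z v w Uu yT.
have T2 := third_derivative_normal v z w Uu yT.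
have S1 : 'D_z ('D_v ('D_w f)) u = 'D_v ('D_z ('D_w f)) u.
  by apply: (smooth_schwarz _ _ oU _ Uu); exact: smooth_derive.
have S2 : 'D_z ('D_v f) u = 'D_v ('D_z f) u by exact: (smooth_schwarz _ _ oU sf Uu).
exact: (codazzi_cancel T1 T2 (congr1 (fun h => dot h y) S1) erefl
  (congr1 (fun h => dot h ('D_w f u)) S2) erefl).
Qed.

(** Since m >= 2 there is a nonzero w orthogonal to z; a vector v with <v, w> = 1 then reduces the
    Codazzi equation to the claim. *)
Lemma dxi_normal u z y : U u -> (forall v, dot ('D_v f u) y = 0) ->
  dot ('D_z xi u) y = 0.
Proof.
move=> Uu yT.
have [w [w0 zw]] : exists w, w != 0 /\ dot ('D_z f u) ('D_w f u) = 0.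
  pose K := kermx (G u *m z^T).
  have K0 : K != 0.
    rewrite -mxrank_eq0 mxrank_ker subn_eq0 -ltnNge.
    by apply: leq_ltn_trans (rank_leq_col _) _.
  have /rowV0Pn[w /sub_kermxP wK w0] := K0.
  exists w; split => //; rewrite dotE // (gram_formC z w (GT u)) /gram_form -mulmxA.
  by rewrite wK mxE.
have [v vw] := nonzero_partner Uu w0.
exact: unit_cancel (codazzi z v w Uu yT) vw zw.
Qed.

Lemma dxi_tangent u z w : U u ->
  dot ('D_z xi u) ('D_w f u) = - dot ('D_z f u) ('D_w f u) * dot (xi u) (xi u).
Proof.
move=> Uu; have [_ D] := is_derive_gram_form J (dxi z Uu) (df w z Uu).
have E0 : \forall y \near u, dot (xi y) ('D_w f y) = cst 0 y.
  by apply: filterS (nU Uu) => y Uy; exact: xiT.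
have Z := etrans (esym D) (etrans (near_eq_derive z E0) (derive_cst _ _ _)).
have e := dot_drop_normal (signature_mxT N p) (hess z w Uu).
have e3 : dot ('D_z ('D_w f) u) (xi u) =
    dot ('D_z f u) ('D_w f u) * dot (xi u) (xi u).
  apply: dot_normal_part (hess z w Uu) _.
  by rewrite dotC; exact: xiT.
rewrite [dot (xi u) _]dotC e3 in Z.
by move/eqP: Z; rewrite addr_eq0 => /eqP ->; rewrite mulNr.
Qed.

(** Both sides have the same products with tangent vectors, by differentiating the orthogonality of
    xi and df, and with normal vectors, by Codazzi; these span the space and the form is
    nondegenerate. *)
Lemma derive_xi u z : U u -> 'D_z xi u = - (dot (xi u) (xi u) *: 'D_z f u).
Proof.
move=> Uu; apply/eqP; rewrite -addr_eq0; apply/eqP.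
apply: (gram_form_eq0 (signature_mx_unit N p)) => y.
have [w [y' [yE yT]]] := tangential_decomposition y Uu.
apply: (dot_orthogonal_sum (signature_mxT N p) yE _ _ (yT z) erefl).
  by rewrite -dE //; exact: dxi_tangent.
exact: dxi_normal.
Qed.

Lemma derive_normxi u z : U u -> is_derive u z (fun y => dot (xi y) (xi y)) 0.
Proof.
move=> Uu; have D := is_derive_gram_form J (dxi z Uu) (dxi z Uu).
apply: (is_derive_eq D); rewrite derive_xi // gram_formNl gram_formZl gram_formNr gram_formZr.
by rewrite [dot ('D_z f u) _]dotC xiT // mulr0 oppr0 addr0.
Qed.

Lemma derive_center u z : U u ->
  is_derive u z (fun y => xi y + dot (xi y) (xi y) *: f y) 0.
Proof.
move=> Uu; have d1 : is_derive u z f ('D_z f u).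
  by apply: derivableP; exact: smooth_derivable sf Uu.
have D := is_deriveD (dxi z Uu) (is_derive_scalemx (derive_normxi z Uu) d1).
apply: (is_derive_eq D); rewrite derive_xi // scale0r add0r addrC.
exact: subrr.
Qed.

(* Along a segment, the products of h with the moving frame (df, xi) solve a
   linear differential equation. *)
Lemma normal_propagates (x0 x y : 'rV[R]_m) (r : R) (h : 'rV[R]_N) :
  (forall z, ball x0 r z -> U z) -> ball x0 r x -> ball x0 r y ->
  (forall v, dot ('D_v f x) h = 0) -> dot (xi x) h = 0 ->
  [/\ forall v, dot ('D_v f y) h = 0, dot (xi y) h = 0 & dot (f y) h = dot (f x) h].
Proof.
move=> bU bx yb hT hx; pose v := y - x; pose s (t : R) := x + t *: v.
have Us (t : R) : 0 <= t <= 1 -> U (s t) by move=> t01; apply/bU/ball_segment.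
pose A u : 'M[R]_m := \matrix_(j < m) Gam u v (e_ j).
pose c u := (xi u *m J *m (xi u)^T) 0 0.
(* For Y = (<h, df>, <h, xi>) along the segment, the first column of blocks comes from [hess] and
   the second from [derive_xi]. *)
pose L u : 'M[R]_(m + 1) := block_mx (A u)^T (- (c u *: v^T)) (v *m G u) 0.
pose a t := h *m J *m (E (s t))^T.
pose b t := h *m J *m (xi (s t))^T.
pose Y t : 'rV[R]_(m + 1) := row_mx (a t) (b t).
have dEs (t : R) : 0 <= t <= 1 ->
    is_derive t 1 (fun t => E (s t)) (A (s t) *m E (s t) + (v *m G (s t))^T *m xi (s t)).
  move=> t01; have Ut := Us t t01.
  have [d1 D1] := smooth_is_derive_jacobian v oU sf Ut.
  have [d2 D2] := is_derive_line d1; split; first exact: d2.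
  refine (etrans D2 (etrans D1 _)); apply: matrix_of_rows => j.
  refine (etrans (rowK _ _) (etrans (hess v (e_ j) Ut) _)).
  refine (congr2 +%R _ (congr1 ( *:%R^~ (xi (s t))) _)).
    by rewrite rowK -dE.
  refine (etrans (dotE v (e_ j) Ut) _).
  by rewrite /gram_form trmx_delta -colE mxE.
have dxis (t : R) : 0 <= t <= 1 ->
    is_derive t 1 (fun t => xi (s t)) (- (c (s t) *: 'D_v f (s t))).
  move=> t01; have Ut := Us t t01.
  have [d1 D1] := dxi v Ut; have [d2 D2] := is_derive_line d1.
  by split; [exact: d2|exact: (etrans D2 (derive_xi v Ut))].
have da (t : R) : 0 <= t <= 1 -> is_derive t 1 a
    (a t *m (A (s t))^T + b t *m (v *m G (s t))).
  move=> t01; have D := is_derive_mulmx (is_derive_cst (h *m J) t 1) (is_derive_trmx (dEs t t01)).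
  by apply: (is_derive_eq D); rewrite mul0mx add0r mulmx_tr_sum.
have db (t : R) : 0 <= t <= 1 -> is_derive t 1 b (a t *m - (c (s t) *: v^T)).
  move=> t01; have D := is_derive_mulmx (is_derive_cst (h *m J) t 1) (is_derive_trmx (dxis t t01)).
  by apply: (is_derive_eq D); rewrite mul0mx add0r (mulmx_tr_opp _ _ (dE v (Us t t01))).
have dY (t : R) : 0 <= t <= 1 -> is_derive t 1 Y (Y t *m L (s t)).
  move=> t01; rewrite /L mul_row_block mulmx0 addr0; apply: is_derive_mx => i j.
  case: (split_ordP j) => j' ->.
    rewrite row_mxEl (_ : (fun _ => _) = fun t => a t i j').
      by apply: is_derive_entry; exact: da.
    by apply/funext => z; rewrite row_mxEl.
  rewrite row_mxEr (_ : (fun _ => _) = fun t => b t i j').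
    by apply: is_derive_entry; exact: db.
  by apply/funext => z; rewrite row_mxEr.
have dL u : U u -> differentiable L u.
  move=> Uu; apply: differentiable_mx => i j.
  case: (split_ordP i) => i' ->; case: (split_ordP j) => j' ->.
  - rewrite (_ : (fun _ => _) = fun u => Gam u v (e_ j') 0 i').
      by apply: differentiable_entry; exact: differentiable_gam.
    by apply/funext => z; rewrite block_mxEul !mxE.
  - rewrite (_ : (fun _ => _) = fun u => (- (c u *: v^T)) i' j'); last first.
      by apply/funext => z; rewrite block_mxEur.
    apply: differentiable_entry; apply: differentiableN; apply: differentiable_scalemx.
      have dx := xi_differentiable Uu.
      apply: differentiable_entry; apply: differentiable_mulmx; last exact: differentiable_trmx.
      by apply: differentiable_mulmx => //; exact: differentiable_cst.
    exact: differentiable_cst.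
  - rewrite (_ : (fun _ => _) = fun u => (v *m G u) i' j'); last first.
      by apply/funext => z; rewrite block_mxEdl.
    apply: differentiable_entry; apply: differentiable_mulmx; first exact: differentiable_cst.
    exact: differentiable_gram.
  rewrite (_ : (fun _ => _) = cst 0); first exact: differentiable_cst.
  by apply/funext => z; rewrite block_mxEdr mxE.
have ds (t : R) : differentiable s t.
  by apply: differentiableD; [exact: differentiable_cst|exact: differentiableZl].
have cL (t : R) : 0 <= t <= 1 -> {for t, continuous (fun t => L (s t))}.
  move=> t01; apply: differentiable_continuous; apply: (differentiable_comp (ds t)).
  exact/dL/Us.
have s0 : s 0 = x by rewrite /s scale0r addr0.
have s1 : s 1 = y by rewrite /s scale1r addrC subrK.
have Y0 : Y 0 = 0.
  rewrite /Y /a /b s0 [X in row_mx X _](_ : _ = 0) ?[X in row_mx _ X](_ : _ = 0) ?row_mx0 //.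
    by apply/matrixP => i j; rewrite !ord1 [RHS]mxE; apply: etrans hx; rewrite dotC.
  apply/rowP => j; rewrite [RHS]mxE; apply: etrans (hT (e_ j)); rewrite dotC /gram_form.
  by rewrite dE ?trmx_mul ?trmx_delta ?mulmxA -?colE ?mxE //; exact: bU.
have Yt := linear_ode_zero dY cL Y0.
have aE (t : R) w : 0 <= t <= 1 -> dot ('D_w f (s t)) h = 0.
  move=> t01; have /eq_row_mx[at0 _] : Y t = row_mx 0 0 by rewrite Yt // row_mx0.
  by rewrite dotC (dE w (Us t t01)) /gram_form trmx_mul mulmxA -/(a t) at0 mul0mx mxE.
have t1 : 0 <= (1 : R) <= 1 by rewrite ler01 lexx.
split.
- by move=> w; have := aE 1 w t1; rewrite s1.
- have /eq_row_mx[_ bt0] : Y 1 = row_mx 0 0 by rewrite Yt // row_mx0.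
  by move: bt0; rewrite /b s1 dotC /gram_form => ->; rewrite mxE.
have dF u : U u -> is_derive u v (fun u => dot (f u) h) (dot ('D_v f u) h).
  move=> Uu; have d1 : is_derive u v f ('D_v f u).
    by apply: derivableP; exact: smooth_derivable sf Uu.
  apply: (is_derive_eq (is_derive_gram_form J d1 (is_derive_cst h u v))).
  by rewrite gram_form0r addr0.
have [t t01|t t01] := @line_MVT _ _ (fun u => dot (f u) h) x v.
  by have [] := dF _ (Us t t01).
have [_ D] := dF _ (Us t t01).
rewrite (addrC x) subrK => H; apply/eqP; rewrite -subr_eq0; apply/eqP.
exact: etrans H (etrans D (aE t v t01)).
Qed.

End LocalUmbilical.

(** * Umbilical immersions of a manifold *)

Section KoszulAlgebra.
Context {R : realType} {N : nat} (J : 'M[R]_N).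
Local Notation dot := (gram_form J).
Hypothesis JT : J^T = J.

(** By the symmetry of second derivatives, the six products of the Koszul combination cancel in
    pairs, except for two equal ones. *)
Lemma koszul_sum (vw wv vl lv wl lw fv fw fl : 'rV[R]_N) :
  vw = wv -> vl = lv -> wl = lw ->
  2^-1 * ((dot vw fl + dot fw vl) + (dot wv fl + dot fv wl) -
          (dot lv fw + dot fv lw)) = dot vw fl.
Proof.
move=> <- <- <-; rewrite (gram_formC fw vl) //.
by rewrite !addrA; field.
Qed.

Lemma gram_form_lower m (G : 'M[R]_m) (E : 'M[R]_(m, N)) a (r z : 'rV[R]_m) :
  G \in unitmx -> r = a *m J *m E^T ->
  gram_form G (r *m invmx G) z = dot a (z *m E).
Proof. by move=> uG ->; rewrite /gram_form mulmxKV // trmx_mul !mulmxA. Qed.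

(** The sphere contributes - g f to the flat Hessian, so the normal part is g (H - f): this is the
    origin of [chart_xi]. *)
Lemma umbilical_hessian a b H f g : dot a f = - g ->
  a - dot a f *: f - b = g *: H -> a = b + g *: (H - f).
Proof.
move=> -> /eqP; rewrite scaleNr opprK subr_eq => /eqP E.
by rewrite scalerBr addrA [b + _]addrC -E addrK.
Qed.

Lemma dot_one_hessian a b x y g : a = b + g *: x -> g = 1 -> dot a y = dot b y + dot x y.
Proof. by move=> -> ->; rewrite scale1r gram_formDl. Qed.

End KoszulAlgebra.

Section ChartFacts.
Context {R : realType} {m s n p : nat} (M : pseudoRiemannian R m s).
Variable phi : M -> 'rV[R]_n.+1.
Hypothesis m2 : (2 <= m)%N.
Hypothesis phi_iso : isometric_immersion p phi.
Hypothesis phi_umb : totally_umbilical p phi.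
Local Notation e_ j := (delta_mx 0 j : 'rV[R]_m).
Local Notation J := (signature_mx n.+1 p : 'M[R]_n.+1).
Local Notation dot := (gram_form (signature_mx n.+1 p : 'M[R]_n.+1)).

(** The mean curvature vector in the flat ambient space, whose part normal to the sphere is -
    phi. *)
Definition chart_xi (k : chart R M m) u : 'rV[R]_n.+1 :=
  mean_curvature p phi k u - phi (cpar k u).

Variable k : chart R M m.
Hypothesis kA : atlas M k.
Local Notation f := (phi \o cpar k).
Local Notation U := (crange k).
Local Notation g := (metric M k).

Let oU : open U := @crange_open _ _ _ k.

Let nU u : U u -> \forall y \near u, U y.
Proof. by move=> Uu; exact: open_nbhs_nbhs. Qed.

Lemma chart_smooth : smooth_on U f.
Proof. by have [_ /(_ k kA) []] := phi_iso. Qed.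

Let sf := chart_smooth.

Lemma chart_metric u v w : U u -> gram_form (g u) v w = dot ('D_v f u) ('D_w f u).
Proof.
move=> Uu; have [_ /(_ k kA) [_ /(_ u Uu) [_ H]]] := phi_iso.
by rewrite -mink_gram; exact: esym (H v w).
Qed.

Lemma chart_metricE u : U u -> jacobian f u *m J *m (jacobian f u)^T = g u.
Proof.
move=> Uu; apply/matrixP => i j; rewrite -gram_form_row -gram_form_delta chart_metric //.
by rewrite !row_jacobian //; exact: (smooth_differentiable oU sf Uu).
Qed.

Lemma chart_unit u : U u -> jacobian f u *m J *m (jacobian f u)^T \in unitmx.
Proof. by move=> Uu; rewrite chart_metricE //; exact: metric_nondegenerate. Qed.

Let df u v w : U u -> is_derive u w ('D_v f) ('D_w ('D_v f) u).
Proof.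
move=> Uu; apply: derivableP; apply: smooth_derivable Uu.
exact: smooth_derive.
Qed.

Let df1 u v : U u -> is_derive u v f ('D_v f u).
Proof. by move=> Uu; apply: derivableP; exact: smooth_derivable sf Uu. Qed.

Lemma derive_metric u v w z : U u -> 'D_z (fun a => gram_form (g a) v w) u =
  dot ('D_z ('D_v f) u) ('D_w f u) + dot ('D_v f u) ('D_z ('D_w f) u).
Proof.
move=> Uu; have [_ D] := is_derive_gram_form J (df v z Uu) (df w z Uu).
apply: etrans D; apply: near_eq_derive.
by apply: filterS (nU Uu) => y Uy; exact: chart_metric.
Qed.

(** For an isometric immersion, the Koszul formula says that the image of the Christoffel symbol is
    the tangential part of the flat second derivative. *)
Lemma chart_koszul u v w z : U u ->
  dot ('D_(christoffel k u v w) f u) ('D_z f u) = dot ('D_v ('D_w f) u) ('D_z f u).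
Proof.
move=> Uu; rewrite -chart_metric //.
have dz : 'D_z f u = z *m jacobian f u.
  by rewrite derive_jacobian //; exact: (smooth_differentiable oU sf Uu).
refine (etrans _ (congr1 (dot _) (esym dz))).
apply: gram_form_lower; first exact: metric_nondegenerate.
apply/rowP => l; rewrite mxE.
have dl : 'D_(e_ l) f u = e_ l *m jacobian f u.
  by rewrite derive_jacobian //; exact: (smooth_differentiable oU sf Uu).
transitivity (dot ('D_v ('D_w f) u) ('D_(e_ l) f u)); last first.
  refine (etrans (congr1 (dot _) dl) _).
  by rewrite /gram_form trmx_mul trmx_delta mulmxA -colE mxE.
rewrite (derive_metric _ _ v Uu) (derive_metric _ _ w Uu) (derive_metric _ _ (e_ l) Uu).
apply: koszul_sum; first exact: signature_mxT.
- exact: (smooth_schwarz _ _ oU sf Uu).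
- exact: (smooth_schwarz _ _ oU sf Uu).
- exact: (smooth_schwarz _ _ oU sf Uu).
Qed.

Lemma phi_norm x : dot (phi x) (phi x) = 1.
Proof. by have [/(_ x)] := phi_iso; rewrite /psphere /= mink_gram expr1n. Qed.

Let dotC x y : dot x y = dot y x.
Proof. by rewrite gram_formC ?signature_mxT. Qed.

Lemma chart_tangent_normal u v : U u -> dot ('D_v f u) (f u) = 0.
Proof.
move=> Uu; have [_ D] := is_derive_gram_form J (df1 v Uu) (df1 v Uu).
have E : \forall y \near u, dot (f y) (f y) = cst 1 y.
  by apply: filterS (nU Uu) => y _; exact: phi_norm.
have Z := etrans (esym D) (etrans (near_eq_derive v E) (derive_cst _ _ _)).
rewrite [dot (f u) _]dotC -mulr2n in Z.
by move/eqP: Z; rewrite mulrn_eq0 => /eqP.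
Qed.

Lemma chart_hess_normal u v w : U u ->
  dot ('D_v ('D_w f) u) (f u) = - dot ('D_v f u) ('D_w f u).
Proof.
move=> Uu; have [_ D] := is_derive_gram_form J (df w v Uu) (df1 v Uu).
have E : \forall y \near u, dot ('D_w f y) (f y) = cst 0 y.
  by apply: filterS (nU Uu) => y Uy; exact: chart_tangent_normal.
have Z := etrans (esym D) (etrans (near_eq_derive v E) (derive_cst _ _ _)).
by move/eqP: Z; rewrite addr_eq0 => /eqP ->; rewrite dotC.
Qed.

Lemma chart_hess u v w : U u -> 'D_v ('D_w f) u =
  'D_(christoffel k u v w) f u + dot ('D_v f u) ('D_w f u) *: chart_xi k u.
Proof.
move=> Uu; have := phi_umb v w kA Uu.
rewrite /second_fundamental_form /ambient_nabla mink_gram (chart_metric v w Uu).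
by apply: umbilical_hessian; exact: chart_hess_normal.
Qed.

Lemma exists_unit_pair u : U u -> exists v w, dot ('D_v f u) ('D_w f u) = 1.
Proof.
move=> Uu; have m0 : (0 < m)%N by apply: leq_trans m2.
have w0 : e_ (Ordinal m0) != 0.
  by apply/eqP => /rowP /(_ (Ordinal m0)) /eqP; rewrite !mxE !eqxx oner_eq0.
by have [v vw] := nonzero_partner oU sf chart_unit Uu w0; exists v, (e_ (Ordinal m0)).
Qed.

(** The mean curvature is defined as a trace, so normality has to be deduced: for v, w with <v, w> =
    1, xi is the flat second derivative minus its tangential part. *)
Lemma chart_xiT u z : U u -> dot (chart_xi k u) ('D_z f u) = 0.
Proof.
move=> Uu; have [v [w vw]] := exists_unit_pair Uu.
have := dot_one_hessian J ('D_z f u) (chart_hess v w Uu) vw.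
rewrite (chart_koszul v w z Uu) => H.
by apply: (addrI (dot ('D_v ('D_w f) u) ('D_z f u))); rewrite addr0 -H.
Qed.

Lemma chart_xif u : U u -> dot (chart_xi k u) (f u) = -1.
Proof.
move=> Uu; have [v [w vw]] := exists_unit_pair Uu.
have := dot_one_hessian J (f u) (chart_hess v w Uu) vw.
by rewrite (chart_hess_normal v w Uu) (chart_tangent_normal _ Uu) vw add0r.
Qed.

End ChartFacts.

Lemma connected_locally_constant (T : topologicalType) (P : set T) :
  connected [set: T] ->
  (forall x, exists2 B, nbhs x B & forall y, B y -> P y <-> P x) ->
  P !=set0 -> P = [set: T].
Proof.
move=> cT loc P0; apply: cT => //.
- exists P; last by rewrite setTI.
  rewrite openE => x Px; have [B nB BP] := loc x.
  by apply: filterS nB => y /BP [_ H]; exact: H.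
exists P; last by rewrite setTI.
rewrite -[P]setCK; apply: open_closedC; rewrite openE => x nPx.
by have [B nB BP] := loc x; apply: filterS nB => y /BP [H _] /H.
Qed.

(** * Independence of the chart *)

Section SecondOrderChainRule.
Context {R : realType} {m m' q : nat}.

(** The last term of the second-order chain rule is tangent to the image of f, so the normal part of
    the Hessian does not depend on the chart. *)
Lemma hessian_comp (W : set 'rV[R]_m) (U : set 'rV[R]_m')
    (tau : 'rV[R]_m -> 'rV[R]_m') (f : 'rV[R]_m' -> 'rV[R]_q) u v w :
  open W -> open U -> smooth_on W tau -> smooth_on U f ->
  (forall x, W x -> U (tau x)) -> W u ->
  'D_v (f \o tau) u = 'D_('D_v tau u) f (tau u) /\
  'D_v ('D_w (f \o tau)) u =
    'D_('D_v tau u) ('D_('D_w tau u) f) (tau u) + 'D_('D_v ('D_w tau) u) f (tau u).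
Proof.
move=> oW oU st sf WU Wu.
have first x z : W x -> 'D_z (f \o tau) x = 'D_('D_z tau x) f (tau x).
  move=> Wx; have [_ D] := @is_derive_comp _ _ _ _ tau f x z
    (smooth_differentiable oW st Wx) (smooth_differentiable oU sf (WU _ Wx)).
  exact: D.
split; first exact: first.
have E : \forall x \near u, 'D_w (f \o tau) x = 'D_w tau x *m jacobian f (tau x).
  have := open_nbhs_nbhs (conj oW Wu); apply: filterS => x Wx.
  by rewrite first // derive_jacobian //; exact: (smooth_differentiable oU sf (WU _ Wx)).
have d1 : is_derive u v ('D_w tau) ('D_v ('D_w tau) u).
  by apply: derivableP; apply: smooth_derivable Wu; exact: smooth_derive.
have d2 : is_derive u v (fun x => jacobian f (tau x))
    (\matrix_j 'D_('D_v tau u) ('D_(delta_mx 0 j) f) (tau u)).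
  have [_ <-] := smooth_is_derive_jacobian ('D_v tau u) oU sf (WU _ Wu).
  apply: (is_derive_comp (g := tau)); first exact: (smooth_differentiable oW st Wu).
  exact: (smooth_differentiable_jacobian oU sf (WU _ Wu)).
have [_ D] := is_derive_mulmx d1 d2.
refine (etrans (near_eq_derive v E) (etrans D _)); rewrite addrC.
refine (congr2 +%R (esym (derive_jacobian2 _ _ oU sf (WU _ Wu))) (esym _)).
by rewrite derive_jacobian //; exact: (smooth_differentiable oU sf (WU _ Wu)).
Qed.

End SecondOrderChainRule.

(** The difference x - y is both tangential and normal, hence 0 as the Gram matrix is invertible. *)
Lemma normal_part_unique {R : realType} {m N : nat} (J : 'M[R]_N) (E : 'M[R]_(m, N))
    (x y : 'rV[R]_N) (a b c : 'rV[R]_m) :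
  E *m J *m E^T \in unitmx -> a *m E + x = b *m E + y + c *m E ->
  (forall z, gram_form J x (z *m E) = 0) -> (forall z, gram_form J y (z *m E) = 0) ->
  x = y.
Proof.
move=> uG H Hx Hy.
have xy : x - y = (b + c - a) *m E.
  rewrite mulmxBl mulmxDl; apply: (addrI (a *m E)).
  rewrite addrA H [RHS]addrC subrK (addrAC (b *m E)).
  exact: addrK.
have : b + c - a = 0.
  apply: (gram_form_eq0 uG) => z; rewrite -gram_form_mul -xy.
  by rewrite gram_formDl gram_formNl Hx Hy subrr.
by move=> z0; apply/eqP; rewrite -subr_eq0 xy z0 mul0mx.
Qed.

Section ChartChange.
Context {R : realType} {m s n p : nat} (M : pseudoRiemannian R m s).
Variable phi : M -> 'rV[R]_n.+1.
Hypothesis m2 : (2 <= m)%N.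
Hypothesis phi_iso : isometric_immersion p phi.
Hypothesis phi_umb : totally_umbilical p phi.
Local Notation J := (signature_mx n.+1 p : 'M[R]_n.+1).
Local Notation dot := (gram_form (signature_mx n.+1 p : 'M[R]_n.+1)).

Let dotC x y : dot x y = dot y x.
Proof. by rewrite gram_formC ?signature_mxT. Qed.

Section TwoCharts.
Variables k l : chart R M m.
Hypotheses (kA : atlas M k) (lA : atlas M l).
Let tau := ccoord l \o cpar k.
Let W := crange k `&` cpar k @^-1` cdom l.

Let oW : open W.
Proof.
rewrite openE => u [Uu Lu]; apply: filterI.
  by apply: open_nbhs_nbhs; split => //; exact: crange_open.
apply: (cpar_cont Uu); apply: open_nbhs_nbhs; split => //.
exact: cdom_open.
Qed.

Let Wtau u : W u -> crange l (tau u).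
Proof. by move=> [Uu Lu]; have [] := ccoordK Lu. Qed.

Let phi_tau u : W u -> (phi \o cpar k) u = ((phi \o cpar l) \o tau) u.
Proof. by move=> [Uu Lu] /=; rewrite /tau /=; have [_ ->] := ccoordK Lu. Qed.

Let near_phi u : W u -> \forall x \near u, (phi \o cpar k) x = ((phi \o cpar l) \o tau) x.
Proof. by move=> Wu; have := open_nbhs_nbhs (conj oW Wu); apply: filterS => x /phi_tau. Qed.

Let hess u v w (Wu : W u) := hessian_comp v w oW (@crange_open _ _ _ l)
  (atlas_smooth kA lA) (chart_smooth phi_iso lA) Wtau Wu.

Lemma chart_change_tangent u v : W u ->
  'D_v (phi \o cpar k) u = 'D_('D_v tau u) (phi \o cpar l) (tau u).
Proof.
move=> Wu; refine (etrans (near_eq_derive v (near_phi Wu)) _).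
by have [] := hess v v Wu.
Qed.

Lemma chart_change_hess u v w : W u ->
  'D_v ('D_w (phi \o cpar k)) u =
  'D_('D_v tau u) ('D_('D_w tau u) (phi \o cpar l)) (tau u) +
  'D_('D_v ('D_w tau) u) (phi \o cpar l) (tau u).
Proof.
move=> Wu; have [_ <-] := hess v w Wu; apply: near_eq_derive.
have := open_nbhs_nbhs (conj oW Wu); apply: filterS => x Wx.
exact: near_eq_derive (near_phi Wx).
Qed.

End TwoCharts.

Lemma chart_change_normal (k l : chart R M m) u h : atlas M k -> atlas M l ->
  crange k u -> cdom l (cpar k u) ->
  (forall v, dot ('D_v (phi \o cpar l) (ccoord l (cpar k u))) h = 0) ->
  forall v, dot ('D_v (phi \o cpar k) u) h = 0.
Proof.
move=> kA lA Uu Lu H v.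
refine (etrans (congr1 (fun y => dot y h) (chart_change_tangent kA lA v (conj Uu Lu))) _).
exact: H.
Qed.

(* In both charts xi is the component of the Hessian of phi that is normal to
   the common tangent space. *)
Lemma chart_change_xi (k l : chart R M m) u : atlas M k -> atlas M l ->
  crange k u -> cdom l (cpar k u) ->
  chart_xi (p := p) phi k u = chart_xi (p := p) phi l (ccoord l (cpar k u)).
Proof.
move=> kA lA Uu Lu; set u' := ccoord l (cpar k u).
have [Uu' pu'] : crange l u' /\ cpar l u' = cpar k u by exact: ccoordK.
have [ku ku'] := cparK Uu.
have Wu : (crange k `&` cpar k @^-1` cdom l) u by split.
have [v [w vw]] := exists_unit_pair m2 phi_iso kA Uu.
have Hk := chart_hess phi_iso phi_umb kA v w Uu.
have Hc := chart_change_hess kA lA v w Wu.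
(* The vector xi of chart k is normal to the derivatives in chart l, because the reverse change of
   charts expresses these through chart k. *)
have Tl z : dot (chart_xi (p := p) phi k u) ('D_z (phi \o cpar l) u') = 0.
  have Wl : (crange l `&` cpar l @^-1` cdom k) u' by split => //=; rewrite pu'.
  have E := chart_change_tangent lA kA z Wl.
  rewrite /= pu' ku' in E.
  refine (etrans (congr1 (dot _) E) _).
  exact: chart_xiT.
rewrite vw scale1r in Hk.
pose tv := 'D_v (ccoord l \o cpar k) u; pose tw := 'D_w (ccoord l \o cpar k) u.
have Hl := chart_hess phi_iso phi_umb lA tv tw Uu'.
have g1 : dot ('D_tv (phi \o cpar l) u') ('D_tw (phi \o cpar l) u') = 1.
  refine (etrans _ vw).
  exact: (congr2 dot (esym (chart_change_tangent kA lA v Wu)) (esym (chart_change_tangent kA lA w Wu))).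
rewrite g1 scale1r in Hl.
have E := etrans (esym Hk) (etrans Hc (congr1 (fun x => x + _) Hl)).
have dl z : 'D_z (phi \o cpar l) u' = z *m jacobian (phi \o cpar l) u'.
  rewrite derive_jacobian //.
  exact: (smooth_differentiable (@crange_open _ _ _ l) (chart_smooth phi_iso lA) Uu').
apply: (normal_part_unique (chart_unit phi_iso lA Uu')).
- refine (etrans (congr1 (fun x => x + _) (esym (dl _))) _).
  refine (etrans (congr1 (fun x => x + _) (esym (chart_change_tangent kA lA _ Wu))) _).
  refine (etrans E _).
  exact: (congr2 (fun x y => x + _ + y) (dl _) (dl _)).
- by move=> z; rewrite -dl; exact: Tl.
- by move=> z; rewrite -dl; exact: chart_xiT.
Qed.

End ChartChange.

(** * From charts to the connected manifold *)

Section Globalization.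
Context {R : realType} {m s n p : nat} (M : pseudoRiemannian R m s).
Variable phi : M -> 'rV[R]_n.+1.
Hypothesis m2 : (2 <= m)%N.
Hypothesis phi_iso : isometric_immersion p phi.
Hypothesis phi_umb : totally_umbilical p phi.
Hypothesis M_conn : connected [set: M].
Local Notation J := (signature_mx n.+1 p : 'M[R]_n.+1).
Local Notation dot := (gram_form (signature_mx n.+1 p : 'M[R]_n.+1)).

Let dotC x y : dot x y = dot y x.
Proof. by rewrite gram_formC ?signature_mxT. Qed.

(** The chart is chosen pointwise and may jump with x; [normal_xi_chart] and [normal_to_chart] bring
    statements back to a fixed chart before anything is differentiated. *)
Definition chart_at (x : M) : chart R M m := s2val (cid2 (atlas_cover x)).

Lemma chart_at_atlas x : atlas M (chart_at x).
Proof. by rewrite /chart_at; case: cid2. Qed.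

Lemma chart_at_dom x : cdom (chart_at x) x.
Proof. by rewrite /chart_at; case: cid2. Qed.

Local Notation coord_at x := (ccoord (chart_at x) x).
Local Notation f_at x := (phi \o cpar (chart_at x)).

Lemma chart_at_range x : crange (chart_at x) (coord_at x).
Proof. by have [] := ccoordK (chart_at_dom x). Qed.

Lemma chart_at_par x : cpar (chart_at x) (coord_at x) = x.
Proof. by have [] := ccoordK (chart_at_dom x). Qed.

Definition normal_xi x : 'rV[R]_n.+1 := chart_xi (p := p) phi (chart_at x) (coord_at x).

Definition tangent_frame x : 'M[R]_(m, n.+1) := jacobian (f_at x) (coord_at x).

Lemma tangent_frameE x v : 'D_v (f_at x) (coord_at x) = v *m tangent_frame x.
Proof.
rewrite derive_jacobian //.
exact: (smooth_differentiable (@crange_open _ _ _ (chart_at x))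
  (chart_smooth phi_iso (chart_at_atlas x)) (chart_at_range x)).
Qed.

Lemma normal_xi_chart (k : chart R M m) u : atlas M k -> crange k u ->
  normal_xi (cpar k u) = chart_xi (p := p) phi k u.
Proof.
move=> kA Uu; apply/esym; apply: chart_change_xi => //.
  exact: chart_at_atlas.
exact: chart_at_dom.
Qed.

Definition normal_to x h := forall v, dot (v *m tangent_frame x) h = 0.

Lemma normal_to_chart (k : chart R M m) u h : atlas M k -> crange k u ->
  normal_to (cpar k u) h <-> forall v, dot ('D_v (phi \o cpar k) u) h = 0.
Proof.
move=> kA Uu; set x := cpar k u; split => H.
  apply: (chart_change_normal phi_iso kA (chart_at_atlas x) Uu (chart_at_dom x)) => v.
  by refine (etrans (congr1 (fun y => dot y h) (tangent_frameE x v)) _); exact: H.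
move=> v; refine (etrans (congr1 (fun y => dot y h) (esym (tangent_frameE x v))) _).
have [kx cx] := cparK Uu.
apply: (chart_change_normal phi_iso (chart_at_atlas x) kA (chart_at_range x)).
  by rewrite chart_at_par.
by move=> w; rewrite chart_at_par cx.
Qed.

(** A ball in coordinates is convex, so any two points of B are joined by a segment to which the
    local results apply. *)
Lemma chart_ball x : exists (k : chart R M m) (r : R) (B : set M),
  [/\ atlas M k, nbhs x B, (forall z, ball (ccoord k x) r z -> crange k z),
      B x & forall y, B y -> cdom k y /\ ball (ccoord k x) r (ccoord k y)].
Proof.
exists (chart_at x); set k := chart_at x.
have : nbhs (ccoord k x) (crange k).
  apply: open_nbhs_nbhs; split; [exact: crange_open|exact: chart_at_range].
move=> /nbhs_ballP[r /= r0 Hr]; exists r.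
exists (cdom k `&` ccoord k @^-1` ball (ccoord k x) r).
have nB : nbhs x (cdom k `&` ccoord k @^-1` ball (ccoord k x) r).
  apply: filterI.
    by apply: open_nbhs_nbhs; split; [exact: cdom_open|exact: chart_at_dom].
  by apply: (ccoord_cont (chart_at_dom x)); exact: nbhsx_ballx.
split => //; first exact: chart_at_atlas.
by split; [exact: chart_at_dom|exact: ballxx].
Qed.

Let c x := dot (normal_xi x) (normal_xi x).

Lemma curvature_constant x y : c x = c y.
Proof.
have H := @connected_locally_constant _ [set z | c z = c x] M_conn.
suff: [set z | c z = c x] = [set: M] by move=> E; have : [set: M] y by []; rewrite -E => ->.
apply: H; last by exists x.
move=> z; have [k [r [B [kA nB bU Bz HB]]]] := chart_ball z.
exists B => // y' By'; rewrite /=; suff -> : c y' = c z by [].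
have [kz bz] := HB _ Bz; have [ky by'] := HB _ By'.
have [Uz Ez] := ccoordK kz; have [Uy Ey] := ccoordK ky.
pose F u : R := dot (chart_xi (p := p) phi k u) (chart_xi (p := p) phi k u).
have cE w (kw : cdom k w) : c w = F (ccoord k w).
  by have [Uw Ew] := ccoordK kw; rewrite -[in LHS]Ew /c normal_xi_chart.
rewrite !cE //.
apply: (@line_constant _ _ (crange k) F _ _ bU _ _ _ by' bz) => u v Uu.
exact: (derive_normxi (@crange_open _ _ _ k) (chart_smooth phi_iso kA)
  (chart_unit phi_iso kA) (chart_hess phi_iso phi_umb kA)
  (chart_xiT m2 phi_iso phi_umb kA) m2).
Qed.

(** The constant vector P of the overview: when c is not 0, P / c is the centre of the quadric. *)
Definition center x := normal_xi x + c x *: phi x.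

Lemma center_constant x y : center x = center y.
Proof.
have H := @connected_locally_constant _ [set z | center z = center x] M_conn.
suff: [set z | center z = center x] = [set: M].
  by move=> E; have : [set: M] y by []; rewrite -E => ->.
apply: H; last by exists x.
move=> z; have [k [r [B [kA nB bU Bz HB]]]] := chart_ball z.
exists B => // y' By'; rewrite /=; suff -> : center y' = center z by [].
have [kz bz] := HB _ Bz; have [ky by'] := HB _ By'.
have [Uz Ez] := ccoordK kz; have [Uy Ey] := ccoordK ky.
have cE w (kw : cdom k w) : center w = (fun u => chart_xi (p := p) phi k u +
    dot (chart_xi (p := p) phi k u) (chart_xi (p := p) phi k u) *: phi (cpar k u)) (ccoord k w).
  have [Uw Ew] := ccoordK kw; rewrite -[in LHS]Ew /center /c normal_xi_chart //.
rewrite !cE //; apply/matrixP => i j.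
pose F u : R := (chart_xi (p := p) phi k u +
    dot (chart_xi (p := p) phi k u) (chart_xi (p := p) phi k u) *: phi (cpar k u)) i j.
apply: (@line_constant _ _ (crange k) F _ _ bU _ _ _ by' bz) => u v Uu.
have D := derive_center (@crange_open _ _ _ k) (chart_smooth phi_iso kA)
  (chart_unit phi_iso kA) (chart_hess phi_iso phi_umb kA)
  (chart_xiT m2 phi_iso phi_umb kA) m2 v Uu.
by have := is_derive_entry i j D; rewrite mxE.
Qed.

(** [normal_propagates] works in both directions between any two points of a chart ball, so the set
    of points with the three properties is open and closed. *)
Lemma normal_everywhere x y h : normal_to x h -> dot (normal_xi x) h = 0 ->
  [/\ normal_to y h, dot (normal_xi y) h = 0 & dot (phi y) h = dot (phi x) h].
Proof.
move=> hT hx.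
pose P := [set z | [/\ normal_to z h, dot (normal_xi z) h = 0 &
  dot (phi z) h = dot (phi x) h]].
suff E : P = [set: M] by have : [set: M] y by []; rewrite -E.
apply: connected_locally_constant => //; last by exists x.
move=> z; have [k [r [B [kA nB bU Bz HB]]]] := chart_ball z.
have prop a b : B a -> B b -> P a -> P b.
  move=> Ba Bb [aT ax aE].
  have [ka ba] := HB _ Ba; have [kb bb] := HB _ Bb.
  have [Ua Ea] := ccoordK ka; have [Ub Eb] := ccoordK kb.
  have aT' : forall v, dot ('D_v (phi \o cpar k) (ccoord k a)) h = 0.
    by apply/(normal_to_chart h kA Ua); rewrite Ea.
  have ax' : dot (chart_xi (p := p) phi k (ccoord k a)) h = 0.
    by rewrite -(normal_xi_chart kA Ua) Ea.
  have [bT bx bE] := normal_propagates (@crange_open _ _ _ k) (chart_smooth phi_iso kA)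
    (chart_unit phi_iso kA) (chart_hess phi_iso phi_umb kA)
    (chart_xiT m2 phi_iso phi_umb kA) m2 bU ba bb aT' ax'.
  split.
  - by have := (normal_to_chart h kA Ub).2 bT; rewrite Eb.
  - by have := normal_xi_chart kA Ub; rewrite Eb => ->.
  - by move: bE; rewrite /= Ea Eb => ->; exact: aE.
exists B; first exact: nB.
by move=> w Bw; split => H; [exact: (prop w z Bw Bz H)|exact: (prop z w Bz Bw H)].
Qed.

(** Its row space is the subspace W of the overview. It may be degenerate: when c = 0, xi is null
    and orthogonal to all of it. *)
Definition hull x : 'M[R]_(m + 1, n.+1) := col_mx (tangent_frame x) (normal_xi x).

Lemma hull_orthogonal x (h : 'rV[R]_n.+1) : hull x *m J *m h^T = 0 ->
  normal_to x h /\ dot (normal_xi x) h = 0.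
Proof.
rewrite /hull !mul_col_mx => /eqP; rewrite col_mx_eq0 => /andP[/eqP H1 /eqP H2]; split.
  by move=> v; rewrite /gram_form -!(mulmxA v) H1 mulmx0 mxE.
by rewrite /gram_form H2 mxE.
Qed.

Lemma sub_hull x y : (phi y - phi x <= hull x)%MS.
Proof.
apply: double_orthogonal => h /hull_orthogonal [hT hx].
by have [_ _ E] := normal_everywhere y hT hx; rewrite gram_formDl gram_formNl E subrr.
Qed.

Lemma hull_constant x y : (hull y :=: hull x)%MS.
Proof.
have le a b : (hull b <= hull a)%MS.
  rewrite {1}/hull col_mx_sub; apply/andP; split; last first.
    apply: (@double_orthogonal _ _ _ p) => h /hull_orthogonal [hT hx].
    by have [] := normal_everywhere b hT hx.
  apply/row_subP => i; apply: (@double_orthogonal _ _ _ p) => h /hull_orthogonal [hT hx].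
  by have [bT _ _] := normal_everywhere b hT hx; rewrite rowE; exact: bT.
by apply/eqmxP; rewrite !le.
Qed.

End Globalization.

(** * Completeness and geodesics *)

Section Jacobi.
Context {R : realType}.
Implicit Types (k d : R).

Lemma derive_zero_constant (F : R -> R) : (forall t : R, is_derive t 1 F 0) ->
  forall t, F t = F 0.
Proof.
move=> dF t; have dF' (x v : R) : is_derive x v F 0.
  have [d1 D1] := dF x; have := derive_scale_dir v d1.
  by rewrite D1 scaler0 [v *: 1]mulr1.
apply: (@line_constant _ _ setT F 0 (`|t| + 1)) => //.
- by rewrite -ball_normE /= sub0r normrN ltrDl.
- by apply: ballxx; rewrite ltr_wpDl.
Qed.

Lemma is_derive_scaled_arg (F dF : R -> R) (w : R) :
  (forall t : R, is_derive t 1 F (dF t)) ->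
  forall t : R, is_derive t 1 (fun t => F (w * t)) (w * dF (w * t)).
Proof.
move=> H t; have d1 : is_derive t 1 (fun s : R => w * s) w.
  have -> : (fun s : R => w * s) = w *: (id : R -> R) by [].
  by apply: is_derive_eq; rewrite [LHS]mulr1.
by have := @is_derive1_comp _ F (fun s => w * s) t _ _ (H (w * t)) d1; rewrite mulrC.
Qed.

Lemma is_derive_scaled (F : R -> R) (t a b : R) : is_derive t 1 F b ->
  is_derive t 1 (fun t => a * F t) (a * b).
Proof. by move=> H; exact: (@is_deriveZ _ _ _ F a t 1 b H). Qed.

(* S, D and C are the generalised sine, cosine and versine of curvature k. *)
Lemma generalized_sine k d : 0 < d -> d ^+ 2 = 1 - k ->
  exists S D C : R -> R,
    [/\ forall t : R, is_derive t 1 S (D t),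
        forall t : R, is_derive t 1 D (- k * S t),
        forall t : R, is_derive t 1 C (S t),
        [/\ S 0 = 0, D 0 = 1 & C 0 = 0] &
        exists t : R, S t = 1 /\ C t = (1 + d)^-1].
Proof.
move=> d0 dk; have d1 : 1 + d != 0 by rewrite gt_eqF // addr_gt0.
(* For k <> 0 the versine is (1 - D) / k, and (1 - d) / k = 1 / (1 + d) since d^2 = 1 - k. *)
have versine (S D : R -> R) (t0 : R) : k != 0 ->
    (forall t : R, is_derive t 1 S (D t)) -> (forall t : R, is_derive t 1 D (- k * S t)) ->
    S 0 = 0 -> D 0 = 1 -> S t0 = 1 -> D t0 = d ->
    exists S D C : R -> R,
    [/\ forall t : R, is_derive t 1 S (D t),
        forall t : R, is_derive t 1 D (- k * S t),
        forall t : R, is_derive t 1 C (S t),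
        [/\ S 0 = 0, D 0 = 1 & C 0 = 0] &
        exists t : R, S t = 1 /\ C t = (1 + d)^-1].
  move=> k0 dS dD S0 D0 St Dt; exists S, D, (fun t => k^-1 * (1 - D t)); split => //.
  - move=> t; have -> : S t = k^-1 * (0 - (- k * S t)) by rewrite sub0r mulNr opprK mulKf.
    apply: is_derive_scaled; exact: (is_deriveB (is_derive_cst (1 : R) t 1) (dD t)).
  - by rewrite D0 subrr mulr0.
  - exists t0; rewrite St Dt; split => //; apply: (mulfI d1); rewrite mulfV //.
    by apply: (mulfI k0); rewrite mulrCA mulVKf // mulr1; move: dk; lra.
have [k0|k0|k0] := ltgtP k 0.
- pose w := Num.sqrt (- k); have w0 : 0 < w by rewrite sqrtr_gt0 oppr_gt0.
  have ww : w ^+ 2 = - k by rewrite sqr_sqrtr // oppr_ge0 ltW.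
  have w1 : w != 0 by rewrite gt_eqF.
  have e1 := is_derive_scaled_arg w (@is_derive_expR R).
  have e2 := is_derive_scaled_arg (- w) (@is_derive_expR R).
  have dw : 0 < d + w by rewrite addr_gt0.
  (* Here S = 1 and D = d read sinh(w t) = w and cosh(w t) = d, that is exp(w t) = d + w, with
     inverse d - w. *)
  have ed : expR (ln (d + w)) = d + w by rewrite lnK.
  have ed' : expR (- ln (d + w)) = d - w.
    rewrite expRN ed; apply: (mulfI (lt0r_neq0 dw)); rewrite mulfV ?gt_eqF //.
    by move: dk; rewrite -[k]opprK -ww opprK => E; move: E; lra.
  apply: (@versine (fun t => (2 * w)^-1 * (expR (w * t) - expR (- w * t)))
    (fun t => 2^-1 * (expR (w * t) + expR (- w * t))) (ln (d + w) / w)).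
  + by rewrite lt_eqF.
  + move=> t; have -> : 2^-1 * (expR (w * t) + expR (- w * t)) =
      (2 * w)^-1 * (w * expR (w * t) - (- w) * expR (- w * t)) by field.
    by apply: is_derive_scaled; exact: is_deriveB (e1 t) (e2 t).
  + move=> t; have -> : - k * ((2 * w)^-1 * (expR (w * t) - expR (- w * t))) =
      2^-1 * (w * expR (w * t) + (- w) * expR (- w * t)) by rewrite -ww; field.
    by apply: is_derive_scaled; exact: is_deriveD (e1 t) (e2 t).
  + by rewrite !mulr0 expR0 subrr mulr0.
  + by rewrite !mulr0 expR0; field.
  + by rewrite mulNr mulrCA mulfV // mulr1 ed ed'; field.
  + by rewrite mulNr mulrCA mulfV // mulr1 ed ed'; field.
- pose w := Num.sqrt k; have w0 : 0 < w by rewrite sqrtr_gt0.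
  have ww : w ^+ 2 = k by rewrite sqr_sqrtr // ltW.
  have w1 : w != 0 by rewrite gt_eqF.
  have dd : -1 <= d <= 1.
    apply/andP; split; first by apply: le_trans (ltW d0); rewrite lerN10.
    rewrite leNgt; apply/negP => dgt1; have : 1 < d ^+ 2 by exact: exprn_egt1.
    by rewrite dk; move: k0; lra.
  have e1 := is_derive_scaled_arg w (@is_derive_sin R).
  have e2 := is_derive_scaled_arg w (@is_derive_cos R).
  (* At t = acos d / w the sine of w t is sqrt(1 - d^2) = w, so S = 1. *)
  apply: (@versine (fun t => w^-1 * sin (w * t)) (fun t => cos (w * t)) (acos d / w)).
  + by rewrite gt_eqF.
  + move=> t; have -> : cos (w * t) = w^-1 * (w * cos (w * t)) by rewrite mulKf.
    exact: is_derive_scaled.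
  + move=> t; have -> : - k * (w^-1 * sin (w * t)) = w * - sin (w * t).
      by rewrite -ww; field.
    exact: e2.
  + by rewrite mulr0 sin0 mulr0.
  + by rewrite mulr0 cos0.
  + rewrite mulrCA mulfV // mulr1 sin_acos // dk opprB addrC subrK.
    by rewrite -/w mulVf.
  + by rewrite mulrCA mulfV // mulr1 acosK // in_itv.
- have dE : d = 1.
    apply/eqP; rewrite -(eqrXn2 (n := 2)) ?ltW // dk k0 subr0 expr1n //.
  exists id, (cst 1), (fun t => 2^-1 * (t * t)); rewrite k0; split => //.
  + by move=> t; exact: is_derive_id.
  + by move=> t; rewrite oppr0 mul0r; exact: is_derive_cst.
  + move=> t; have E : t = 2^-1 * (1 * t + t * 1) by field.
    rewrite [X in is_derive _ _ _ X]E; apply: is_derive_scaled.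
    by apply: (@is_derive_mulr _ _ id id); exact: is_derive_id.
  + by rewrite mulr0 mulr0.
  + by exists 1; rewrite !mulr1 dE.
Qed.

(** The combinations Z D - Z1 S and k Z S + Z1 D are constant, hence 0; as D^2 + k S^2 = 1, they
    determine Z. *)
Lemma jacobi_unique (Z Z1 S D : R -> R) k :
  (forall t : R, is_derive t 1 S (D t)) -> (forall t : R, is_derive t 1 D (- k * S t)) ->
  S 0 = 0 -> D 0 = 1 ->
  (forall t : R, is_derive t 1 Z (Z1 t)) -> (forall t : R, is_derive t 1 Z1 (- k * Z t)) ->
  Z 0 = 0 -> Z1 0 = 0 -> forall t, Z t = 0.
Proof.
move=> dS dD S0 D0 dZ dZ1 Z0 Z10 t.
have A t' : Z t' * D t' - Z1 t' * S t' = 0.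
  refine (etrans (@derive_zero_constant (fun t => Z t * D t - Z1 t * S t) _ t') _).
    move=> r; apply: (is_derive_eq (is_deriveB (is_derive_mulr (dZ r) (dD r))
      (is_derive_mulr (dZ1 r) (dS r)))).
    by ring.
  by rewrite Z0 Z10 !mul0r subrr.
have B t' : Z t' * (k * S t') + Z1 t' * D t' = 0.
  refine (etrans (@derive_zero_constant (fun t => Z t * (k * S t) + Z1 t * D t) _ t') _).
    move=> r; apply: (is_derive_eq (is_deriveD
      (is_derive_mulr (dZ r) (is_derive_scaled k (dS r))) (is_derive_mulr (dZ1 r) (dD r)))).
    by ring.
  by rewrite Z0 Z10 !mul0r addr0.
have U t' : D t' * D t' + k * S t' * S t' = 1.
  refine (etrans (@derive_zero_constant (fun t => D t * D t + k * S t * S t) _ t') _).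
    move=> r; apply: (is_derive_eq (is_deriveD (is_derive_mulr (dD r) (dD r))
      (is_derive_mulr (is_derive_scaled k (dS r)) (dS r)))).
    by ring.
  by rewrite S0 D0 !(mulr0, mul0r) addr0 mulr1.
rewrite -[LHS]mulr1 -(U t).
have -> : Z t * (D t * D t + k * S t * S t) =
  (Z t * D t - Z1 t * S t) * D t + (Z t * (k * S t) + Z1 t * D t) * S t by ring.
by rewrite A B !mul0r addr0.
Qed.

End Jacobi.

Section DotExpansions.
Context {R : realType} {N : nat} (J : 'M[R]_N).
Hypothesis JT : J^T = J.
Local Notation dot := (gram_form J).

Lemma dot_sum3 a e x b : dot (a + e + b *: x) (a + e + b *: x) =
  dot a a + dot e e + b ^+ 2 * dot x x + 2 * (dot e a + b * dot x a + b * dot x e).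
Proof.
rewrite !gram_formDl !gram_formDr !gram_formZl !gram_formZr (gram_formC a e) //.
by rewrite (gram_formC a x) // (gram_formC e x) //; ring.
Qed.

Lemma dot_sum2 e x b : dot (e + b *: x) (e + b *: x) =
  dot e e + b ^+ 2 * dot x x + 2 * b * dot x e.
Proof.
rewrite !gram_formDl !gram_formDr !gram_formZl !gram_formZr (gram_formC e x) //.
by ring.
Qed.

Lemma add3K (a b x : 'rV[R]_N) : a + b + x - a = b + x.
Proof. by rewrite addrC -(addrA a) addKr. Qed.

Lemma entry_center i k e (a b d : 'rV[R]_N) :
  (e *: (a + k *: b - k *: d)) 0 i = e * (a 0 i + k * b 0 i - k * d 0 i).
Proof. by rewrite !mxE. Qed.

Lemma entry_sum3 i k (a b d : 'rV[R]_N) :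
  (a + b + k *: d) 0 i = a 0 i + b 0 i + k * d 0 i.
Proof. by rewrite !mxE. Qed.

End DotExpansions.

(** * The quadric that contains the image, and the images of geodesics *)

Section Quadric.
Context {R : realType} {m s n p : nat} (M : pseudoRiemannian R m s).
Variable phi : M -> 'rV[R]_n.+1.
Hypothesis m2 : (2 <= m)%N.
Hypothesis phi_iso : isometric_immersion p phi.
Hypothesis phi_umb : totally_umbilical p phi.
Hypothesis M_conn : connected [set: M].
Local Notation J := (signature_mx n.+1 p : 'M[R]_n.+1).
Local Notation dot := (gram_form (signature_mx n.+1 p : 'M[R]_n.+1)).
Local Notation X := (normal_xi (p := p) phi).
Local Notation T := (tangent_frame phi).
Local Notation G x := (T x *m J *m (T x)^T).
Local Notation c x := (dot (X x) (X x)).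

Let dotC x y : dot x y = dot y x.
Proof. by rewrite gram_formC ?signature_mxT. Qed.

Lemma frame_normal_xi x v : dot (X x) (v *m T x) = 0.
Proof.
rewrite -(tangent_frameE phi_iso).
exact: (chart_xiT m2 phi_iso phi_umb (chart_at_atlas x) v (chart_at_range x)).
Qed.

Lemma frame_normal_phi x v : dot (v *m T x) (phi x) = 0.
Proof.
rewrite -(tangent_frameE phi_iso) -[x in phi x]chart_at_par.
exact: (chart_tangent_normal phi_iso (chart_at_atlas x) v (chart_at_range x)).
Qed.

Lemma normal_xi_phi x : dot (X x) (phi x) = -1.
Proof.
rewrite -[x in phi x]chart_at_par.
exact: (chart_xif m2 phi_iso phi_umb (chart_at_atlas x) (chart_at_range x)).
Qed.

Lemma frame_gram_unit x : G x \in unitmx.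
Proof. exact: (chart_unit phi_iso (chart_at_atlas x) (chart_at_range x)). Qed.

Lemma frame_gramT x : (G x)^T = G x.
Proof. by rewrite !trmx_mul trmxK signature_mxT mulmxA. Qed.

Lemma frame_gram_index x : has_index (G x) s.
Proof.
rewrite (_ : G x = metric M (chart_at x) (ccoord (chart_at x) x)).
  by apply: metric_index; [exact: chart_at_atlas|exact: chart_at_range].
exact: (chart_metricE phi_iso (chart_at_atlas x) (chart_at_range x)).
Qed.

(* By quadricP, this is a quadric of dimension m in the affine space of
   dimension m + 1 through phi x spanned by the tangent space and xi. *)
Definition quadric x : set 'rV[R]_n.+1 :=
  [set y | dot y y = 1 /\ (y - phi x <= hull (p := p) phi x)%MS].

Lemma quadric_phi x y : quadric x (phi y).
Proof. by split; [exact: phi_norm|exact: sub_hull]. Qed.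

Lemma quadric_base x y : quadric x = quadric y.
Proof.
have sub a b : quadric a `<=` quadric b.
  move=> z [z1 za]; split=> //.
  rewrite (hull_constant m2 phi_iso phi_umb M_conn a b).
  have -> : z - phi b = (z - phi a) - (phi b - phi a) by rewrite opprB addrA subrK.
  by rewrite addmx_sub // eqmx_opp; exact: sub_hull.
by apply/seteqP; split; exact: sub.
Qed.

Lemma frame_norm x v b : dot (phi x + v *m T x + b *: X x) (phi x + v *m T x + b *: X x) =
  1 + (gram_form (G x) v v + c x * b ^+ 2 - 2 * b).
Proof.
rewrite (dot_sum3 (signature_mxT _ _)) (phi_norm phi_iso) gram_form_mul.
by rewrite frame_normal_phi normal_xi_phi frame_normal_xi; ring.
Qed.

Lemma quadricP x y : quadric x y <-> exists v b,
  y = phi x + v *m T x + b *: X x /\ gram_form (G x) v v + c x * b ^+ 2 = 2 * b.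
Proof.
split=> [[y1 /submxP[w yw]]|[v [b [-> E]]]].
  exists (lsubmx w), (rsubmx w 0 0).
  have yE : y = phi x + lsubmx w *m T x + rsubmx w 0 0 *: X x.
    move: yw; rewrite -[w in w *m _]hsubmxK mul_row_col [X in _ + X *m _]mx11_scalar.
    by rewrite mul_scalar_mx -addrA => <-; rewrite addrC subrK.
  split=> //; move: y1; rewrite yE frame_norm => /eqP.
  by rewrite -subr_eq0 addrAC subrr add0r subr_eq0 => /eqP.
split; first by rewrite frame_norm E subrr addr0.
rewrite add3K; apply/submxP; exists (row_mx v b%:M).
by rewrite mul_row_col mul_scalar_mx.
Qed.

(** The square of the chord from phi x depends on b alone, which turns the bound c b < 1 into a
    condition that mentions neither frame nor coordinates. *)
Lemma quadric_offset x v b : gram_form (G x) v v + c x * b ^+ 2 = 2 * b ->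
  dot (phi x + v *m T x + b *: X x - phi x) (phi x + v *m T x + b *: X x - phi x) = 2 * b.
Proof.
move=> E; rewrite add3K.
rewrite (dot_sum2 (signature_mxT _ _)) gram_form_mul frame_normal_xi -E; ring.
Qed.

(** The geodesic equation cancels the tangential part of the acceleration of phi along g, which
    leaves <g', g'> xi. The velocity [g'] is defined without charts, so that the equation holds
    along the whole curve. *)
Lemma geodesic_image (g : R -> M) : is_geodesic g ->
  exists g' : R -> 'rV[R]_n.+1,
    [/\ forall t : R, is_derive t 1 (phi \o g) (g' t),
        forall t : R, is_derive t 1 g' (dot (g' t) (g' t) *: X (g t)),
        forall t : R, dot (X (g t)) (g' t) = 0 &
        forall (k : chart R M m) (t : R), atlas M k -> cdom k (g t) ->
          g' t = 'D_(derive1 (ccoord k \o g) t) (phi \o cpar k) (ccoord k (g t))].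
Proof.
move=> [cg geo]; pose g' t : 'rV[R]_n.+1 := 'D_1 (phi \o g) t.
have nk (k : chart R M m) (t : R) : cdom k (g t) -> \forall r \near t, cdom k (g r).
  by move=> kt; apply: (cg t); apply: open_nbhs_nbhs; split => //; exact: cdom_open.
have dy (k : chart R M m) (t : R) : atlas M k -> cdom k (g t) ->
    is_derive t 1 (ccoord k \o g) (derive1 (ccoord k \o g) t).
  by move=> kA kt; have [d _ _] := geo k t kA kt; rewrite derive1E; exact: derivableP.
have first (k : chart R M m) (t : R) : atlas M k -> cdom k (g t) ->
    is_derive t 1 (phi \o g)
      ('D_(derive1 (ccoord k \o g) t) (phi \o cpar k) (ccoord k (g t))) /\
    is_derive t 1 (fun r => 'D_(derive1 (ccoord k \o g) r) (phi \o cpar k) (ccoord k (g r)))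
      (dot ('D_(derive1 (ccoord k \o g) t) (phi \o cpar k) (ccoord k (g t)))
           ('D_(derive1 (ccoord k \o g) t) (phi \o cpar k) (ccoord k (g t))) *: X (g t)).
  move=> kA kt; have [_ dy' E] := geo k t kA kt.
  set v := derive1 (ccoord k \o g) t.
  have dy2 : is_derive t 1 (derive1 (ccoord k \o g))
      (- christoffel k (ccoord k (g t)) v v).
    by rewrite -E derive1E; exact: derivableP.
  have [Ut pt] := ccoordK kt.
  have ndy : \forall r \near t, is_derive (r : R) 1 (ccoord k \o g)
      (derive1 (ccoord k \o g) r).
    by apply: filterS (nk k t kt) => r kr; exact: dy.
  have [near1 d2] := smooth_curve (@crange_open _ _ _ k) (chart_smooth phi_iso kA)
    (Ut : crange k ((ccoord k \o g) t)) ndy dy2.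
  split.
    apply: near_eq_is_derive (nbhs_singleton near1).
    by apply: filterS (nk k t kt) => r kr /=; have [_ ->] := ccoordK kr.
  apply: (is_derive_eq d2).
  have H := chart_hess phi_iso phi_umb kA v v Ut.
  refine (etrans (congr1 (fun x => x + _) H) _).
  have dl z : 'D_z (phi \o cpar k) (ccoord k (g t)) =
      z *m jacobian (phi \o cpar k) (ccoord k (g t)).
    rewrite derive_jacobian //.
    exact: (smooth_differentiable (@crange_open _ _ _ k) (chart_smooth phi_iso kA) Ut).
  refine (etrans (congr2 (fun x y => x + _ + y) (dl _) (etrans (dl _) (mulNmx _ _))) _).
  rewrite addrAC subrr add0r -[in X (g t)]pt.
  by rewrite (normal_xi_chart m2 phi_iso phi_umb kA Ut).
have g'E (k : chart R M m) (t : R) : atlas M k -> cdom k (g t) ->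
    g' t = 'D_(derive1 (ccoord k \o g) t) (phi \o cpar k) (ccoord k (g t)).
  by move=> kA kt; have [[_ D] _] := first k t kA kt; exact: D.
exists g'; split; last exact: g'E.
- move=> t; have [d _] := first _ t (chart_at_atlas (g t)) (chart_at_dom (g t)).
  by apply: (is_derive_eq d); rewrite -g'E //; [exact: chart_at_atlas|exact: chart_at_dom].
- move=> t; have kA := chart_at_atlas (g t); have kt := chart_at_dom (g t).
  have [_ d] := first _ t kA kt.
  rewrite (g'E _ _ kA kt); apply: near_eq_is_derive d.
  by apply: filterS (nk _ t kt) => r kr; rewrite -g'E.
- move=> t; have kA := chart_at_atlas (g t); have kt := chart_at_dom (g t).
  rewrite (g'E _ _ kA kt).
  exact: (chart_xiT m2 phi_iso phi_umb kA _ (chart_at_range (g t))).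
Qed.

(** Along the geodesic, xi = P - c phi turns the acceleration into a linear equation with constant
    coefficients, solved by phi x + S e + <e, e> C xi; with d = 1 - c b this curve is at the
    required point when S = 1. *)
Lemma complete_reach x v b : geodesically_complete M ->
  gram_form (G x) v v + c x * b ^+ 2 = 2 * b -> c x * b < 1 ->
  exists z, phi z = phi x + v *m T x + b *: X x.
Proof.
move=> compl vb cb.
have [g [geo g0 g'0]] := compl _ (ccoord (chart_at x) x) v (chart_at_atlas x) (chart_at_range x).
rewrite chart_at_par in g0.
have [g' [dg dg' gX g'E]] := geodesic_image geo.
have g'v : g' 0 = v *m T x.
  rewrite -(tangent_frameE phi_iso) (g'E (chart_at x)); [|exact: chart_at_atlas|].
    by rewrite g'0 g0.
  by rewrite g0; exact: chart_at_dom.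
pose e0 := gram_form (G x) v v.
have speed t : dot (g' t) (g' t) = e0.
  refine (etrans (@derive_zero_constant _ (fun t => dot (g' t) (g' t)) _ t) _); last first.
    by rewrite g'v gram_form_mul.
  move=> r; apply: (is_derive_eq (is_derive_gram_form J (dg' r) (dg' r))).
  by rewrite gram_formZl gram_formZr (dotC (g' r) (X (g r))) gX mulr0 addr0.
have XE t : X (g t) = X x + c x *: phi x - c x *: phi (g t).
  have := center_constant m2 phi_iso phi_umb M_conn (g t) x; rewrite /center => <-.
  by rewrite (curvature_constant m2 phi_iso phi_umb M_conn (g t) x) addrK.
have d0 : 0 < 1 - c x * b by rewrite subr_gt0.
(* The constraint gives e0 = b (2 - c b), whence both this equality and e0 / (1 + (1 - c b)) = b
   below. *)
have dk : (1 - c x * b) ^+ 2 = 1 - c x * e0.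
  rewrite /e0; have -> : gram_form (G x) v v = 2 * b - c x * b ^+ 2 by rewrite -vb addrK.
  by ring.
have [S [D [C [dS dD dC [S0 D0 C0] [t0 [St Ct]]]]]] := generalized_sine d0 dk.
have DC t : 1 - D t = c x * e0 * C t.
  have : D t + c x * e0 * C t = 1.
    refine (etrans (@derive_zero_constant _ (fun t => D t + c x * e0 * C t) _ t) _).
      move=> r; apply: (is_derive_eq (is_deriveD (dD r) (is_derive_scaled (c x * e0) (dC r)))).
      by rewrite mulNr addNr.
    by rewrite D0 C0 mulr0 addr0.
  by move=> <-; rewrite addrAC subrr add0r.
have sol i t : phi (g t) 0 i = phi x 0 i + S t * (v *m T x) 0 i + e0 * C t * X x 0 i.
  set e := (v *m T x) 0 i; set x0 := phi x 0 i; set xi := X x 0 i.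
  apply/eqP; rewrite -subr_eq0; apply/eqP.
  apply: (@jacobi_unique _
    (fun t => phi (g t) 0 i - (x0 + S t * e + e0 * C t * xi))
    (fun t => g' t 0 i - (D t * e + e0 * S t * xi)) S D (c x * e0)) => //.
  - move=> r; have d1 := is_derive_entry 0 i (dg r).
    have d2 : is_derive r 1 (fun r => x0 + S r * e + e0 * C r * xi)
        (0 + (D r * e + S r * 0) + (e0 * S r * xi + e0 * C r * 0)).
      exact: (is_deriveD (is_deriveD (is_derive_cst x0 r 1)
        (is_derive_mulr (dS r) (is_derive_cst e r 1)))
        (is_derive_mulr (is_derive_scaled e0 (dC r)) (is_derive_cst xi r 1))).
    by apply: (is_derive_eq (is_deriveB d1 d2)); rewrite !mulr0 !addr0 add0r.
  - move=> r; have d1 := is_derive_entry 0 i (dg' r).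
    have d2 : is_derive r 1 (fun r => D r * e + e0 * S r * xi)
        (- (c x * e0) * S r * e + D r * 0 + (e0 * D r * xi + e0 * S r * 0)).
      exact: (is_deriveD (is_derive_mulr (dD r) (is_derive_cst e r 1))
        (is_derive_mulr (is_derive_scaled e0 (dS r)) (is_derive_cst xi r 1))).
    apply: (is_derive_eq (is_deriveB d1 d2)); rewrite speed XE !mulr0 !addr0 entry_center -/x0 -/xi.
    have -> : D r = 1 - c x * e0 * C r by rewrite -DC opprB addrC subrK.
    by set c0 := c x; set y := phi (g r) 0 i; ring.
  - by rewrite g0 S0 C0 !(mulr0, mul0r) !addr0 subrr.
  - by rewrite g'v S0 D0 !(mulr0, mul0r) mul1r addr0 subrr.
exists (g t0); apply/rowP => i; rewrite sol St Ct mul1r.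
have -> : e0 * (1 + (1 - c x * b))^-1 = b.
  have nz : 1 + (1 - c x * b) != 0 by rewrite gt_eqF // addr_gt0.
  apply: (mulIf nz); rewrite mulfVK // /e0.
  have -> : gram_form (G x) v v = 2 * b - c x * b ^+ 2 by rewrite -vb addrK.
  by ring.
by rewrite entry_sum3.
Qed.

End Quadric.

(** * The range as a subset of the quadric *)

Section OpenMapping.
Context {R : realType}.

Lemma mulmx_norm p k l (x : 'M[R]_(p, k)) (B : 'M[R]_(k, l)) :
  `|x *m B| <= k%:R * `|B| * `|x|.
Proof.
apply: norm_le_coord => [|i j]; first by rewrite !mulr_ge0.
rewrite mxE; apply: le_trans (ler_norm_sum _ _ _) _.
apply: (@le_trans _ _ (\sum_(i0 < k) `|B| * `|x|)).
  apply: ler_sum => a _; rewrite normrM mulrC.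
  by apply: ler_pM => //; exact: coord_le_norm.
by rewrite sumr_const card_ord -mulrA mulr_natl.
Qed.

Lemma eucl_ge_norm k (x : 'rV[R]_k) : `|x| ^+ 2 <= gram_form 1%:M x x.
Proof.
have q i : x 0 i ^+ 2 <= gram_form 1%:M x x.
  rewrite /gram_form mulmx1 mxE (bigD1 i) //= mxE -expr2 lerDl.
  by apply: sumr_ge0 => j _; rewrite mxE -expr2 sqr_ge0.
have q0 : 0 <= gram_form 1%:M x x.
  by rewrite /gram_form mulmx1 mxE; apply: sumr_ge0 => j _; rewrite mxE -expr2 sqr_ge0.
rewrite -(sqr_sqrtr q0) ler_pXn2r ?nnegrE // ?sqrtr_ge0 //.
apply: norm_le_coord => [|i j]; first exact: sqrtr_ge0.
by rewrite ord1 -sqrtr_sqr ler_sqrt.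
Qed.

Lemma eucl_le_norm k (x : 'rV[R]_k) : gram_form 1%:M x x <= k%:R * `|x| ^+ 2.
Proof.
rewrite /gram_form mulmx1 mxE.
apply: (@le_trans _ _ (\sum_(j < k) `|x| ^+ 2)).
  apply: ler_sum => j _; rewrite mxE -expr2 -real_normK ?num_real //.
  by rewrite ler_pXn2r ?nnegrE //; exact: coord_le_norm.
by rewrite sumr_const card_ord mulr_natl.
Qed.

(* A point whose image is nearest to [y] over a small closed ball is interior,
   hence critical for the distance to [y], hence mapped to [y]. *)
Lemma local_open_mapping k (U : set 'rV[R]_k) (h : 'rV[R]_k -> 'rV[R]_k) u0
    (A : 'rV[R]_k -> 'M[R]_k) :
  open U -> U u0 -> (forall u, U u -> differentiable h u) ->
  (forall u v, U u -> 'D_v h u = v *m A u) -> (forall u, U u -> A u \in unitmx) ->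
  exists2 e, 0 < e & forall y, `|y - h u0| < e -> exists2 u, U u & h u = y.
Proof.
move=> oU Uu0 dh hA uA.
(* The inverse of A u0 bounds |v| by C |v A u0|; a linearization error of at most |w| / (2 C) then
   leaves |h (w + u0) - h u0| >= |w| / (2 C). *)
pose C := k%:R * `|invmx (A u0)| + 1.
have C0 : 0 < C by rewrite ltr_wpDl // mulr_ge0.
have expand (v : 'rV[R]_k) : `|v| <= C * `|v *m A u0|.
  rewrite -{1}[v](mulmxK (uA _ Uu0)); apply: le_trans (mulmx_norm _ _) _.
  by rewrite ler_wpM2r // /C lerDl.
have e0 : 0 < (2 * C)^-1 by rewrite invr_gt0 mulr_gt0.
have nE := differentiable_small (dh _ Uu0) e0.
have [r1 /= r10 H1] : exists2 r : R, 0 < r & forall w : 'rV[R]_k, `|w| < r ->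
    `|h (w + u0) - h u0| >= (2 * C)^-1 * `|w|.
  move: nE => /nbhs_ballP[r /= r0 Hr]; exists r => // w wr.
  have := Hr w; rewrite -ball_normE /= sub0r normrN => /(_ wr).
  rewrite -deriveE; last exact: dh.
  rewrite hA // => H; have := expand w; set a := `|w| in H *; set b := `|w *m _|.
  have tri : b <= `|h (w + u0) - h u0| + (2 * C)^-1 * a.
    apply: le_trans (lerD (lexx _) H); apply: le_trans (ler_normB _ _).
    by rewrite opprB addrC subrK.
  move=> ab; have : C^-1 * a <= b by rewrite ler_pdivrMl.
  have : C^-1 * a = 2 * ((2 * C)^-1 * a) by field; rewrite gt_eqF.
  by move: tri; lra.
have [r2 /= r20 H2] : exists2 r : R, 0 < r & forall w : 'rV[R]_k, `|w| < r -> U (w + u0).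
  have : nbhs u0 U by exact: open_nbhs_nbhs.
  move=> /nbhs_ballP[r /= r0 Hr]; exists r => // w wr; apply: Hr.
  by rewrite -ball_normE /= opprD addrCA subrr addr0 normrN.
pose r := Num.min r1 r2 / 2.
have m0 : 0 < Num.min r1 r2 by rewrite lt_min r10.
have r0 : 0 < r by rewrite divr_gt0.
have rr1 : r < r1.
  by apply: lt_le_trans (_ : Num.min r1 r2 <= _); rewrite ?ge_min ?lexx // ltr_pdivrMr //; lra.
have rr2 : r < r2.
  by apply: lt_le_trans (_ : Num.min r1 r2 <= _); rewrite ?ge_min ?lexx ?orbT // ltr_pdivrMr //; lra.
pose K := [set u : 'rV[R]_k | `|u0 - u| <= r].
have KU u : K u -> U u.
  move=> Ku; rewrite -(subrK u0 u); apply: H2; rewrite distrC.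
  exact: le_lt_trans Ku rr2.
have cK : compact K.
  have -> : K = closed_ball u0 r by rewrite closed_ballE.
  apply: bounded_closed_compact; last exact: closed_ball_closed.
  rewrite closed_ballE //; exists (`|u0| + r); split; first exact: num_real.
  move=> N rN u /= Ku; apply: le_trans (ltW rN).
  rewrite -[u](subrK u0); apply: le_trans (ler_normD _ _) _.
  by rewrite addrC lerD2l distrC.
pose rho := (2 * C)^-1 * r; have rho0 : 0 < rho by rewrite mulr_gt0.
(* At a boundary point the sup norm distance to y is at least rho - e = (k + 1) e, whose square
   exceeds k e^2, an upper bound of the Euclidean Q u0: the minimum is not on the boundary. *)
pose e := rho / k.+2%:R.
have ee0 : 0 < e by rewrite divr_gt0.
exists e => // y ye.
pose Q u := gram_form 1%:M (h u - y) (h u - y).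
have dQ u v : U u -> is_derive u v Q (2 * gram_form 1%:M (v *m A u) (h u - y)).
  move=> Uu; have d1 : is_derive u v h (v *m A u).
    by rewrite -hA //; apply: derivableP; apply: diff_derivable; exact: dh.
  have d2 := is_deriveB d1 (is_derive_cst y u v); rewrite subr0 in d2.
  apply: (is_derive_eq (is_derive_gram_form 1%:M d2 d2)).
  by rewrite [X in _ + X]gram_formC ?trmx1 // mulr2n mulrDl mul1r.
have cQ : {within K, continuous Q}.
  apply: continuous_in_subspaceT => u; rewrite inE => /KU Uu.
  apply: differentiable_continuous.
  apply: (@differentiable_entry _ _ _ _ (fun u => (h u - y) *m 1%:M *m (h u - y)^T)).
  have dhy : differentiable (fun u => h u - y) u.
    by apply: differentiableB; [exact: dh|exact: differentiable_cst].
  apply: differentiable_mulmx; last exact: differentiable_trmx.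
  by apply: differentiable_mulmx => //; exact: differentiable_cst.
have K0 : K !=set0 by exists u0; rewrite /K /= subrr normr0 ltW.
have [u uK Hmin] := EVT_min_rV K0 cK cQ; rewrite inE in uK.
exists u; first exact: KU.
have Qu0 : Q u <= k%:R * e ^+ 2.
  apply: le_trans (Hmin u0 _) _; first by rewrite inE /K /= subrr normr0 ltW.
  apply: le_trans (eucl_le_norm _) _; rewrite ler_wpM2l //.
  by rewrite ler_pXn2r ?nnegrE ?(ltW ee0) // distrC ltW.
have interior : `|u0 - u| < r.
  rewrite lt_neqAle uK andbT; apply/eqP => ur.
  have Huu : rho <= `|h u - h u0|.
    have := H1 (u - u0); rewrite subrK distrC ur => /(_ rr1); exact.
  have : rho - e <= `|h u - y|.
    apply: le_trans (lerB Huu (ltW ye)) _; rewrite lerBlDr.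
    have -> : h u - h u0 = (h u - y) + (y - h u0) by rewrite addrA subrK.
    exact: ler_normD.
  have rhoE : rho = k.+2%:R * e by rewrite /e mulrC mulfVK.
  have -> : rho - e = k.+1%:R * e by rewrite rhoE -[in LHS]natr1 mulrDl mul1r addrK.
  move=> He.
  have : (k.+1%:R * e) ^+ 2 <= Q u.
    apply: le_trans (eucl_ge_norm _); rewrite ler_pXn2r ?nnegrE //.
    by rewrite mulr_ge0 // ltW.
  rewrite leNgt => /negP; apply; apply: le_lt_trans Qu0 _.
  have -> : (k.+1%:R * e) ^+ 2 = k.+1%:R ^+ 2 * e ^+ 2 by ring.
  rewrite ltr_pM2r ?exprn_gt0 // -natrX ltr_nat.
  by rewrite -[(k.+1 ^ 2)%N]/(k.+1 * k.+1)%N mulSn addSn ltnS leq_addr.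
apply/eqP; rewrite -subr_eq0; apply/eqP.
have uA1 : (1%:M : 'M[R]_k) \in unitmx by exact: unitmx1.
apply: (gram_form_eq0 uA1) => w.
have [v ->] : exists v, w = v *m A u by exists (w *m invmx (A u)); rewrite mulmxKV // uA //; exact: KU.
rewrite gram_formC ?trmx1 //.
(* As u is interior, a short segment through u in the direction v stays in K, and the minimum
   criterion in one variable applies. *)
have [a a0 Ha] : exists2 a : R, 0 < a & forall t : R, t \in `]-a, a[ -> K (u + t *: v).
  have v0 : 0 < `|v| + 1 by rewrite ltr_wpDl.
  exists ((r - `|u0 - u|) / (`|v| + 1)); first by rewrite divr_gt0 // subr_gt0.
  move=> t; rewrite in_itv /= -ltr_norml ltr_pdivlMr // => ht.
  rewrite /K /= opprD addrA; apply: le_trans (ler_normB _ _) _; rewrite normrZ.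
  rewrite -lerBrDl; apply: le_trans (ltW ht).
  by rewrite ler_wpM2l // lerDl.
have dline (t : R) : K (u + t *: v) ->
    is_derive t 1 (fun t => Q (u + t *: v)) (2 * gram_form 1%:M (v *m A (u + t *: v)) (h (u + t *: v) - y)).
  move=> /KU Ut; have [d D] := dQ _ v Ut; rewrite -D; exact: is_derive_line.
have : is_derive (0 : R) 1 (fun t => Q (u + t *: v)) 0.
  apply: (@derive1_at_min _ (fun t : R => Q (u + t *: v)) (- a) a).
  - by rewrite lerNl; lra.
  - by move=> t /Ha /dline [].
  - by rewrite in_itv /= oppr_lt0 a0.
  - by move=> t /Ha Kt; rewrite scale0r addr0; apply: Hmin; rewrite inE.
move=> [_ D0]; have K00 : K (u + 0 *: v) by rewrite scale0r addr0.
have [_ D] := dline 0 K00; move: D; rewrite D0 scale0r addr0 => /esym/eqP.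
by rewrite mulf_eq0 pnatr_eq0 /= => /eqP.
Qed.

End OpenMapping.

(** * Openness and closedness of the image in the quadric *)

Section Range.
Context {R : realType} {m s n p : nat} (M : pseudoRiemannian R m s).
Variable phi : M -> 'rV[R]_n.+1.
Hypothesis m2 : (2 <= m)%N.
Hypothesis phi_iso : isometric_immersion p phi.
Hypothesis phi_umb : totally_umbilical p phi.
Hypothesis M_conn : connected [set: M].
Local Notation J := (signature_mx n.+1 p : 'M[R]_n.+1).
Local Notation dot := (gram_form (signature_mx n.+1 p : 'M[R]_n.+1)).
Local Notation X := (normal_xi (p := p) phi).
Local Notation T := (tangent_frame phi).
Local Notation G x := (T x *m J *m (T x)^T).
Local Notation c x := (dot (X x) (X x)).
Local Notation quadric := (quadric (p := p) phi).

Lemma differentiable_dist (V : normedModType R) (F : V -> 'rV[R]_n.+1) a z :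
  differentiable F z -> differentiable (fun y => dot (F y - a) (F y - a)) z.
Proof.
move=> dF; apply: (@differentiable_entry _ _ _ _ (fun y => (F y - a) *m J *m (F y - a)^T)).
have d : differentiable (fun y => F y - a) z.
  by apply: differentiableB; [exact: dF|exact: differentiable_cst].
apply: differentiable_mulmx; last exact: differentiable_trmx.
by apply: differentiable_mulmx; [exact: d|exact: differentiable_cst].
Qed.

Lemma near_dist_small (V : normedModType R) (F : V -> 'rV[R]_n.+1) z k :
  differentiable F z -> \forall y \near z, k * dot (F y - F z) (F y - F z) < 2.
Proof.
move=> dF; have d : differentiable (fun y => 2 - k * dot (F y - F z) (F y - F z)) z.
  apply: differentiableB; first exact: differentiable_cst.
  apply: (@differentiableM _ _ (fun=> k)); first exact: differentiable_cst.
  exact: differentiable_dist.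
have := differentiable_continuous d; rewrite /prop_for /continuous_at subrr gram_form0l mulr0 subr0.
move=> cont; have : nbhs (2 : R) [set r : R | 0 < r].
  by apply: open_nbhs_nbhs; split; [exact: open_gt|rewrite /= ltr0n].
move=> /cont; rewrite /nbhs /=; apply: filterS => y /=.
by rewrite subr_gt0.
Qed.

Lemma frame_coordinates x v b :
  (phi x + v *m T x + b *: X x) *m J *m (T x)^T = v *m G x.
Proof.
have z (y : 'rV[R]_n.+1) : (forall w, dot y (w *m T x) = 0) -> y *m J *m (T x)^T = 0.
  move=> H; apply/rowP => j; rewrite [RHS]mxE -[RHS](H (delta_mx 0 j)) /gram_form.
  by rewrite trmx_mul trmx_delta mulmxA -colE [RHS]mxE.
rewrite !mulmxDl -!scalemxAl (z (phi x)) ?add0r.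
  rewrite (z (X x)) ?scaler0 ?addr0 ?mulmxA // => w.
  exact: (frame_normal_xi m2 phi_iso phi_umb).
move=> w; rewrite gram_formC ?signature_mxT //.
exact: (frame_normal_phi phi_iso).
Qed.

(** The difference of the two equations factors through 2 - k a - k b, which is positive below the
    threshold: the quadric is a graph there. *)
Lemma quadric_graph_unique (k a b : R) (g : R) : k * a < 1 -> k * b < 1 ->
  g + k * a ^+ 2 = 2 * a -> g + k * b ^+ 2 = 2 * b -> a = b.
Proof.
move=> ka kb Ha Hb; apply/eqP; rewrite -subr_eq0.
have : (a - b) * (2 - k * a - k * b) = 0.
  have E : g = 2 * a - k * a ^+ 2 by rewrite -Ha addrK.
  have E' : g = 2 * b - k * b ^+ 2 by rewrite -Hb addrK.
  have := E; rewrite E' => /eqP; rewrite eq_sym -subr_eq0 => /eqP <-; ring.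
move=> /eqP; rewrite mulf_eq0 => /orP[//|/eqP H]; exfalso; lra.
Qed.

(** The projection to the tangent space at x maps the image of phi onto a neighbourhood of the
    projection of phi x; a point of the quadric and a point of the image with the same projection,
    both with c b < 1, coincide. *)
Lemma quadric_locally_reached x :
  \forall y \near phi x, quadric x y -> range phi y.
Proof.
pose k := chart_at x; pose u0 := ccoord k x; pose f := phi \o cpar k.
have Uu0 : crange k u0 by exact: chart_at_range.
have oU := @crange_open _ _ _ k.
have sf : smooth_on (crange k) f by exact: (chart_smooth phi_iso (chart_at_atlas x)).
have fu0 : f u0 = phi x by rewrite /f /= chart_at_par.
(* The derivative of this projection; at u0 it is the Gram matrix of the tangent frame. *)
pose A u := jacobian f u *m J *m (T x)^T.
have dA : differentiable A u0.
  apply: differentiable_mulmx; last exact: differentiable_cst.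
  apply: differentiable_mulmx; last exact: differentiable_cst.
  exact: (smooth_differentiable_jacobian oU sf Uu0).
have detA : \forall u \near u0, \det (A u) != 0.
  apply: (differentiable_neq0_near (differentiable_det dA)).
  by rewrite -unitfE -unitmxE; exact: (frame_gram_unit phi_iso).
have close := near_dist_small (c x) (smooth_differentiable oU sf Uu0).
have [r /= r0 Hr] : exists2 r : R, 0 < r & forall u, ball u0 r u ->
    [/\ crange k u, A u \in unitmx & c x * dot (f u - phi x) (f u - phi x) < 2].
  have : nbhs u0 [set u | [/\ crange k u, A u \in unitmx &
      c x * dot (f u - phi x) (f u - phi x) < 2]].
    apply: filterS3 _ (open_nbhs_nbhs (conj oU Uu0)) detA close => u Uu du cu.
    by split => //; [rewrite unitmxE unitfE|move: cu; rewrite fu0].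
  by move=> /nbhs_ballP[r r0 H]; exists r.
pose h u := f u *m J *m (T x)^T.
have dh u : crange k u -> differentiable h u.
  move=> Uu; apply: differentiable_mulmx; last exact: differentiable_cst.
  apply: differentiable_mulmx; last exact: differentiable_cst.
  exact: (smooth_differentiable oU sf Uu).
have [e e0 He] : exists2 e : R, 0 < e & forall y, `|y - h u0| < e ->
    exists2 u, ball u0 r u & h u = y.
  apply: (local_open_mapping (A := A)).
  - exact: ball_open.
  - exact: ballxx.
  - by move=> u /Hr [Uu _ _]; exact: dh.
  - move=> u v /Hr [Uu _ _].
    have d1 : is_derive u v f ('D_v f u).
      by apply: derivableP; exact: smooth_derivable sf Uu.
    have d2 := is_derive_mulmx (is_derive_mulmx d1 (is_derive_cst J u v)) (is_derive_cst (T x)^T u v).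
    have [_ D] := d2; apply: (etrans D); rewrite !mulmx0 !addr0 /A !mulmxA.
    by rewrite derive_jacobian //; exact: (smooth_differentiable oU sf Uu).
  - by move=> u /Hr [].
have near1 : \forall y \near phi x, c x * dot (y - phi x) (y - phi x) < 2.
  exact: (@near_dist_small _ id).
have near2 : \forall y \near phi x, `|y *m J *m (T x)^T - h u0| < e.
  have d : differentiable (fun y : 'rV[R]_n.+1 => y *m J *m (T x)^T) (phi x).
    apply: differentiable_mulmx; last exact: differentiable_cst.
    by apply: differentiable_mulmx; last exact: differentiable_cst.
  have := differentiable_continuous d; rewrite /prop_for /continuous_at => /cvgrPdist_lt /(_ _ e0).
  by rewrite /h fu0; apply: filterS => y; rewrite distrC.
apply: filterS2 _ near1 near2 => y cy /He [u bu hu] Qy.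
have [Uu _ cu] := Hr u bu.
exists (cpar k u) => //.
have Qu : quadric x (f u) by exact: (quadric_phi m2 phi_iso phi_umb M_conn).
have [v [b [yE vb]]] := (quadricP m2 phi_iso phi_umb x y).1 Qy.
have [v' [b' [uE vb']]] := (quadricP m2 phi_iso phi_umb x (f u)).1 Qu.
have vv : v' = v.
  apply: (can_inj (mulmxK (frame_gram_unit phi_iso x))).
  by rewrite -(frame_coordinates x v' b') -uE -/(h u) hu yE frame_coordinates.
have cb : c x * b < 1.
  by move: cy; rewrite yE (quadric_offset m2 phi_iso phi_umb vb); lra.
have cb' : c x * b' < 1.
  by move: cu; rewrite uE (quadric_offset m2 phi_iso phi_umb vb'); lra.
rewrite vv in uE vb'.
have bb := quadric_graph_unique cb' cb vb' vb.
by rewrite -[LHS]/(f u) uE yE bb.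
Qed.

(** Near each phi z the quadric is contained in the image, so the image together with the complement
    of the quadric is a neighbourhood of phi z. *)
Lemma range_open x : exists2 V : set 'rV[R]_n.+1, open V & range phi = quadric x `&` V.
Proof.
exists (interior (range phi `|` ~` quadric x)); first exact: open_interior.
apply/seteqP; split=> [y [z _ <-]|y [Qy Vy]]; last first.
  by have [//|] := interior_subset Vy.
split; first exact: (quadric_phi m2 phi_iso phi_umb M_conn).
rewrite (quadric_base m2 phi_iso phi_umb M_conn x z).
apply: filterS (quadric_locally_reached z) => w H.
by have [Qw|nQw] := pselect (quadric z w); [left; exact: H|right].
Qed.

Lemma phi_continuous : continuous phi.
Proof.
move=> x; pose k := chart_at x.
have Uu := chart_at_range x; have kx := chart_at_dom x.
have cf : {for ccoord k x, continuous (phi \o cpar k)}.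
  exact: smooth_continuous (chart_smooth phi_iso (chart_at_atlas x)) Uu.
have E : \forall y \near x, (phi \o cpar k \o ccoord k) y = phi y.
  have : nbhs x (cdom k) by apply: open_nbhs_nbhs; split => //; exact: cdom_open.
  by apply: filterS => y ky /=; have [_ ->] := ccoordK ky.
rewrite /continuous_at -(nbhs_singleton E).
apply: cvg_trans (near_eq_cvg E) _.
exact: (continuous_comp (ccoord_cont kx) cf).
Qed.

Lemma complete_close y z : geodesically_complete M -> quadric z y ->
  c z * dot (y - phi z) (y - phi z) < 2 -> range phi y.
Proof.
move=> compl Qy; have [v [b [-> vb]]] := (quadricP m2 phi_iso phi_umb z y).1 Qy.
rewrite (quadric_offset m2 phi_iso phi_umb vb) => cb.
have [|w <-] := complete_reach m2 phi_iso phi_umb M_conn compl vb; last by exists w.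
by move: cb; lra.
Qed.

(** For closedness: if y is a limit of the image, some phi z satisfies c <y - phi z, y - phi z> < 2,
    an inequality symmetric in the two points and with the same c at every z, so a geodesic from z
    reaches y. *)
Lemma range_component x : geodesically_complete M ->
  range phi = connected_component (quadric x) (phi x).
Proof.
move=> compl; have [V oV rV] := range_open x.
have cphi : connected (range phi).
  apply: connected_continuous_connected M_conn _.
  exact/continuous_subspaceT/phi_continuous.
apply/seteqP; split.
  apply: connected_component_max => //.
  by rewrite rV => y [].
set C := connected_component _ _.
have cC : connected C by exact: component_connected.
have CQ : C `<=` quadric x by exact: connected_component_sub.
suff <- : C `&` V = C by move=> y [Cy Vy]; rewrite rV; split => //; exact: CQ.
apply: cC.
- exists (phi x); split.
    by apply: connected_component_refl; exact: (quadric_phi m2 phi_iso phi_umb M_conn).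
  by have : range phi (phi x) by [exists x]; rewrite rV => -[].
- by exists V.
exists (closure (range phi)); first exact: closed_closure.
apply/seteqP; split=> y [Cy Vy]; split => //.
  by apply: subset_closure; rewrite rV; split => //; exact: CQ.
suff : range phi y by rewrite rV => -[].
have Qy := CQ _ Cy.
have near_y : \forall w \near y, c x * dot (w - y) (w - y) < 2.
  exact: (@near_dist_small _ id).
have [w [[z _ <-] Hz]] := Vy _ near_y.
apply: (complete_close compl (z := z)).
  by rewrite -(quadric_base m2 phi_iso phi_umb M_conn x z).
rewrite (curvature_constant m2 phi_iso phi_umb M_conn z x).
by rewrite -[y - phi z]opprB gram_formNl gram_formNr opprK.
Qed.

End Range.

(** * Normal forms and congruence *)

Section Frames.
Context {R : realType} {N : nat} (p : nat).
Local Notation J := (signature_mx N p : 'M[R]_N).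
Local Notation dot := (gram_form (signature_mx N p : 'M[R]_N)).

Lemma signature_snoc k q : (q <= k)%N ->
  block_mx (signature_mx k q) 0 0 1%:M = signature_mx (k + 1) q :> 'M[R]_(k + 1).
Proof.
move=> qk; apply/matrixP => i j; rewrite [RHS]mxE.
case: (split_ordP i) => i' ->; case: (split_ordP j) => j' ->.
- by rewrite block_mxEul !mxE eq_lshift.
- by rewrite block_mxEur !mxE eq_lrshift mulr0.
- by rewrite block_mxEdl !mxE eq_rlshift mulr0.
- by rewrite block_mxEdr !mxE eq_rshift /= ltnNge (leq_trans qk (leq_addr _ _)) /= mul1r.
Qed.

(** Negative coordinates come first in [mink]: a positive vector is appended at the end and a
    negative one in front, which dictates the place of the constants in the models. *)
Lemma frame_snoc k q (B : 'M[R]_(k, N)) (u : 'rV[R]_N) : (q <= k)%N ->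
  B *m J *m B^T = signature_mx k q -> (forall x, dot (x *m B) u = 0) -> dot u u = 1 ->
  col_mx B u *m J *m (col_mx B u)^T = signature_mx (k + 1) q.
Proof.
move=> qk BB Bu uu; rewrite -signature_snoc //.
have Bu0 : B *m J *m u^T = 0.
  apply/colP => i; rewrite [RHS]mxE -[RHS](Bu (delta_mx 0 i)) /gram_form.
  by rewrite -!mulmxA -rowE !mxE.
have uB0 : u *m J *m B^T = 0.
  by apply: trmx_inj; rewrite trmx0 !trmx_mul trmxK signature_mxT mulmxA.
rewrite mul_col_mx tr_col_mx mul_col_row BB Bu0 uB0; congr block_mx.
by rewrite [LHS]mx11_scalar -[X in X%:M]/(dot u u) uu.
Qed.

Lemma frame_cons k q (B : 'M[R]_(k, N)) (u : 'rV[R]_N) :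
  B *m J *m B^T = signature_mx k q -> (forall x, dot (x *m B) u = 0) -> dot u u = -1 ->
  col_mx u B *m J *m (col_mx u B)^T = signature_mx (1 + k) q.+1.
Proof.
move=> BB Bu uu; rewrite -signature_block.
have Bu0 : B *m J *m u^T = 0.
  apply/colP => i; rewrite [RHS]mxE -[RHS](Bu (delta_mx 0 i)) /gram_form.
  by rewrite -!mulmxA -rowE !mxE.
have uB0 : u *m J *m B^T = 0.
  by apply: trmx_inj; rewrite trmx0 !trmx_mul trmxK signature_mxT mulmxA.
rewrite mul_col_mx tr_col_mx mul_col_row BB Bu0 uB0; congr block_mx.
by rewrite [LHS]mx11_scalar -[X in X%:M]/(dot u u) uu.
Qed.

Lemma mink_snoc k q (w : 'rV[R]_k) (t : 'rV[R]_1) : (q <= k)%N ->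
  mink q (row_mx w t) (row_mx w t) = mink q w w + t 0 0 ^+ 2.
Proof.
move=> qk; rewrite /mink big_split_ord /= big_ord1 row_mxEr /= addn0 ltnNge qk mul1r.
by congr (_ + _); apply: eq_bigr => i _; rewrite row_mxEl.
Qed.

Lemma mink_cons k q (w : 'rV[R]_k) (t : 'rV[R]_1) :
  mink q.+1 (row_mx t w) (row_mx t w) = - t 0 0 ^+ 2 + mink q w w.
Proof.
rewrite /mink big_split_ord /= big_ord1 row_mxEl /= mulN1r; congr (_ + _).
by apply: eq_bigr => i _; rewrite row_mxEr.
Qed.

Lemma const_mx11_mul a (u : 'rV[R]_N) : const_mx a *m u = a *: u.
Proof.
by rewrite -mul_scalar_mx; congr (_ *m _); apply/matrixP => i j; rewrite !ord1 !mxE mulr1n.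
Qed.

End Frames.

Section NormalForms.
Context {R : realType} {N m s : nat} (p : nat).
Local Notation J := (signature_mx N p : 'M[R]_N).
Local Notation dot := (gram_form (signature_mx N p : 'M[R]_N)).
Local Notation c1 a := (const_mx a : 'rV[R]_1).
Variables (E : 'M[R]_(m, N)) (f X : 'rV[R]_N) (c : R).
Hypothesis sm : (s <= m)%N.
Hypothesis EE : E *m J *m E^T = signature_mx m s.
Hypothesis Ef : forall w, dot (w *m E) f = 0.
Hypothesis EX : forall w, dot (w *m E) X = 0.
Hypothesis ff : dot f f = 1.
Hypothesis Xf : dot X f = -1.
Hypothesis XX : dot X X = c.

Definition umbilical_quadric : set 'rV[R]_N :=
  [set y | exists w b, y = f + w *m E + b *: X /\ mink s w w + c * b ^+ 2 = 2 * b].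

Let dotC x y : dot x y = dot y x.
Proof. by rewrite gram_formC ?signature_mxT. Qed.

(* X = P - c f, so that f - c^-1 P is a multiple of X: when c <> 0 the quadric is
   centred at c^-1 P. *)
Let P := X + c *: f.

Let EP w : dot (w *m E) P = 0.
Proof. by rewrite gram_formDr gram_formZr EX Ef mulr0 addr0. Qed.

Let XP : dot X P = 0.
Proof. by rewrite gram_formDr gram_formZr XX Xf mulrN1 subrr. Qed.

Let PP : dot P P = c ^+ 2 - c.
Proof.
rewrite {2}/P gram_formDr gram_formZr [dot P X]dotC XP add0r.
by rewrite /P gram_formDl gram_formZl Xf ff; ring.
Qed.

Section Positive.
Hypothesis c0 : 0 < c.
Let r := (Num.sqrt c)^-1.
Let u := r *: X.
Let r0 : 0 < r. Proof. by rewrite invr_gt0 sqrtr_gt0. Qed.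
Let r2 : r ^+ 2 = c^-1. Proof. by rewrite exprVn sqr_sqrtr // ltW. Qed.
Let cn : c != 0. Proof. by rewrite gt_eqF. Qed.
Let rn : r != 0. Proof. by rewrite gt_eqF. Qed.

Let uu : dot u u = 1.
Proof. by rewrite gram_formZl gram_formZr XX mulrA -expr2 r2 mulVf. Qed.

Lemma positive_frame : col_mx E u *m J *m (col_mx E u)^T = signature_mx (m + 1) s.
Proof. by apply: frame_snoc => // x; rewrite gram_formZr EX mulr0. Qed.

Lemma positive_center x : dot (x *m col_mx E u) P = 0.
Proof.
rewrite -[x]hsubmxK mul_row_col gram_formDl EP add0r [rsubmx x]mx11_scalar mul_scalar_mx.
by rewrite !gram_formZl XP !mulr0.
Qed.

(** Since f = c^-1 P - c^-1 X, completing the square in b about c^-1 gives the pseudo-sphere with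
    r^2 = 1 / c centred at c^-1 P. *)
Lemma positive_quadric : umbilical_quadric =
  [set c^-1 *: P + x *m col_mx E u | x in [set x : 'rV[R]_(m + 1) | mink s x x = r ^+ 2]].
Proof.
apply/seteqP; split=> y /=.
  move=> [w [b [-> H]]]; exists (row_mx w (const_mx (r^-1 * (b - c^-1)))).
    rewrite mink_snoc // mxE r2 exprMn exprVn r2 invrK.
    have -> : mink s w w = 2 * b - c * b ^+ 2 by rewrite -H addrK.
    by field.
  rewrite mul_row_col const_mx11_mul /P /u; move: (w *m E) => e.
  by apply/rowP => i; rewrite !mxE; field; rewrite cn.
move=> [x Hx <-]; exists (lsubmx x), (c^-1 + r * rsubmx x 0 0); split.
  rewrite -{1}[x]hsubmxK mul_row_col {1}[rsubmx x]mx11_scalar mul_scalar_mx /P /u.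
  move: (lsubmx x *m E) (rsubmx x 0 0) => e t.
  by apply/rowP => i; rewrite !mxE; field.
move: Hx; rewrite -{1 2}[x]hsubmxK mink_snoc // r2 => H.
have -> : mink s (lsubmx x) (lsubmx x) = c^-1 - rsubmx x 0 0 ^+ 2 by rewrite -H addrK.
move: (rsubmx x 0 0) => t; rewrite sqrrD exprMn r2; field.
by rewrite cn.
Qed.

(** Its sign is that of c - 1: it separates r < 1 from r > 1, and decides whether the axis through
    the centre is positive or negative. *)
Let center_norm : dot (c^-1 *: P) (c^-1 *: P) = 1 - r ^+ 2.
Proof. by rewrite gram_formZl gram_formZr PP r2; field. Qed.

Lemma model3_quadric a : a = (m + 1)%N -> 1 < c ->
  exists2 B : 'M[R]_(a + 1, N), B *m J *m B^T = signature_mx (a + 1) s &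
    umbilical_quadric = [set row_mx x (c1 (Num.sqrt (1 - r ^+ 2))) *m B |
                          x in (psphere s r : set 'rV[R]_a)].
Proof.
move=> -> cgt1; have k0 : 0 < 1 - r ^+ 2 by rewrite subr_gt0 r2 invf_lt1.
set k := Num.sqrt _; have kn : k != 0 by rewrite gt_eqF // sqrtr_gt0.
have kk : k ^+ 2 = 1 - r ^+ 2 by rewrite sqr_sqrtr // ltW.
exists (col_mx (col_mx E u) (k^-1 *: (c^-1 *: P))).
  apply: frame_snoc; [exact: leq_trans sm (leq_addr _ _)|exact: positive_frame| |].
    by move=> x; rewrite !gram_formZr positive_center !mulr0.
  by rewrite gram_formZl gram_formZr center_norm -kk; field.
rewrite positive_quadric; apply: eq_imagel => x _.
by rewrite mul_row_col const_mx11_mul scalerA mulfV // scale1r addrC.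
Qed.

Lemma model4_quadric a : a = (m + 1)%N -> c < 1 ->
  exists2 B : 'M[R]_(1 + a, N), B *m J *m B^T = signature_mx (1 + a) s.+1 &
    umbilical_quadric = [set row_mx (c1 (Num.sqrt (r ^+ 2 - 1))) x *m B |
                          x in (psphere s r : set 'rV[R]_a)].
Proof.
move=> -> clt1; have k0 : 0 < r ^+ 2 - 1 by rewrite subr_gt0 r2 invf_gt1.
set k := Num.sqrt _; have kn : k != 0 by rewrite gt_eqF // sqrtr_gt0.
have kk : k ^+ 2 = r ^+ 2 - 1 by rewrite sqr_sqrtr // ltW.
exists (col_mx (k^-1 *: (c^-1 *: P)) (col_mx E u)).
  apply: frame_cons; first exact: positive_frame.
    by move=> x; rewrite !gram_formZr positive_center !mulr0.
  rewrite gram_formZl gram_formZr center_norm -[1 - _]opprB -kk; field.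
  by rewrite kn.
rewrite positive_quadric; apply: eq_imagel => x _.
by rewrite mul_row_col const_mx11_mul scalerA mulfV // scale1r.
Qed.

(** When P = 0 the quadric is centred at the origin and determines no further axis; the codimension
    leaves room for one, and its sign decides between models (1) and (2). *)
Lemma exists_orthogonal_unit : (m + 1 < N)%N ->
  exists v, (forall x, dot (x *m col_mx E u) v = 0) /\ (dot v v = 1 \/ dot v v = -1).
Proof.
move=> mN; have [q [C [k [rN kr CC CB]]]] := frame_complement positive_frame.
have q0 : (0 < q)%N by move: rN mN; lia.
pose i := Ordinal q0; exists (row i C); split.
  move=> x; rewrite dotC rowE /gram_form trmx_mul !mulmxA -!(mulmxA (delta_mx 0 i)).
  by rewrite CB mul0mx mulmx0 mxE.
rewrite gram_form_row CC mxE eqxx mulr1.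
by case: ifP; [right|left].
Qed.

Lemma geodesic_quadric a : a = (m + 1)%N -> c = 1 -> P = 0 -> (m + 1 < N)%N ->
  (exists2 B : 'M[R]_(a + 1, N), B *m J *m B^T = signature_mx (a + 1) s &
    umbilical_quadric = [set row_mx x (c1 0) *m B | x in (psphere s 1 : set 'rV[R]_a)]) \/
  (exists2 B : 'M[R]_(1 + a, N), B *m J *m B^T = signature_mx (1 + a) s.+1 &
    umbilical_quadric = [set row_mx (c1 0) x *m B | x in (psphere s 1 : set 'rV[R]_a)]).
Proof.
move=> -> cE P0 mN; have rE : r = 1 by rewrite /r cE sqrtr1 invr1.
have [v [vE [v1|v1]]] := exists_orthogonal_unit mN; [left|right].
- exists (col_mx (col_mx E u) v).
    by apply: frame_snoc => //; [exact: leq_trans sm (leq_addr _ _)|exact: positive_frame].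
  rewrite positive_quadric rE; apply: eq_imagel => x _.
  by rewrite P0 scaler0 add0r mul_row_col const_mx11_mul scale0r addr0.
exists (col_mx v (col_mx E u)).
  by apply: frame_cons => //; exact: positive_frame.
rewrite positive_quadric rE; apply: eq_imagel => x _.
by rewrite P0 scaler0 add0r mul_row_col const_mx11_mul scale0r add0r.
Qed.

(** P is null and nonzero: a vector that pairs with it is made orthogonal to the frame, scaled, and
    corrected by a multiple of P to become null, which completes P to a hyperbolic pair. *)
Lemma exists_null_partner : c = 1 -> P != 0 ->
  exists z, [/\ forall x, dot (x *m col_mx E u) z = 0, dot z z = 0 & dot P z = -1].
Proof.
move=> cE Pn; have PP0 : dot P P = 0 by rewrite PP cE; ring.
have [y0 Py] : exists y, dot P y != 0.
  apply: contrapT => H; move/eqP: Pn; apply.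
  apply: (gram_form_eq0 (signature_mx_unit N p)) => y.
  by apply/eqP; apply: contrapT => /negP ny; apply: H; exists y.
pose B := col_mx E u.
pose a := y0 *m J *m B^T *m signature_mx (m + 1) s.
pose y := y0 - a *m B.
have yB x : dot (x *m B) y = 0.
  have yJB : y *m J *m B^T = 0.
    rewrite !mulmxBl -!(mulmxA a) positive_frame.
    by rewrite /a -(mulmxA _ (signature_mx _ _)) signature_mxK mulmx1 subrr.
  by rewrite dotC /gram_form trmx_mul mulmxA yJB mul0mx mxE.
have Pyy : dot P y = dot P y0.
  by rewrite gram_formDr gram_formNr [dot P (a *m B)]dotC positive_center oppr0 addr0.
pose d := dot P y; have dn : d != 0 by rewrite /d Pyy.
have [z [zE Pz]] : exists z, (forall x, dot (x *m col_mx E u) z = 0) /\ dot P z = -1.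
  exists (- d^-1 *: y); split; last by rewrite gram_formZr mulNr mulVf.
  by move=> x; rewrite gram_formZr yB mulr0.
(* As <P, P> = 0 and <P, z> = -1, adding t P to z changes <z, z> by - 2 t. *)
exists (z + (dot z z / 2) *: P); split.
- by move=> x; rewrite gram_formDr gram_formZr zE positive_center mulr0 addr0.
- rewrite gram_formDl !gram_formDr !gram_formZl !gram_formZr [dot z P]dotC Pz PP0.
  by set q := dot z z; field.
- by rewrite gram_formDr gram_formZr PP0 mulr0 addr0.
Qed.

Lemma model5_quadric a : a = (m + 1)%N -> c = 1 -> P != 0 ->
  exists2 B : 'M[R]_(1 + (a + 1), N), B *m J *m B^T = signature_mx (1 + (a + 1)) s.+1 &
    umbilical_quadric = [set row_mx (c1 1) (row_mx x (c1 1)) *m B |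
                          x in (psphere s 1 : set 'rV[R]_a)].
Proof.
move=> -> cE Pn; have rE : r = 1 by rewrite /r cE sqrtr1 invr1.
have PP0 : dot P P = 0 by rewrite PP cE; ring.
have [z [zE zz Pz]] := exists_null_partner cE Pn.
have zP : dot z P = -1 by rewrite dotC.
(* P / 2 + z and P / 2 - z have squares -1 and 1 and add up to P, the centre for c = 1; hence the
   two constants 1 of the model. *)
exists (col_mx (2^-1 *: P + z) (col_mx (col_mx E u) (2^-1 *: P - z))).
  apply: frame_cons; first apply: frame_snoc.
  - exact: leq_trans sm (leq_addr _ _).
  - exact: positive_frame.
  - by move=> x; rewrite gram_formDr gram_formNr gram_formZr zE positive_center mulr0 subrr.
  - rewrite gram_formDl gram_formNl !gram_formDr !gram_formNr !gram_formZl !gram_formZr.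
    by rewrite PP0 zz Pz zP; field.
  - move=> x; rewrite -[x]hsubmxK mul_row_col gram_formDl gram_formDr gram_formZr zE.
    rewrite positive_center mulr0 addr0 add0r [rsubmx x]mx11_scalar mul_scalar_mx gram_formZl.
    rewrite gram_formDl gram_formNl !gram_formDr !gram_formZl !gram_formZr PP0 zz Pz zP.
    by ring.
  - rewrite gram_formDl !gram_formDr !gram_formZl !gram_formZr PP0 zz Pz zP.
    by field.
rewrite positive_quadric rE; apply: eq_imagel => x _.
rewrite !mul_row_col !const_mx11_mul !scale1r cE invr1 scale1r.
rewrite [RHS]addrCA; move: (x *m _) => e.
by apply/rowP => i; rewrite !mxE; field.
Qed.

End Positive.

Section Negative.
Hypothesis c0 : c < 0.
Let r := (Num.sqrt (- c))^-1.
Let u := r *: X.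
Let r0 : 0 < r. Proof. by rewrite invr_gt0 sqrtr_gt0 oppr_gt0. Qed.
Let r2 : r ^+ 2 = - c^-1. Proof. by rewrite exprVn sqr_sqrtr ?invrN // oppr_ge0 ltW. Qed.
Let cn : c != 0. Proof. by rewrite lt_eqF. Qed.
Let rn : r != 0. Proof. by rewrite gt_eqF. Qed.

Let frame : col_mx u E *m J *m (col_mx u E)^T = signature_mx (1 + m) s.+1.
Proof.
apply: frame_cons => // [x|]; first by rewrite gram_formZr EX mulr0.
by rewrite gram_formZl gram_formZr XX mulrA -expr2 r2 mulNr mulVf.
Qed.

(** The unit vector along X is negative and goes in front of E, which makes the quadric hyperbolic;
    the square of the centre, 1 - 1 / c = 1 + r^2, is always positive. *)
Lemma model6_quadric a : a = (1 + m)%N ->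
  exists2 B : 'M[R]_(a + 1, N), B *m J *m B^T = signature_mx (a + 1) s.+1 &
    umbilical_quadric = [set row_mx x (c1 (Num.sqrt (1 + r ^+ 2))) *m B |
                          x in (phyperbolic s r : set 'rV[R]_a)].
Proof.
move=> ->; have k0 : 0 < 1 + r ^+ 2 by rewrite addr_gt0 // exprn_gt0.
set k := Num.sqrt _; have kn : k != 0 by rewrite gt_eqF // sqrtr_gt0.
have kk : k ^+ 2 = 1 + r ^+ 2 by rewrite sqr_sqrtr // ltW.
exists (col_mx (col_mx u E) (k^-1 *: (c^-1 *: P))).
  apply: frame_snoc => //.
    move=> x; rewrite -[x]hsubmxK mul_row_col [lsubmx x]mx11_scalar mul_scalar_mx.
    by rewrite gram_formDl !gram_formZr EP !gram_formZl XP !mulr0 addr0.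
  rewrite !gram_formZl !gram_formZr PP.
  have -> : k^-1 * (c^-1 * (k^-1 * (c^-1 * (c ^+ 2 - c)))) = (k ^+ 2)^-1 * (1 - c^-1).
    by field; rewrite cn.
  by rewrite kk r2 mulVf // -r2 gt_eqF.
apply/seteqP; split=> y /=.
  move=> [w [b [-> H]]]; exists (row_mx (const_mx (r^-1 * (b - c^-1))) w).
    rewrite /phyperbolic /= mink_cons // mxE r2 exprMn exprVn r2.
    have -> : mink s w w = 2 * b - c * b ^+ 2 by rewrite -H addrK.
    by field; rewrite cn.
  rewrite !mul_row_col !const_mx11_mul (scalerA k) mulfV // scale1r /P /u; move: (w *m E) => e.
  by apply/rowP => i; rewrite !mxE; field; rewrite cn.
move=> [x Hx <-]; exists (rsubmx x), (c^-1 + r * lsubmx x 0 0); split.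
  rewrite mul_row_col const_mx11_mul (scalerA k) mulfV // scale1r.
  rewrite -{1}[x]hsubmxK mul_row_col {1}[lsubmx x]mx11_scalar mul_scalar_mx /P /u.
  move: (rsubmx x *m E) (lsubmx x 0 0) => e t.
  by apply/rowP => i; rewrite !mxE; field.
move: Hx; rewrite /phyperbolic /= -{1 2}[x]hsubmxK mink_cons r2 => H.
have -> : mink s (rsubmx x) (rsubmx x) = c^-1 + lsubmx x 0 0 ^+ 2.
  by move/eqP: H; rewrite opprK addrC subr_eq => /eqP.
move: (lsubmx x 0 0) => t; rewrite sqrrD exprMn r2; field.
by rewrite cn.
Qed.

End Negative.

(** There is no centre: the equation is linear in b, and the quadric is the paraboloid b = <w, w> /
    2, a graph over the whole of E^m_s. *)
Lemma model7_quadric : c = 0 ->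
  exists2 B : 'M[R]_(1 + (m + 1), N), B *m J *m B^T = signature_mx (1 + (m + 1)) s.+1 &
    umbilical_quadric = [set row_mx (c1 (mink s x x - 3 / 4))
                               (row_mx x (c1 (mink s x x - 5 / 4))) *m B | x in setT].
Proof.
move=> cE; have XX0 : dot X X = 0 by rewrite XX.
have fX : dot f X = -1 by rewrite dotC.
(* The two added vectors nu and mu solve nu + mu = X / 2 and 3 nu + 5 mu = - 4 f. *)
exists (col_mx (2 *: f + (5 / 4) *: X) (col_mx E (- 2 *: f + (- (3 / 4)) *: X))).
  apply: frame_cons; first apply: frame_snoc => //.
  - by move=> x; rewrite gram_formDr !gram_formZr Ef EX !mulr0 addr0.
  - rewrite gram_formDl !gram_formDr !gram_formZl !gram_formZr XX0 ff fX Xf.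
    by field.
  - move=> x; rewrite -[x]hsubmxK mul_row_col gram_formDl [rsubmx x]mx11_scalar mul_scalar_mx.
    rewrite gram_formZl gram_formDr !gram_formZr Ef EX.
    rewrite gram_formDl !gram_formDr !gram_formZl !gram_formZr XX0 ff fX Xf.
    by field.
  - rewrite gram_formDl !gram_formDr !gram_formZl !gram_formZr XX0 ff fX Xf.
    by field.
have id w q : row_mx (c1 (q - 3 / 4)) (row_mx w (c1 (q - 5 / 4))) *m
    col_mx (2 *: f + (5 / 4) *: X) (col_mx E (- 2 *: f + (- (3 / 4)) *: X)) =
    f + w *m E + (q / 2) *: X.
  rewrite !mul_row_col !const_mx11_mul; move: (w *m E) => e.
  by apply/rowP => i; rewrite !mxE; field.
apply/seteqP; split=> y /=.
  move=> [w [b [-> H]]]; exists w => //; rewrite id.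
  have -> : mink s w w / 2 = b by move: H; rewrite cE mul0r addr0 => ->; field.
  by [].
move=> [x _ <-]; exists x, (mink s x x / 2); split; first exact: id.
by rewrite cE mul0r addr0; field.
Qed.

End NormalForms.

(** * Linear isometries and transport of portions *)

Section LinearIsometry.
Context {R : realType}.

Lemma Ck_cst (V W : normedModType R) k (U : set V) (w : W) : Ck k U (cst w).
Proof.
elim: k w => [|k IH] w /=; split=> //; try by move=> x _; exact: cst_continuous.
move=> v; split=> [x _|]; first exact: derivable_cst.
by rewrite (_ : 'D_v (cst w) = cst 0) //; apply/funext => x; rewrite derive_cst.
Qed.

Lemma is_derive_mulmxr a b (A : 'M[R]_(a, b)) (x v : 'rV[R]_a) :
  is_derive x v (fun y => y *m A) (v *m A).
Proof.
have := is_derive_mulmx (is_derive_id x v) (is_derive_cst A x v).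
by rewrite mulmx0 addr0.
Qed.

Lemma differentiable_mulmxr a b (A : 'M[R]_(a, b)) (x : 'rV[R]_a) :
  differentiable (fun y : 'rV[R]_a => y *m A) x.
Proof. by apply: differentiable_mulmx => //; exact: differentiable_cst. Qed.

Lemma smooth_mulmxr a b (A : 'M[R]_(a, b)) (U : set 'rV[R]_a) :
  smooth_on U (fun x : 'rV[R]_a => x *m A).
Proof.
move=> k; have c x : {for x, continuous (fun x : 'rV[R]_a => x *m A)}.
  by apply: differentiable_continuous; exact: differentiable_mulmxr.
case: k => [|k] /=; split=> // v; split=> [x _|].
  by have [] := is_derive_mulmxr A x v.
rewrite (_ : 'D_v _ = cst (v *m A)); first exact: Ck_cst.
by apply/funext => x; have [_ ->] := is_derive_mulmxr A x v.
Qed.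

Lemma psphere_isometry_mulmx N p (A : 'M[R]_N) :
  A *m signature_mx N p *m A^T = signature_mx N p ->
  psphere_isometry p (fun x : 'rV[R]_N => x *m A).
Proof.
set J := signature_mx N p => AJA.
have uA : A \in unitmx.
  have : A *m J *m A^T \in unitmx by rewrite AJA signature_mx_unit.
  by rewrite !unitmx_mul => /andP[/andP[]].
have minkA x y : mink p (x *m A) (y *m A) = mink p x y.
  by rewrite !mink_gram gram_form_mul AJA.
have smooth (B : 'M[R]_N) : smooth_along (psphere p 1) (fun x : 'rV[R]_N => x *m B).
  by exists setT; split => //; [exact: openT|exact: smooth_mulmxr].
split; first exact: smooth.
split.
  exists (fun x => x *m invmx A); split; first exact: smooth.
    by move=> x Sx; split; [rewrite /psphere /= minkA|rewrite mulmxK].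
  move=> x Sx; split; last by rewrite mulmxKV.
  by rewrite /psphere /= -minkA mulmxKV.
move=> x v w _ _ _; have [_ ->] := is_derive_mulmxr A x v.
by have [_ ->] := is_derive_mulmxr A x w.
Qed.

End LinearIsometry.

Lemma component_image (S T : topologicalType) (h : S -> T) (g : T -> S)
    (Q : set S) (Q' : set T) (x : S) :
  continuous h -> continuous g -> (forall y, Q y -> Q' (h y) /\ g (h y) = y) ->
  (forall z, Q' z -> Q (g z) /\ h (g z) = z) -> Q x ->
  connected_component Q' (h x) = h @` connected_component Q x.
Proof.
move=> ch cg hg gh Qx; apply/seteqP; split.
  move=> z Cz; have Qz := connected_component_sub Cz; have [Qgz hgz] := gh z Qz.
  exists (g z) => //; have [_ <-] := hg x Qx.
  suff : g @` connected_component Q' (h x) `<=` connected_component Q (g (h x)).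
    by apply; exists z.
  apply: connected_component_max.
  - exists (h x) => //; apply: connected_component_refl.
    by have [] := hg x Qx.
  - move=> y [w Cw <-]; have Qw := connected_component_sub Cw.
    by have [] := gh w Qw.
  - apply: connected_continuous_connected; first exact: component_connected.
    exact: continuous_subspaceT.
apply: connected_component_max.
- by exists x => //; exact: connected_component_refl.
- move=> z [y Cy <-]; have Qy := connected_component_sub Cy.
  by have [] := hg y Qy.
- apply: connected_continuous_connected; first exact: component_connected.
  exact: continuous_subspaceT.
Qed.

Section Congruence.
Context {R : realType} {m s : nat} (M : pseudoRiemannian R m s) (n p : nat).
Variable phi : M -> 'rV[R]_n.+1.
Hypothesis pn : (p <= n.+1)%N.

Lemma congruent_portion (portion : forall T : topologicalType, set T -> set T -> Prop)
    a b q (Q O : set 'rV[R]_a) (F : 'rV[R]_a -> 'rV[R]_b) (B : 'M[R]_(b, n.+1)) :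
  (q <= b)%N -> B *m signature_mx n.+1 p *m B^T = signature_mx b q ->
  portion _ Q O -> range phi = [set F x *m B | x in O] ->
  congruent_to p phi portion q Q F.
Proof.
move=> qb BB QO rO; have [qp bp [A AJA AB]] := frame_extension pn qb BB.
split=> //; exists (fun x => x *m A), O; split=> //; first exact: psphere_isometry_mulmx.
by rewrite rO; apply: eq_imagel => x _; rewrite AB.
Qed.

(** The Gram relation gives B a right inverse and [pr] undoes F, so x |-> F x B is a homeomorphism
    of Q onto D, which carries open portions and components along. *)
Lemma congruent_models a b q (Q : set 'rV[R]_a) (F : 'rV[R]_a -> 'rV[R]_b)
    (pr : 'rV[R]_b -> 'rV[R]_a) (B : 'M[R]_(b, n.+1)) (D : set 'rV[R]_n.+1) :
  (q <= b)%N -> B *m signature_mx n.+1 p *m B^T = signature_mx b q ->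
  (forall x, differentiable F x) -> (forall x, differentiable pr x) -> cancel F pr ->
  D = [set F x *m B | x in Q] ->
  (forall V, open V -> range phi = D `&` V ->
     congruent_to p phi open_portion q Q F) /\
  (forall y, D y -> range phi = connected_component D y ->
     congruent_to p phi whole_portion q Q F).
Proof.
move=> qb BB dF dpr Fpr DE.
set J := signature_mx n.+1 p in BB.
pose h x := F x *m B; pose g y := pr (y *m (J *m B^T *m signature_mx b q)).
have gh x : g (h x) = x.
  rewrite /g /h !mulmxA -!(mulmxA (F x)) BB signature_mxK mulmx1.
  exact: Fpr.
have ch : continuous h.
  move=> x; apply: differentiable_continuous; apply: differentiable_mulmx; first exact: dF.
  exact: differentiable_cst.
have cg : continuous g.
  move=> y; apply: differentiable_continuous; apply: (differentiable_comp _ (dpr _)).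
  exact: differentiable_mulmxr.
split=> [V oV rV|y Dy rC].
  apply: (congruent_portion (O := Q `&` h @^-1` V) qb BB).
    by exists (h @^-1` V) => //; apply: open_comp => // x _; exact: ch.
  rewrite rV DE; apply/seteqP; split=> [_ [[x Qx <-] Vx]|_ [x [Qx Vx] <-]].
    by exists x.
  by split; [exists x|].
have [x Qx xy] : exists2 x, Q x & h x = y by move: Dy; rewrite DE => -[x Qx <-]; exists x.
apply: (congruent_portion (O := connected_component Q x) qb BB); first by exists x.
rewrite rC -xy; apply: (component_image ch cg) => // [z Qz|z].
  by rewrite gh DE; split => //; exists z.
rewrite DE => -[w Qw <-]; rewrite -/(h w) gh; by split.
Qed.

End Congruence.

Section DifferentiableBlocks.
Context {R : realType} {V : normedModType R}.

Lemma differentiable_row_mx a b (A : V -> 'rV[R]_a) (B : V -> 'rV[R]_b) x :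
  differentiable A x -> differentiable B x -> differentiable (fun y => row_mx (A y) (B y)) x.
Proof.
move=> dA dB; apply: differentiable_mx => i j; case: (split_ordP j) => j' ->.
  rewrite (_ : (fun _ => _) = fun y => A y i j'); first exact: differentiable_entry.
  by apply/funext => y; rewrite row_mxEl.
rewrite (_ : (fun _ => _) = fun y => B y i j'); first exact: differentiable_entry.
by apply/funext => y; rewrite row_mxEr.
Qed.

Lemma differentiable_mink k q (x : 'rV[R]_k) :
  differentiable (fun y : 'rV[R]_k => mink q y y) x.
Proof.
rewrite (_ : (fun _ => _) = fun y : 'rV[R]_k => (y *m signature_mx k q *m y^T) 0 0).
  apply: differentiable_entry; apply: differentiable_mulmx; last exact: differentiable_trmx.
  exact: differentiable_mulmxr.
by apply/funext => y; rewrite mink_gram.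
Qed.

End DifferentiableBlocks.

(** * Case analysis on the constant c *)

Section Classification.
Context {R : realType} {m s n p : nat} (M : pseudoRiemannian R m s).
Variable phi : M -> 'rV[R]_n.+1.
Hypothesis m2 : (2 <= m)%N.
Hypothesis mn : (m < n)%N.
Hypothesis phi_iso : isometric_immersion p phi.
Hypothesis phi_umb : totally_umbilical p phi.
Hypothesis M_conn : connected [set: M].
Local Notation J := (signature_mx n.+1 p : 'M[R]_n.+1).
Local Notation dot := (gram_form (signature_mx n.+1 p : 'M[R]_n.+1)).
Local Notation X := (normal_xi (p := p) phi).
Local Notation T := (tangent_frame phi).
Local Notation c x := (dot (X x) (X x)).
Local Notation quadric := (quadric (p := p) phi).

(** For p > n + 1 the form would be negative definite, and no point could have square 1. *)
Lemma index_bound (x : M) : (p <= n.+1)%N.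
Proof.
rewrite leqNgt; apply/negP => np; have := phi_norm phi_iso x.
rewrite signature_mxE => H.
have : (1 : R) <= 0.
  rewrite -H; apply: sumr_le0 => i _; rewrite (ltn_trans (ltn_ord i) np) mulN1r.
  by rewrite oppr_le0 sqr_ge0.
by rewrite ler10.
Qed.

(** Diagonalization of the Gram matrix of the tangent frame; by inertia its negative signs are s in
    number. *)
Lemma orthonormal_frame x : (s <= m)%N /\ exists E : 'M[R]_(m, n.+1),
  [/\ E *m J *m E^T = signature_mx m s, forall w, dot (w *m E) (phi x) = 0,
      forall w, dot (w *m E) (X x) = 0 &
      quadric x = umbilical_quadric (s := s) E (phi x) (X x) (c x)].
Proof.
have uG := frame_gram_unit phi_iso x.
have [K [k [km uK KGK]]] := signature_diagonalization (frame_gramT (p := p) phi x) uG.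
have ks := signature_index km uK KGK (frame_gram_index phi_iso x).
rewrite ks in km KGK; split=> //; exists (K *m T x).
have wE w : w *m (K *m T x) = (w *m K) *m T x by rewrite mulmxA.
split.
- by rewrite -KGK trmx_mul !mulmxA.
- by move=> w; rewrite wE; exact: (frame_normal_phi phi_iso).
- move=> w; rewrite wE gram_formC ?signature_mxT //.
  exact: (frame_normal_xi m2 phi_iso phi_umb).
have gE w : gram_form (T x *m J *m (T x)^T) (w *m K) (w *m K) = mink s w w.
  by rewrite gram_form_mul KGK mink_gram.
apply/seteqP; split=> y.
  move=> /(quadricP m2 phi_iso phi_umb)[v [b [-> vb]]].
  exists (v *m invmx K), b; rewrite wE mulmxKV //; split => //.
  by rewrite -gE mulmxKV.
move=> [w [b [-> wb]]]; apply/(quadricP m2 phi_iso phi_umb).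
by exists (w *m K), b; rewrite wE; split => //; rewrite gE.
Qed.

Lemma mean_curvatureE (k : chart R M m) u : atlas M k -> crange k u ->
  mean_curvature p phi k u = X (cpar k u) + phi (cpar k u).
Proof. by move=> kA Uu; rewrite (normal_xi_chart m2 phi_iso phi_umb kA Uu) /chart_xi subrK. Qed.

(** Expand H = xi + phi with <xi, phi> = -1 and <phi, phi> = 1. *)
Lemma mean_curvature_norm x : H_everywhere p phi (fun H => mink p H H = c x - 1).
Proof.
move=> k u kA Uu; rewrite mean_curvatureE // mink_gram.
rewrite (curvature_constant m2 phi_iso phi_umb M_conn x (cpar k u)).
have := normal_xi_phi m2 phi_iso phi_umb (cpar k u); have := phi_norm phi_iso (cpar k u).
move: (X _) (phi _) => a b bb ab.
rewrite gram_formDl !gram_formDr [dot b a]gram_formC ?signature_mxT // ab bb.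
by ring.
Qed.

(** For c = 1 the vector P is H itself, so P = 0 is the totally geodesic case. *)
Lemma mean_curvature_parallel x : c x = 1 ->
  H_everywhere p phi (fun H => H = X x + c x *: phi x).
Proof.
move=> cE k u kA Uu; rewrite mean_curvatureE //.
have := center_constant m2 phi_iso phi_umb M_conn (cpar k u) x; rewrite /center => <-.
by rewrite (curvature_constant m2 phi_iso phi_umb M_conn (cpar k u) x) cE scale1r.
Qed.

Lemma H_everywhere_impl (P Q : 'rV[R]_n.+1 -> Prop) : (forall H, P H -> Q H) ->
  H_everywhere p phi P -> H_everywhere p phi Q.
Proof. by move=> PQ HP k u kA Uu; exact/PQ/HP. Qed.

(** The notion of portion enters only through the hypothesis on congruence, so one case analysis
    serves the local and the complete statement. The cases c < 0, c = 0, 0 < c < 1 and c > 1 give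
    models (6), (7), (4) and (3); c = 1 gives (1), (2) or (5). *)
Lemma classified_of (x : M) (portion : forall T : topologicalType, set T -> set T -> Prop) :
  (forall a b q (Q : set 'rV[R]_a) (F : 'rV[R]_a -> 'rV[R]_b) (pr : 'rV[R]_b -> 'rV[R]_a)
     (B : 'M[R]_(b, n.+1)), (q <= b)%N ->
     B *m signature_mx n.+1 p *m B^T = signature_mx b q ->
     (forall x, differentiable F x) -> (forall x, differentiable pr x) -> cancel F pr ->
     quadric x = [set F x *m B | x in Q] -> congruent_to p phi portion q Q F) ->
  classified p phi portion.
Proof.
move=> cong; have [sm [E [EE Ef EX QE]]] := orthonormal_frame x.
have ff := phi_norm phi_iso x; have Xf := normal_xi_phi m2 phi_iso phi_umb x.
have cn := mean_curvature_norm x.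
have dl a b (y : 'rV[R]_(a + b)) : differentiable (lsubmx : 'rV[R]_(a + b) -> 'rV[R]_a) y.
  exact: differentiable_lsubmx.
have dr a b (y : 'rV[R]_(a + b)) : differentiable (rsubmx : 'rV[R]_(a + b) -> 'rV[R]_b) y.
  exact: differentiable_rsubmx.
have dsnoc a k (y : 'rV[R]_a) :
    differentiable (fun y : 'rV[R]_a => row_mx y (const_mx k : 'rV[R]_1)) y.
  by apply: differentiable_row_mx => //; exact: differentiable_cst.
have dcons a k (y : 'rV[R]_a) :
    differentiable (fun y : 'rV[R]_a => row_mx (const_mx k : 'rV[R]_1) y) y.
  by apply: differentiable_row_mx => //; exact: differentiable_cst.
have ea : m.+1 = (m + 1)%N by rewrite addn1.
have sle : (s <= m.+1)%N by exact: leq_trans sm (leqnSn m).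
have [c0|c0|c0] := ltgtP (c x) 0.
- have [B BB QB] := model6_quadric sm EE Ef EX ff Xf erefl c0 (erefl (1 + m)%N).
  do 5!right; left; exists (Num.sqrt (- c x))^-1; split.
  + by rewrite invr_gt0 sqrtr_gt0 oppr_gt0.
  + apply: (cong _ _ _ _ _ lsubmx B) => //.
    - by rewrite addn1 ltnS.
    - by move=> y; rewrite row_mxKl.
    - by rewrite QE QB.
  + by apply: H_everywhere_impl cn => H ->; lra.
- have [c1|c1|c1] := ltgtP (c x) 1.
  + have [B BB QB] := model4_quadric sm EE Ef EX ff Xf erefl c0 ea c1.
    do 3!right; left; exists (Num.sqrt (c x))^-1; split.
    * by rewrite invf_gt1 ?sqrtr_gt0 // -sqrtr1 ltr_sqrt.
    * apply: (cong _ _ _ _ _ rsubmx B) => //.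
      - by move=> y; rewrite row_mxKr.
      - by rewrite QE QB.
    * by apply: H_everywhere_impl cn => H ->; split; lra.
  + have [B BB QB] := model3_quadric sm EE Ef EX ff Xf erefl c0 ea c1.
    do 2!right; left; exists (Num.sqrt (c x))^-1; split.
    * by rewrite invr_gt0 sqrtr_gt0.
    * by rewrite invf_lt1 ?sqrtr_gt0 // -[X in X < _]sqrtr1 ltr_sqrt.
    * apply: (cong _ _ _ _ _ lsubmx B) => //.
      - exact: leq_trans sle (leq_addr _ _).
      - by move=> y; rewrite row_mxKl.
      - by rewrite QE QB.
    * by apply: H_everywhere_impl cn => H ->; rewrite subr_gt0.
  have HP := mean_curvature_parallel c1.
  have [P0|P0] := eqVneq (X x + c x *: phi x) 0.
    have H0 : H_everywhere p phi (fun H => H = 0) by apply: H_everywhere_impl HP => H ->.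
    have geod : totally_geodesic p phi.
      by move=> k u v w kA Uu; rewrite phi_umb // (H0 k u kA Uu) scaler0.
    have mN : (m + 1 < n.+1)%N by rewrite addn1 ltnS.
    have [[B BB QB]|[B BB QB]] := geodesic_quadric sm EE EX erefl c0 ea c1 P0 mN.
      left; split => //; apply: (cong _ _ _ _ _ lsubmx B) => //.
      - exact: leq_trans sle (leq_addr _ _).
      - by move=> y; rewrite row_mxKl.
      - by rewrite QE QB.
    right; left; split => //; apply: (cong _ _ _ _ _ rsubmx B) => //.
    - by move=> y; rewrite row_mxKr.
    - by rewrite QE QB.
  have [B BB QB] := model5_quadric sm EE Ef EX ff Xf erefl c0 ea c1 P0.
  do 4!right; left; split.
  + apply: (cong _ _ _ _ _ (lsubmx \o rsubmx) B) => //.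
    - by rewrite add1n ltnS; exact: leq_trans sle (leq_addr _ _).
    - by move=> y; apply: differentiable_row_mx => //; exact: differentiable_cst.
    - by move=> y; apply: differentiable_comp; [exact: dr|exact: dl].
    - by move=> y; rewrite /= row_mxKr row_mxKl.
    - by rewrite QE QB.
  + by apply: H_everywhere_impl HP => H ->; exact/eqP.
  + by apply: H_everywhere_impl cn => H ->; rewrite c1 subrr.
have [B BB QB] := model7_quadric sm EE Ef EX ff Xf erefl c0.
do 6!right; split.
  apply: (cong _ _ _ _ _ (lsubmx \o rsubmx) B) => //.
  - by rewrite add1n ltnS; exact: leq_trans sm (leq_addr _ _).
  - move=> y; have dm k : differentiable (fun y : 'rV[R]_m => const_mx (mink s y y - k) : 'rV[R]_1) y.
      apply: differentiable_mx => i j.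
      rewrite (_ : (fun _ => _) = fun y : 'rV[R]_m => mink s y y - k).
        apply: (@differentiableB _ _ _ (fun y : 'rV[R]_m => mink s y y) (cst k)).
          exact: differentiable_mink.
        exact: differentiable_cst.
      by apply/funext => z; rewrite mxE.
    by apply: differentiable_row_mx; [exact: dm|apply: differentiable_row_mx].
  - by move=> y; apply: differentiable_comp; [exact: dr|exact: dl].
  - by move=> y; rewrite /= row_mxKr row_mxKl.
  - by rewrite QE QB.
by apply: H_everywhere_impl cn => H ->; rewrite c0 sub0r.
Qed.

End Classification.

Theorem theorem8 (R : realType) (m n s p : nat) (hm : (2 <= m)%N) (hmn : (m < n)%N)
    (M : pseudoRiemannian R m s)
    (M_nonempty : ([set: M] !=set0)%classic)
    (M_connected : connected ([set: M])%classic)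
    (phi : M -> 'rV[R]_(n.+1))
    (phi_isometric : isometric_immersion p phi)
    (phi_umbilical : totally_umbilical p phi)
    (phi_full : full p phi) :
  classified p phi open_portion /\
  (geodesically_complete M -> classified p phi whole_portion).
Proof.
have [x _] := M_nonempty; have pn := index_bound phi_isometric x.
have Qx : quadric (p := p) phi x (phi x).
  exact: (quadric_phi hm phi_isometric phi_umbilical M_connected).
split.
  apply: (classified_of hm hmn phi_isometric phi_umbilical M_connected (x := x)).
  move=> a b q Q F pr B qb BB dF dpr Fpr DE.
  have [V oV rV] := range_open hm phi_isometric phi_umbilical M_connected x.
  by have [H _] := congruent_models phi pn qb BB dF dpr Fpr DE; exact: (H V).
move=> compl; apply: (classified_of hm hmn phi_isometric phi_umbilical M_connected (x := x)).
move=> a b q Q F pr B qb BB dF dpr Fpr DE.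
have [_ H] := congruent_models phi pn qb BB dF dpr Fpr DE; apply: (H (phi x)) => //.
exact: (range_component hm phi_isometric phi_umbilical M_connected).
Qed.
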